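(* Let $\Gamma$ be a finite simplicial connected $\mathcal{CFS}$ graph that is not a join, and let $H$ be a finitely generated join-free subgroup of the right-angled Coxeter group $G_\Gamma$. Then the subgroup divergence of $H$ in $G_\Gamma$ is exactly quadratic.
   Context: Right-angled Coxeter group: for a finite simplicial graph $\Gamma$ with vertex set $S$, $G_\Gamma$ is generated by $S$ with relations $s^2=1$ for $s\in S$ and $st=ts$ for adjacent $s,t$. For an induced subgraph $\Lambda$, $G_\Lambda\le G_\Gamma$ is the subgroup generated by the vertices of $\Lambda$. The join of two non-empty graphs is obtained by connecting every vertex of one to every vertex of the other. A join subgroup is $G_J$ with $J$ an induced subgraph decomposing as a join. A subgroup $H\le G_\Gamma$ is join-free if it is infinite and none of its infinite order elements are conjugate into a join subgroup. $\mathcal{CFS}$: for a non-join graph $\Gamma$, the four-cycle graph $\Gamma^4$ has as vertices the induced loops of length four (four-cycles) of $\Gamma$, two being adjacent if the corresponding four-cycles share a pair of non-adjacent vertices. The support of a subgraph $K$ of $\Gamma^4$ is the set of vertices of $\Gamma$ appearing in the four-cycles corresponding to vertices of $K$. $\Gamma$ is $\mathcal{CFS}$ if some component of $\Gamma^4$ has support equal to the whole vertex set of $\Gamma$. Subgroup divergence. For a geodesic space $X$, subspace $A$ and $r>0$: $N_r(A)=\{x: d(x,A)<r\}$, $\partial N_r(A)=\{x: d(x,A)=r\}$, $C_r(A)=X-N_r(A)$, and $d_r$ is the induced length metric on $C_r(A)$ (value $\infty$ if there is no connecting path). For $\rho\in(0,1]$ and integer $n\ge2$ define $\sigma^n_\rho\colon[0,\infty)\to[0,\infty]$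 by $\sigma^n_\rho(r)=\inf d_{\rho r}(x_1,x_2)$ over all $x_1,x_2\in\partial N_r(A)$ with $d_r(x_1,x_2)<\infty$ and $d(x_1,x_2)\ge nr$, and $\sigma^n_\rho(r)=\infty$ if there is no such pair. The subspace divergence of $A$ in $X$ is the family $\{\sigma^n_\rho\}$. The subgroup divergence of $H$ in a finitely generated group $G$ is the subspace divergence of $H$ in a Cayley graph of $G$ for a finite generating set (up to the equivalence below it does not depend on this choice). For functions $f,g\colon[0,\infty)\to[0,\infty]$, $f\preceq g$ means there are positive constants $A,B,C,D$ with $f(x)\le Ag(Bx)+Cx$ for all $x>D$. For families, $\{\delta^n_\rho\}\preceq\{\delta'^n_\rho\}$ means there are $L\in(0,1]$ and a positive integer $M$ with $\delta^n_{L\rho}\preceq\delta'^{Mn}_\rho$ for all $\rho,n$. Equivalence $\sim$ means $\preceq$ in both directions. A function $f$ is regarded as the constant family $\delta^n_\rho=f$. The subgroup divergence is (exactly) quadratic if the family is equivalent to a polynomial of degree two. *)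

(* Defs.v *)
From HB Require Import structures.
From mathcomp Require Import all_boot all_order all_algebra.
From mathcomp Require Import generic_quotient.

Set Implicit Arguments.
Unset Strict Implicit.
Unset Printing Implicit Defensive.

Import Order.TTheory GRing.Theory Num.Theory.

Section Graphs.
Context {T : finType} (e : rel T).

(* The subgraph induced by J decomposes as a join. *)
Definition is_join (J : {set T}) : Prop :=
  exists A B : {set T},
    [/\ A != set0, B != set0, [disjoint A & B], A :|: B = J &
        forall a b, a \in A -> b \in B -> e a b].

Definition is_join_graph : Prop := is_join [set: T].

(* A four-cycle is identified with its vertex set; for an induced loop of
   length four no information is lost. *)
Definition induced_four_cycle (Q : {set T}) : bool :=
  [exists a, exists b, exists c, exists d,
    [&& Q == [set a; b; c; d], uniq [:: a; b; c; d],
        e a b, e b c, e c d, e d a, ~~ e a c & ~~ e b d]].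

Definition four_cycle_adj (Q Q' : {set T}) : bool :=
  [&& induced_four_cycle Q, induced_four_cycle Q', Q != Q' &
      [exists x, exists y,
        [&& x != y, ~~ e x y, x \in Q :&: Q' & y \in Q :&: Q']]].

Definition four_cycle_component (Q : {set T}) : {set {set T}} :=
  [set Q' | connect four_cycle_adj Q Q'].

Definition CFS : Prop :=
  exists2 Q, induced_four_cycle Q & cover (four_cycle_component Q) = [set: T].

End Graphs.

From mathcomp Require Import all_classical all_reals all_analysis.
Import numFieldTopology.Exports.

Local Open Scope quotient_scope.

Local Open Scope classical_set_scope.
Local Open Scope ring_scope.

Section Subgroups.
Context {G : groupType}.
Local Open Scope group_scope.

Definition is_subgroup (H : set G) : Prop := group_closed [in H].

Definition subgroup_gen (A : set G) : set G := smallest is_subgroup A.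

Definition fin_gen (H : set G) : Prop :=
  exists A : seq G, H = subgroup_gen [set` A].

Definition infinite_order (g : G) : Prop :=
  forall n : nat, (0 < n)%N -> g ^+ n <> 1.

Lemma subgroup_genP (A : set G) : is_subgroup (subgroup_gen A).
Proof.
split; first by apply/mem_set => K [[K1 _] _]; exact: set_mem K1.
move=> x y /set_mem Ax /set_mem Ay; apply/mem_set => K KA.
have [[_ Kdiv] _] := KA.
by apply/set_mem/Kdiv; apply/mem_set; [exact: Ax|exact: Ay].
Qed.

End Subgroups.

(* The right-angled Coxeter group as a quotient of the free monoid on T: since
   the generators are involutions, formal inverses of letters are not needed.
   That the quotient has the universal property of the group presentation is
   racg_lift below. *)
Section RightAngledCoxeterGroup.
Context {T : finType} (e : rel T).

Inductive racg_eq : seq T -> seq T -> Prop :=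
| racg_eq_refl u : racg_eq u u
| racg_eq_sym u v : racg_eq u v -> racg_eq v u
| racg_eq_trans v u w : racg_eq u v -> racg_eq v w -> racg_eq u w
| racg_eq_square s u v : racg_eq (u ++ [:: s; s] ++ v) (u ++ v)
| racg_eq_comm s t u v :
    e s t -> racg_eq (u ++ [:: s; t] ++ v) (u ++ [:: t; s] ++ v).

Lemma racg_eq_ctx a b u v : racg_eq u v -> racg_eq (a ++ u ++ b) (a ++ v ++ b).
Proof.
elim=> {u v} [u|u v _ IH|v u w _ IH1 _ IH2|s u v|s t u v st].
- exact: racg_eq_refl.
- exact: racg_eq_sym.
- exact: racg_eq_trans IH1 IH2.
- by have := racg_eq_square s (a ++ u) (v ++ b); rewrite -!catA.
- by have := racg_eq_comm (a ++ u) (v ++ b) st; rewrite -!catA.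
Qed.

Lemma racg_eq_cat u u' v v' :
  racg_eq u u' -> racg_eq v v' -> racg_eq (u ++ v) (u' ++ v').
Proof.
move=> uu' vv'; apply: (@racg_eq_trans (u' ++ v)).
  exact: (racg_eq_ctx [::] v uu').
by have := racg_eq_ctx u' [::] vv'; rewrite !cats0.
Qed.

Lemma racg_eq_rev u v : racg_eq u v -> racg_eq (rev u) (rev v).
Proof.
elim=> {u v} [u|u v _ IH|v u w _ IH1 _ IH2|s u v|s t u v st].
- exact: racg_eq_refl.
- exact: racg_eq_sym.
- exact: racg_eq_trans IH1 IH2.
- by rewrite !rev_cat -catA; exact: racg_eq_square.
- rewrite !rev_cat -!catA; apply: racg_eq_sym; exact: racg_eq_comm.
Qed.

Lemma racg_eq_revl u : racg_eq (rev u ++ u) [::].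
Proof.
elim: u => [|s u IH]; first exact: racg_eq_refl.
apply: racg_eq_trans IH; rewrite rev_cons -cats1 -catA.
exact: racg_eq_square.
Qed.

Definition racg_eqb (u v : seq T) : bool := `[< racg_eq u v >].

Lemma racg_eqb_refl : reflexive racg_eqb.
Proof. by move=> u; apply/asboolP; exact: racg_eq_refl. Qed.

Lemma racg_eqb_sym : symmetric racg_eqb.
Proof.
by move=> u v; apply/idP/idP => /asboolP uv; apply/asboolP; exact: racg_eq_sym.
Qed.

Lemma racg_eqb_trans : transitive racg_eqb.
Proof.
by move=> v u w /asboolP uv /asboolP vw; apply/asboolP; exact: racg_eq_trans vw.
Qed.

Canonical racg_equiv : equiv_rel (seq T) :=
  EquivRel racg_eqb racg_eqb_refl racg_eqb_sym racg_eqb_trans.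

Definition racg := {eq_quot racg_equiv}.

HB.instance Definition _ := Choice.on racg.
HB.instance Definition _ := EqQuotient.on racg.

Definition racg_word (u : seq T) : racg := \pi_racg u.

Lemma racg_wordP u v : racg_word u = racg_word v <-> racg_eq u v.
Proof.
split=> [/eqP|uv]; first by rewrite /racg_word eqmodE => /asboolP.
by apply/eqP; rewrite /racg_word eqmodE; apply/asboolP.
Qed.

Lemma racg_word_repr (x : racg) : racg_word (repr x) = x.
Proof. exact: reprK. Qed.

Lemma repr_racg_word u : racg_eq (repr (racg_word u)) u.
Proof. by apply/racg_wordP; rewrite racg_word_repr. Qed.

Definition racg_one : racg := racg_word [::].
Definition racg_inv (x : racg) : racg := racg_word (rev (repr x)).
Definition racg_mul (x y : racg) : racg := racg_word (repr x ++ repr y).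

Lemma racg_mul_word u v :
  racg_mul (racg_word u) (racg_word v) = racg_word (u ++ v).
Proof. by apply/racg_wordP/racg_eq_cat; exact: repr_racg_word. Qed.

Lemma racg_mulA : associative racg_mul.
Proof.
move=> x y z; rewrite -(racg_word_repr x) -(racg_word_repr y).
by rewrite -(racg_word_repr z) !racg_mul_word catA.
Qed.

Lemma racg_mul1 : left_id racg_one racg_mul.
Proof. by move=> x; rewrite -(racg_word_repr x) racg_mul_word. Qed.

Lemma racg_mulr1 : right_id racg_one racg_mul.
Proof. by move=> x; rewrite -(racg_word_repr x) racg_mul_word cats0. Qed.

Lemma racg_mulV : left_inverse racg_one racg_inv racg_mul.
Proof.
move=> x; rewrite -{2}(racg_word_repr x) racg_mul_word.
by apply/racg_wordP; exact: racg_eq_revl.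
Qed.

Lemma racg_mulrV : right_inverse racg_one racg_inv racg_mul.
Proof.
move=> x; rewrite -{1}(racg_word_repr x) racg_mul_word.
by apply/racg_wordP; rewrite -{1}(revK (repr x)); exact: racg_eq_revl.
Qed.

HB.instance Definition _ := isGroup.Build racg
  racg_mulA racg_mul1 racg_mulr1 racg_mulV racg_mulrV.

Definition racg_gen (s : T) : racg := racg_word [:: s].

Definition special_subgroup (J : {set T}) : set racg :=
  subgroup_gen (racg_gen @` [set` J]).

Local Open Scope group_scope.

Lemma racg_gen_square s : racg_gen s * racg_gen s = 1.
Proof.
transitivity (racg_word [:: s; s]); first exact: racg_mul_word.
by apply/racg_wordP; exact: (racg_eq_square s [::] [::]).
Qed.

Lemma racg_gen_comm s t :
  e s t -> racg_gen s * racg_gen t = racg_gen t * racg_gen s.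
Proof.
move=> st; transitivity (racg_word [:: s; t]); first exact: racg_mul_word.
transitivity (racg_word [:: t; s]); last exact/esym/racg_mul_word.
by apply/racg_wordP; exact: (racg_eq_comm [::] [::] st).
Qed.

Lemma racg_word_prod u : racg_word u = \prod_(s <- u) racg_gen s.
Proof.
elim: u => [|s u IH]; first by rewrite big_nil.
by rewrite big_cons -IH; exact/esym/(racg_mul_word [:: s]).
Qed.

Lemma racg_lift (K : groupType) (f : T -> K) :
  (forall s, f s * f s = 1) ->
  (forall s t, e s t -> f s * f t = f t * f s) ->
  exists! F : racg -> K,
    {morph F : x y / x * y} /\ (forall s, F (racg_gen s) = f s).
Proof.
move=> fsq fcomm; pose F (x : racg) := \prod_(s <- repr x : seq T) f s.
have FP u v : racg_eq u v -> \prod_(s <- u) f s = \prod_(s <- v) f s.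
  elim=> {u v} [//|//|u v w _ -> //|s u v|s t u v st].
    by rewrite !big_cat !big_cons big_nil /= mulg1 fsq mul1g.
  by rewrite !big_cat !big_cons !big_nil /= !mulg1 fcomm.
have Fw u : F (racg_word u) = \prod_(s <- u) f s by exact/FP/repr_racg_word.
have FM : {morph F : x y / x * y}.
  move=> x y; transitivity (F (racg_word (repr x ++ repr y))) => //.
  by rewrite Fw big_cat.
have Fg s : F (racg_gen s) = f s by rewrite Fw big_seq1.
exists F; split=> // F' [F'M F'g]; apply/funext => x.
have F'1 : F' 1 = 1 by apply: (@mulgI _ (F' 1)); rewrite -F'M !mulg1.
rewrite -(racg_word_repr x) Fw racg_word_prod (big_morph F' F'M F'1).
by apply: eq_bigr => s _; rewrite F'g.
Qed.

Definition join_free (H : set racg) : Prop :=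
  infinite_set H /\
  forall h, H h -> infinite_order h ->
    ~ exists J : {set T}, is_join e J /\ exists x, special_subgroup J (h ^ x).

End RightAngledCoxeterGroup.

Record cgraph := CGraph {
  vertex :> choiceType;
  adj : rel vertex;
  adj_sym : symmetric adj;
  adj_irr : irreflexive adj;
  adj_conn : forall u v, exists2 p, path adj u p & last u p = v }.

(* The geometric realization of a connected graph, with all edges of length
   one: points are given by barycentric coordinates, and the distance is the
   infimum of the lengths of the strings of points whose consecutive members
   lie on a common edge. *)
Section Realization.
Context {R : realType}.

Definition on_edge (V : eqType) (a b : V) (x : V -> R) : Prop :=
  exists2 t : R, 0 <= t <= 1 &
    forall v, x v = (1 - t) * (v == a)%:R + t * (v == b)%:R.

(* The case a = b only serves the graph that consists of a single vertex. *)
Record realization (X : cgraph) := RPoint {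
  bary :> X -> R;
  baryP : exists a b : X, (a = b \/ adj a b) /\ on_edge a b bary }.

Context {X : cgraph}.
Local Notation "|X|" := (realization X).

HB.instance Definition _ := gen_eqMixin |X|.
HB.instance Definition _ := gen_choiceMixin |X|.

Lemma bary_inj (x y : |X|) : x =1 y -> x = y.
Proof.
case: x y => [x xP] [y yP] /= /funext xy; subst y.
by congr RPoint; exact: Prop_irrelevance.
Qed.

Lemma rvertex_subproof (a : X) :
  exists b c : X, (b = c \/ adj b c) /\
    on_edge b c (fun v => (v == a)%:R).
Proof.
exists a, a; split; first by left.
exists 0 => [|v]; first by rewrite lexx ler01.
by rewrite subr0 mul1r mul0r addr0.
Qed.

Definition rvertex (a : X) : |X| := RPoint (rvertex_subproof a).

(* On the edge ab, the coordinate of a is one minus the distance to a. *)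
Inductive string : |X| -> |X| -> R -> Prop :=
| string_nil x : string x x 0
| string_cons (a b : X) (x y z : |X|) l :
    adj a b -> on_edge a b x -> on_edge a b y ->
    string y z l -> string x z (`|x a - y a| + l).

Definition rdist (x y : |X|) : R := inf (string x y).

Lemma on_edge_sym (a b : X) x : on_edge a b x -> on_edge b a x.
Proof.
move=> [t /andP[t0 t1] xE]; exists (1 - t) => [|v].
  by rewrite subr_ge0 t1 lerBlDr lerDl t0.
by rewrite xE subKr addrC.
Qed.

Lemma on_edge_dist (a b : X) (x y : X -> R) : a != b ->
  on_edge a b x -> on_edge a b y ->
  forall v, `|x v - y v| <= `|x a - y a|.
Proof.
move=> ab [t _ xE] [s _ yE] v; rewrite !xE !yE eqxx (negbTE ab) /=.
rewrite !mulr1 !mulr0 !addr0.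
have [->|va] := eqVneq v a; first by rewrite (negbTE ab) !mulr1 !mulr0 !addr0.
rewrite !mulr0 !add0r; case: (v == b); last by rewrite !mulr0 subrr normr0.
by rewrite !mulr1 opprB [X in _ <= `|X|]addrC subrKA distrC.
Qed.

Lemma on_edge_distC (a b : X) (x y : X -> R) : a != b ->
  on_edge a b x -> on_edge a b y -> `|x b - y b| = `|x a - y a|.
Proof.
move=> ab xab yab; apply/le_anti/andP; split.
  exact: (on_edge_dist ab xab yab).
have ba : b != a by rewrite eq_sym.
by apply: (on_edge_dist ba); exact: on_edge_sym.
Qed.

Lemma adj_neq (a b : X) : adj a b -> a != b.
Proof. by apply: contraTneq => ->; rewrite adj_irr. Qed.

Lemma string_cat x y z l m :
  string x y l -> string y z m -> string x z (l + m).
Proof.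
elim=> {x y l} [x|a b x y w l ab xab yab _ IH] yz; first by rewrite add0r.
by rewrite -addrA; apply: string_cons ab xab yab (IH yz).
Qed.

Lemma string1 (a b : X) (x y : |X|) :
  adj a b -> on_edge a b x -> on_edge a b y -> string x y `|x a - y a|.
Proof.
move=> ab xab yab; rewrite -[`|_|]addr0.
exact: string_cons ab xab yab (string_nil y).
Qed.

Lemma string_rev x y l : string x y l -> string y x l.
Proof.
elim=> {x y l} [x|a b x y z l ab xab yab _ IH]; first exact: string_nil.
rewrite addrC; apply: string_cat IH _; rewrite distrC.
exact: string1 ab yab xab.
Qed.

Lemma string_bound x y l : string x y l -> forall v, `|x v - y v| <= l.
Proof.
elim=> {x y l} [x|a b x y z l ab xab yab _ IH] v; first by rewrite subrr normr0.
rewrite (le_trans (ler_distD (y v) _ _))// lerD//.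
exact: on_edge_dist (adj_neq ab) xab yab v.
Qed.

Lemma string_ge0 x y l : string x y l -> 0 <= l.
Proof.
by case: (baryP x) => a _ /string_bound/(_ a); apply: le_trans; rewrite normr_ge0.
Qed.

Lemma on_edgel (a b : X) : on_edge a b (rvertex a).
Proof.
exists 0 => [|v]; first by rewrite lexx ler01.
by rewrite subr0 mul1r mul0r addr0.
Qed.

Lemma string_vertex (x : |X|) : exists a l, string x (rvertex a) l.
Proof.
have [a [b [[<-|ab] xab]]] := baryP x; exists a; last first.
  by exists `|x a - rvertex a a|; apply: string1 ab xab (on_edgel a b).
have -> : x = rvertex a; last by exists 0; exact: string_nil.
apply: bary_inj => v; have [t _ ->] := xab.
by rewrite -mulrDl subrK mul1r.
Qed.

Lemma string_vertices (a b : X) : exists l, string (rvertex a) (rvertex b) l.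
Proof.
have [p + <-] := adj_conn a b.
elim: p a => [a _|c p IH a /= /andP[ac /IH[l cl]]].
  by exists 0; exact: string_nil.
eexists; apply: string_cons ac (on_edgel a c) _ cl.
exact/on_edge_sym/on_edgel.
Qed.

Lemma string_ex (x y : |X|) : string x y !=set0.
Proof.
have [a [l xa]] := string_vertex x; have [b [m yb]] := string_vertex y.
have [n ab] := string_vertices a b; exists (l + (n + m)).
by apply: string_cat xa _; apply: string_cat ab _; exact: string_rev.
Qed.

Lemma rdist_le x y l : string x y l -> rdist x y <= l.
Proof.
by move=> xy; apply: ge_inf => //; exists 0 => m; exact: string_ge0.
Qed.

Lemma rdistxx x : rdist x x = 0.
Proof.
apply/le_anti; rewrite rdist_le/=; last exact: string_nil.
by apply: lb_le_inf; [exact: string_ex|move=> l; exact: string_ge0].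
Qed.

Lemma rdist_positivity x y : rdist x y = 0 -> x = y.
Proof.
move=> xy; apply: bary_inj => v; apply/eqP; rewrite -subr_eq0 -normr_le0 -xy.
by apply: lb_le_inf; [exact: string_ex|move=> l /string_bound].
Qed.

Lemma rdist_sym x y : rdist x y = rdist y x.
Proof. by congr inf; apply/seteqP; split=> l; exact: string_rev. Qed.

Lemma rdist_triangle y x z : rdist x z <= rdist x y + rdist y z.
Proof.
rewrite -lerBlDr; apply: lb_le_inf; first exact: string_ex.
move=> l xy; rewrite lerBlDr -lerBlDl; apply: lb_le_inf; first exact: string_ex.
by move=> m yz; rewrite lerBlDl; apply: rdist_le; exact: string_cat yz.
Qed.

HB.instance Definition _ := isMetric.Build R |X|
  rdistxx rdist_positivity rdist_sym rdist_triangle.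

End Realization.

Arguments realization R X : clear implicits.
Arguments rvertex R {X} a.

Section CayleyGraph.
Context {G : groupType} (S : seq G).
Local Open Scope group_scope.

Definition cayley_adj (g h : G) : bool :=
  (g != h) && ((g^-1 * h \in S) || (h^-1 * g \in S)).

Lemma cayley_adj_sym : symmetric cayley_adj.
Proof. by move=> g h; rewrite /cayley_adj eq_sym orbC. Qed.

Lemma cayley_adj_irr : irreflexive cayley_adj.
Proof. by move=> g; rewrite /cayley_adj eqxx. Qed.

Hypothesis S_gen : subgroup_gen [set` S] = [set: G].

Lemma cayley_adj_conn (g h : G) :
  exists2 p, path cayley_adj g p & last g p = h.
Proof.
pose K : set G := [set k | forall g, exists2 p, path cayley_adj g p
                                              & last g p = g * k].
suff KT : [set: G] `<=` K by have := KT (g^-1 * h) I g; rewrite mulVKg.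
rewrite -S_gen; apply: smallest_sub => [|s /= sS] {g h}; last first.
  move=> g; have [s1|s1] := eqVneq s 1; first by exists [::]; rewrite ?s1 ?mulg1.
  exists [:: g * s] => //=; rewrite andbT /cayley_adj mulKg sS andbT.
  by apply: contra_neq s1 => /esym; rewrite -[RHS]mulg1 => /mulgI.
split; first by apply/mem_set => g; exists [::]; rewrite ?mulg1.
move=> x y /set_mem Kx /set_mem Ky; apply/mem_set => g.
have [p gp pE] := Kx g; have [q gq qE] := Ky (g * (x / y)).
exists (p ++ rev (belast (g * (x / y)) q)).
  rewrite cat_path gp pE /=; have := rev_path cayley_adj (g * (x / y)) q.
  rewrite qE -mulgA mulgVK => ->.
  by rewrite (eq_path (e' := cayley_adj)) // => a b; rewrite cayley_adj_sym.
rewrite last_cat pE; case: q qE {gq} => /= [->|a q _]; first by rewrite -mulgA mulgVK.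
by rewrite rev_cons last_rcons.
Qed.

Definition cayley_graph : cgraph :=
  CGraph cayley_adj_sym cayley_adj_irr cayley_adj_conn.

End CayleyGraph.

Section SubspaceDivergence.
Context {R : realType} {X : metricType R}.
Local Open Scope ereal_scope.

Definition path_length (g : R -> X) : \bar R :=
  ereal_sup [set (\sum_(0 <= i < size s)
      mdist (g (nth 1 (0 :: s) i)) (g (nth 1 (0 :: s) i.+1)))%R%:E
    | s in itv_partition (0 : R)%R 1%R].

Definition path_in (C : set X) (x y : X) (g : R -> X) : Prop :=
  [/\ {within `[0%R, 1%R], continuous g}, g 0%R = x, g 1%R = y &
      g @` `[0%R, 1%R] `<=` C].

Definition length_dist (C : set X) (x y : X) : \bar R :=
  ereal_inf [set path_length g | g in path_in C x y].

Variable A : set X.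

Definition nbhd_frontier (r : R) : set X := [set x | edist_inf A x = r%:E].
Definition nbhd_compl (r : R) : set X := ~` [set x | edist_inf A x < r%:E].

Definition subspace_divergence (rho : R) (n : nat) (r : R) : \bar R :=
  ereal_inf [set length_dist (nbhd_compl (rho * r)%R) p.1 p.2 | p in
    [set p : X * X | [/\ nbhd_frontier r p.1, nbhd_frontier r p.2,
      length_dist (nbhd_compl r) p.1 p.2 < +oo & (n%:R * r <= mdist p.1 p.2)%R]]].

End SubspaceDivergence.

(* Functions on [0, oo) are represented by functions on R; their values at
   negative arguments play no role below. *)
Section Growth.
Context {R : realType}.
Implicit Types (f g : R -> \bar R) (delta : R -> nat -> R -> \bar R).

Definition fun_preceq f g : Prop :=
  exists A B C D : R, [/\ 0 < A, 0 < B, 0 < C & 0 < D] /\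
    forall x, D < x -> (f x <= A%:E * g (B * x)%R + (C * x)%:E)%E.

Definition family_preceq delta delta' : Prop :=
  exists (L : R) (M : nat), [/\ 0 < L, L <= 1 & (0 < M)%N] /\
    forall (rho : R) (n : nat), 0 < rho <= 1 -> (2 <= n)%N ->
      fun_preceq (delta (L * rho) n) (delta' rho (M * n)%N).

Definition family_equiv delta delta' : Prop :=
  family_preceq delta delta' /\ family_preceq delta' delta.

Definition exactly_quadratic delta : Prop :=
  exists p : {poly R}, [/\ size p = 3%N, forall x, 0 <= x -> 0 <= p.[x] &
    family_equiv delta (fun _ _ x => (p.[x])%:E)].

End Growth.

Definition subgroup_divergence (R : realType) (G : groupType) (S : seq G)
    (S_gen : subgroup_gen [set` S] = [set: G]) (H : set G) :
    R -> nat -> R -> \bar R :=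
  subspace_divergence (rvertex R (X := cayley_graph S_gen) @` H).

(* Main.v *)
Require Import Defs.
From mathcomp Require Import all_boot all_order all_algebra.
From mathcomp Require Import all_classical all_reals all_analysis.
From mathcomp Require Import perm generic_quotient ring lra zify.

(* Walls are the reflections [x s x^-1]; the word metric counts separating walls.
   Elements of H stabilising a wall, or a coset of a join subgroup, form a finite
   set, because an infinite subgroup contains two elements with the same image in
   the abelianisation, whose quotient has infinite order.  Hence a geodesic of H
   crosses a given wall only during a bounded time, and projecting it to the
   interval between 1 and h yields, for every h in H, a reduced word of h that
   stays near H and whose factors in join subgroups are bounded.

   It follows that only boundedly many of the walls separating two elements of H
   cross any given wall K: otherwise the walls crossing K and those separating 1
   from K would fill a long factor and cross each other, making the labels of
   that factor span a join.

   Lower bound: walls far enough apart along the word of h are nested and no wall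
   crosses two of them, so between two of them a path at distance r from H travels
   a distance of order r, and it meets a number of them of order r.  Upper bound:
   the flats of the four-cycles at the points of the word of h leave H linearly;
   going around them at distance of order r, and from flat to flat along the
   four-cycle graph, costs of order r at each of the points of the word, whose
   number is of order r. *)

Set Implicit Arguments.
Unset Strict Implicit.
Unset Printing Implicit Defensive.

(** * Walls and the word metric *)

(** The obstacle is that no convexity of [H] is assumed: a path that is short in the generators of
    [H] need not be close to a geodesic of [G]. Its place is taken by one uniform constant, the
    number of walls separating two elements of [H] that can cross one given wall. It is uniform
    because, up to translation by [H], only finitely many cosets of join subgroups pass within a
    given distance of [1], so that finiteness of each intersection becomes a common bound. The
    constant serves twice: it fixes the spacing of the chain of walls in the lower bound, and in the
    upper bound it says how many walls of an alternating word may fail to count towards the distance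
    from [H]. All counting is done in the word metric of the standard generators; the Cayley graph
    of an arbitrary finite generating set enters only at the end, through a bilipschitz comparison
    on the vertices. *)

Record sgraph (T : finType) := SGraph {
  edge :> rel T;
  edge_sym : symmetric edge;
  edge_irr : irreflexive edge }.

Section Walls.
Context (T : finType) (X : sgraph T).
Local Notation e := (edge X).
Local Notation e_sym := (@edge_sym T X).
Local Notation e_irr := (@edge_irr T X).
Local Open Scope group_scope.
Local Notation G := (racg e).
Local Notation word := (@racg_word T e).
Local Notation gen := (@racg_gen T e).

Lemma word_cat u v : word (u ++ v) = word u * word v.
Proof. exact/esym/racg_mul_word. Qed.

Lemma word_cons s u : word (s :: u) = gen s * word u.
Proof. exact: (word_cat [:: s]). Qed.

Lemma word_nil : word [::] = 1.
Proof. by []. Qed.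

Lemma gen_inv s : (gen s)^-1 = gen s.
Proof. by apply/esym/eqP; rewrite -mulg_eq1; apply/eqP; exact: racg_gen_square. Qed.

Lemma word_rev u : word (rev u) = (word u)^-1.
Proof.
elim: u => [|s u IH]; first by rewrite invg1.
by rewrite rev_cons -cats1 word_cat IH (word_cons s u) invgM gen_inv.
Qed.

(** It exchanges [x] and [x * gen s]. Encoded in this way, walls are compared by an equality in [G]:
    both ends of an edge give the same element, and so do opposite edges of a square ([wall_gen],
    [wall_comm]). *)
Definition wall (x : G) (s : T) : G := x * gen s * x^-1.

Lemma wall_mul g x s : wall (g * x) s = g * wall x s * g^-1.
Proof. by rewrite /wall invgM !mulgA. Qed.

Lemma genK x s : x * gen s * gen s = x.
Proof. by rewrite -mulgA racg_gen_square mulg1. Qed.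

Lemma wall_gen x s : wall (x * gen s) s = wall x s.
Proof. by rewrite /wall invgM gen_inv genK mulgA. Qed.

Lemma wall_comm x s t : e s t -> wall (x * gen s) t = wall x t.
Proof.
move=> st; rewrite /wall invgM gen_inv mulgA -(mulgA x) (racg_gen_comm st).
by rewrite mulgA genK.
Qed.

Fixpoint crossed (x : G) (u : seq T) : seq G :=
  if u is s :: u' then wall x s :: crossed (x * gen s) u' else [::].

Lemma size_crossed x u : size (crossed x u) = size u.
Proof. by elim: u x => //= s u IH x; rewrite IH. Qed.

Lemma crossed_cat x u v :
  crossed x (u ++ v) = crossed x u ++ crossed (x * word u) v.
Proof.
elim: u x => [|s u IH] x /=; first by rewrite mulg1.
by rewrite IH word_cons mulgA.
Qed.

Lemma crossed_mul g x u :
  crossed (g * x) u = [seq g * r * g^-1 | r <- crossed x u].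
Proof. by elim: u x => //= s u IH x; rewrite wall_mul -(mulgA g x) IH. Qed.

Lemma nth_crossed r0 x u i s0 : (i < size u)%N ->
  nth r0 (crossed x u) i = wall (x * word (take i u)) (nth s0 u i).
Proof.
elim: u x i => [//|s u IH] x [|i] /=; first by rewrite mulg1.
by move=> iu; rewrite IH// word_cons mulgA.
Qed.

Lemma crossed_wall r x u : r \in crossed x u ->
  exists u1 s u2, u = u1 ++ s :: u2 /\ r = wall (x * word u1) s.
Proof.
elim: u x => [//|s u IH] x /=; rewrite inE => /orP[/eqP->|].
  by exists [::], s, u; rewrite mulg1.
move=> /IH[u1 [t [u2 [-> ->]]]]; exists (s :: u1), t, u2.
by rewrite word_cons mulgA.
Qed.

(* With colours in [bool] this gives the parity of the crossings of a wall; with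
   colours in a symmetric group it detects the order in which two walls are
   crossed. *)
Lemma crossed_prod (K : Type) (idx : K) (op : Monoid.law idx) (f : G -> K) :
  (forall r, op (f r) (f r) = idx) ->
  (forall x s t, e s t ->
     op (f (wall x s)) (f (wall x t)) = op (f (wall x t)) (f (wall x s))) ->
  forall u v, racg_eq e u v -> forall x,
  \big[op/idx]_(r <- crossed x u) f r = \big[op/idx]_(r <- crossed x v) f r.
Proof.
move=> fsq fcomm u v; elim=> {u v} [//|u v _ IH x|u v w _ IH1 _ IH2 x|s u v x|s t u v st x].
- by rewrite IH.
- by rewrite IH1.
- rewrite !crossed_cat !big_cat /= !big_cons big_nil Monoid.mulm1.
  rewrite wall_gen fsq Monoid.mul1m.
  suff -> : x * word u * word [:: s; s] = x * word u by [].
  by rewrite !word_cons word_nil mulg1 racg_gen_square mulg1.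
- rewrite !crossed_cat !big_cat /= !big_cons big_nil !Monoid.mulm1.
  rewrite (wall_comm _ st) wall_comm 1?e_sym// fcomm//.
  suff -> : word [:: s; t] = word [:: t; s] by [].
  by rewrite !word_cons word_nil !mulg1 racg_gen_comm.
Qed.

(** The half-space of [r] that contains [x], with [false] for the one of [1]. Any element of [G] is
    allowed as [r]; one that is not a reflection is never crossed and has all points on one side. *)
Definition side (x r : G) : bool := odd (count_mem r (crossed 1 (repr x))).

Lemma odd_count (r : G) u : odd (count_mem r u) = \big[addb/false]_(q <- u) (q == r).
Proof.
elim: u => [|q u IH]; first by rewrite big_nil.
by rewrite big_cons /= oddD IH oddb.
Qed.

Lemma racg_eq_count u v : racg_eq e u v -> forall x r,
  odd (count_mem r (crossed x u)) = odd (count_mem r (crossed x v)).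
Proof.
move=> uv x r; rewrite !odd_count.
apply: (@crossed_prod _ false addb (fun q => q == r)) uv x => [q|x s t _].
  exact: addbb.
exact: addbC.
Qed.

Lemma side_word u r : side (word u) r = odd (count_mem r (crossed 1 u)).
Proof. exact/racg_eq_count/repr_racg_word. Qed.

Lemma side_mul_word x u r :
  side (x * word u) r = side x r (+) odd (count_mem r (crossed x u)).
Proof.
rewrite -(racg_word_repr x) -word_cat !side_word crossed_cat count_cat oddD.
by rewrite mul1g.
Qed.

Lemma side_gen x s r : side (x * gen s) r = side x r (+) (wall x s == r).
Proof. by rewrite (side_mul_word x [:: s]) /= addn0 oddb. Qed.

Definition sep (x y r : G) : bool := side x r (+) side y r.

Lemma sep_word x u r : sep x (x * word u) r = odd (count_mem r (crossed x u)).
Proof. by rewrite /sep side_mul_word addKb. Qed.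

Lemma sep_sym x y r : sep x y r = sep y x r.
Proof. exact: addbC. Qed.

Lemma sepxx x r : sep x x r = false.
Proof. exact: addbb. Qed.

Lemma sep_trans y x z r : sep x z r = sep x y r (+) sep y z r.
Proof. by rewrite /sep addbA addbK. Qed.

Lemma conj_eq g r q : (g * q * g^-1 == g * r * g^-1) = (q == r :> G).
Proof. by rewrite (inj_eq (@mulIg _ _)) (inj_eq (@mulgI _ _)). Qed.

Lemma sep_mul g x y r : sep (g * x) (g * y) (g * r * g^-1) = sep x y r.
Proof.
rewrite -{1}(mulVKg x y) mulgA -(racg_word_repr (x^-1 * y)) sep_word crossed_mul.
rewrite -{2}(mulVKg x y) -{2}(racg_word_repr (x^-1 * y)) sep_word.
rewrite count_map; congr odd; apply: eq_count => q /=; exact: conj_eq.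
Qed.

Lemma sep_gen x s r : sep x (x * gen s) r = (wall x s == r).
Proof. by rewrite /sep side_gen addKb. Qed.


Definition reduced u := uniq (crossed 1 u).

Lemma reduced_crossed x u : uniq (crossed x u) = reduced u.
Proof.
rewrite -{1}(mulg1 x) crossed_mul map_inj_uniq // => r q /eqP.
by rewrite conj_eq => /eqP.
Qed.

Lemma reduced_cat u v : reduced (u ++ v) -> reduced u /\ reduced v.
Proof.
by rewrite /reduced crossed_cat cat_uniq (reduced_crossed _ v) => /and3P[].
Qed.

(** The deletion condition: if the wall of a letter [s] is crossed again at a letter [t], the factor
    between them conjugates [t] to [s], so both letters cancel. *)
Lemma not_reduced_delete u : ~~ reduced u ->
  exists v, word v = word u /\ size u = (size v).+2.
Proof.
elim: u => [//|s u IH].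
rewrite /reduced /= reduced_crossed negb_and => /orP[|/IH[v [uv sv]]]; last first.
  by exists (s :: v); rewrite !word_cons uv /= sv.
rewrite negbK mul1g => /crossed_wall[u1 [t [u2 [-> E]]]].
exists (u1 ++ u2); rewrite /= !size_cat /= addnS; split=> //.
rewrite word_cons !word_cat !word_cons.
have {}E : wall (word u1) t = gen s.
  apply: (@mulgI _ (gen s)); apply: (@mulIg _ (gen s)^-1).
  by rewrite -wall_mul -E /wall invg1 mul1g mulg1 mulgK.
by rewrite (mulgA (gen s)) -E /wall mulgVK mulgA genK.
Qed.

Lemma reduced_word_ex x : exists u, word u = x /\ reduced u.
Proof.
have [n] := ubnP (size (repr x : seq T)).
have := racg_word_repr x.
elim: n (repr x : seq T) => [//|n IH] u ux; rewrite ltnS => un.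
case: (boolP (reduced u)) => [ru|/not_reduced_delete[v [vu sv]]]; first by exists u.
by apply: (IH v); rewrite ?vu//; lia.
Qed.

Definition rword x : seq T := projT1 (cid (reduced_word_ex x)).

Lemma rwordK x : word (rword x) = x.
Proof. by rewrite /rword; case: cid => u []. Qed.

Lemma rword_reduced x : reduced (rword x).
Proof. by rewrite /rword; case: cid => u []. Qed.

Definition walls x y := crossed x (rword (x^-1 * y)).

Lemma walls_uniq x y : uniq (walls x y).
Proof. by rewrite reduced_crossed rword_reduced. Qed.

Lemma mem_crossed x u r : reduced u -> (r \in crossed x u) = sep x (x * word u) r.
Proof.
by rewrite -(reduced_crossed x) sep_word => /count_uniq_mem ->; rewrite oddb.
Qed.

Lemma mem_walls x y r : (r \in walls x y) = sep x y r.
Proof. by rewrite mem_crossed ?rword_reduced // rwordK mulVKg. Qed.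

Definition dist x y := size (walls x y).

Lemma le_dist x y (s : seq G) :
  uniq s -> (forall r, r \in s -> sep x y r) -> (size s <= dist x y)%N.
Proof. by move=> us sxy; apply: uniq_leq_size => // r /sxy; rewrite mem_walls. Qed.

Lemma dist_le x y (s : seq G) :
  (forall r, sep x y r -> r \in s) -> (dist x y <= size s)%N.
Proof.
by move=> sxy; apply: uniq_leq_size (walls_uniq x y) _ => r; rewrite mem_walls => /sxy.
Qed.

Lemma dist_size x y : dist x y = size (rword (x^-1 * y)).
Proof. exact: size_crossed. Qed.

Lemma dist_word x u : (dist x (x * word u) <= size u)%N.
Proof.
rewrite -(size_crossed x); apply: dist_le => r; rewrite sep_word => /odd_gt0.
by rewrite -has_count has_pred1.
Qed.

Lemma dist_reduced x u : reduced u -> dist x (x * word u) = size u.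
Proof.
move=> ru; apply/eqP; rewrite eqn_leq dist_word -(size_crossed x) le_dist //.
  by rewrite reduced_crossed.
by move=> r; rewrite mem_crossed.
Qed.

Lemma dist_mul g x y : dist (g * x) (g * y) = dist x y.
Proof. by rewrite !dist_size invgM -mulgA mulKg. Qed.

Lemma dist_sym x y : dist x y = dist y x.
Proof.
suff H a b : (dist a b <= dist b a)%N by apply/eqP; rewrite eqn_leq !H.
by apply: le_dist (walls_uniq _ _) _ => r; rewrite mem_walls sep_sym.
Qed.

Lemma distxx x : dist x x = 0%N.
Proof. by have := dist_word x [::]; rewrite word_nil mulg1 leqn0 => /eqP. Qed.

Lemma dist_eq0 x y : dist x y = 0%N -> x = y.
Proof.
rewrite dist_size => /size0nil E; have := rwordK (x^-1 * y).
by rewrite E => /esym/eqP; rewrite word_nil mulg_eq1 => /eqP/invg_inj.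
Qed.

Lemma dist_triangle y x z : (dist x z <= dist x y + dist y z)%N.
Proof.
rewrite /dist -size_cat; apply: dist_le => r; rewrite (sep_trans y) mem_cat !mem_walls.
by case: sep; case: sep.
Qed.

(** The coordinates of the abelianisation, a power of Z/2. Conjugation does not change them, so a
    wall determines its label ([wall_label]). *)
Definition parity (t : T) (x : G) : bool := odd (count_mem t (repr x : seq T)).

Lemma parity_word t u : parity t (word u) = odd (count_mem t u).
Proof.
suff H v w : racg_eq e v w -> odd (count_mem t v) = odd (count_mem t w).
  exact/H/repr_racg_word.
elim=> {v w} [//|v w _ ->//|v w z _ -> _ ->//|s v w|a b v w _].
  by rewrite !count_cat /= !oddD !oddb addKb.
by rewrite !count_cat /= !oddD !oddb (addbCA (a == t)).
Qed.

Lemma parityM t x y : parity t (x * y) = parity t x (+) parity t y.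
Proof.
by rewrite -(racg_word_repr x) -(racg_word_repr y) -word_cat !parity_word count_cat oddD.
Qed.

Lemma parity1 t : parity t 1 = false.
Proof. by rewrite -word_nil parity_word. Qed.

Lemma parityV t x : parity t x^-1 = parity t x.
Proof.
by have := parityM t x^-1 x; rewrite mulVg parity1; case: parity; case: parity.
Qed.

Lemma parity_gen t s : parity t (gen s) = (s == t).
Proof. by rewrite parity_word /= addn0 oddb. Qed.

Lemma parity_wall t x s : parity t (wall x s) = (s == t).
Proof. by rewrite /wall !parityM parityV parity_gen addbAC addbb addFb. Qed.

Lemma wall_label x y s t : wall x s = wall y t -> s = t.
Proof.
move=> E; have := parity_wall s x s; rewrite E parity_wall eqxx.
by move=> /eqP.
Qed.

End Walls.

Arguments side {T X} (x r)%_group_scope.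
Arguments sep {T X} (x y r)%_group_scope.
Arguments dist {T X} (x y)%_group_scope.
Arguments wall {T X} x%_group_scope s.
Arguments walls {T X} (x y)%_group_scope.
Arguments crossed {T X} x%_group_scope u.

(** * Crossing walls *)

Section Crossing.
Context (T : finType) (X : sgraph T).
Local Notation e := (edge X).
Local Notation e_sym := (@edge_sym T X).
Local Notation e_irr := (@edge_irr T X).
Local Open Scope group_scope.
Local Notation G := (racg e).
Local Notation word := (@racg_word T e).
Local Notation gen := (@racg_gen T e).

(** All four quadrants are inhabited. This is equivalent to meeting in a square, by [cross_corner]
    and [corner_cross]. *)
Definition cross (r q : G) : Prop :=
  forall a b : bool, exists x, side x r = a /\ side x q = b.

Lemma cross_symP r q : cross r q -> cross q r.
Proof. by move=> rq a b; have [x []] := rq b a; exists x. Qed.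

Lemma cross_sep z r q : cross r q ->
  forall a b : bool, exists x, sep z x r = a /\ sep z x q = b.
Proof.
move=> rq a b; have [x [xr xq]] := rq (side z r (+) a) (side z q (+) b).
by exists x; rewrite /sep xr xq !addKb.
Qed.

Lemma sep_cross z r q :
  (forall a b : bool, exists x, sep z x r = a /\ sep z x q = b) -> cross r q.
Proof.
move=> rq a b; have [x [xr xq]] := rq (side z r (+) a) (side z q (+) b).
by exists x; move: xr xq; rewrite /sep => /addbI -> /addbI ->.
Qed.

Lemma big_uniq_one (K : Type) (idx : K) (op : Monoid.law idx) (f : G -> K) l r :
  uniq l -> r \in l -> (forall q, q \in l -> q != r -> f q = idx) ->
  \big[op/idx]_(q <- l) f q = f r.
Proof.
move=> + rl; case/splitPr: rl => l1 l2; rewrite cat_uniq => /and3P[_ d /andP[d2 _]] fE.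
rewrite big_cat big_cons !big1_seq /= ?Monoid.mulm1 ?Monoid.mul1m //.
  move=> q ql2; apply: fE; first by rewrite mem_cat inE ql2 !orbT.
  by apply: contraNneq d2 => <-.
move=> q ql1; apply: fE; first by rewrite mem_cat ql1.
by apply: contraNneq d => <-; rewrite /= ql1.
Qed.

(* Colour [r] and [q] by two non-commuting transpositions. If [r] and [q] did not
   meet in a square, the product of the colours along a word would be an
   invariant of the group element, but the four quadrants make it both products
   of the two transpositions. *)
Lemma cross_corner r q : cross r q ->
  exists z s t, [/\ e s t, r = wall z s & q = wall z t].
Proof.
move=> rq; apply: contrapT => nc.
pose a : {perm option bool} := tperm None (Some true).
pose b : {perm option bool} := tperm (Some true) (Some false).
have r_q : q != r.
  by have [x [xr xq]] := rq true false; apply/eqP => E; move: xr; rewrite -E xq.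
pose f (w : G) := if w == r then a else if w == q then b else 1.
have fsq w : f w * f w = 1 by rewrite /f; do 2?case: ifP => _; rewrite ?tperm2 ?mulg1.
have fcomm x s t : e s t ->
    f (wall x s) * f (wall x t) = f (wall x t) * f (wall x s).
  move=> st; rewrite /f; do 4?case: ifP => // ?; rewrite ?mulg1 ?mul1g //.
    by case: nc; exists x, s, t; split=> //; apply/esym/eqP.
  by case: nc; exists x, t, s; split; rewrite 1?e_sym//; apply/esym/eqP.
have inv := @crossed_prod _ X _ 1 *%g f fsq fcomm.
pose Phi (x : G) := \big[*%g/1]_(w <- crossed 1 (rword x)) f w.
have step x y : Phi y = Phi x * \big[*%g/1]_(w <- walls x y) f w.
  have : racg_eq e (rword y) (rword x ++ rword (x^-1 * y)).
    by apply/racg_wordP; rewrite word_cat !rwordK mulVKg.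
  by move/inv/(_ 1); rewrite crossed_cat mul1g rwordK big_cat.
have stepr x y : sep x y r -> ~~ sep x y q -> Phi y = Phi x * a.
  move=> xyr xyq; rewrite (step x); congr (_ * _).
  rewrite (@big_uniq_one _ _ _ f _ r (walls_uniq x y)) ?mem_walls //.
    by rewrite /f eqxx.
  move=> w; rewrite mem_walls => xyw wr; rewrite /f (negbTE wr); case: eqP => // wq.
  by rewrite wq (negbTE xyq) in xyw.
have stepq x y : sep x y q -> ~~ sep x y r -> Phi y = Phi x * b.
  move=> xyr xyq; rewrite (step x); congr (_ * _).
  rewrite (@big_uniq_one _ _ _ f _ q (walls_uniq x y)) ?mem_walls //.
    by rewrite /f eqxx (negbTE r_q).
  move=> w; rewrite mem_walls => xyw wr; rewrite /f (negbTE wr); case: eqP => // wq.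
  by rewrite wq (negbTE xyq) in xyw.
have Phi1 : Phi 1 = 1.
  suff -> : Phi 1 = \big[*%g/1]_(w <- crossed 1 [::]) f w by rewrite big_nil.
  by apply/inv/racg_wordP; rewrite rwordK.
have [y [yr yq]] := cross_sep 1 rq true true.
have [z [zr zq]] := cross_sep 1 rq false true.
have [w [wr wq]] := cross_sep 1 rq true false.
have E1 : Phi y * a = b.
  rewrite -(stepr y z) ?(sep_trans 1 y z) ?(sep_sym y 1) ?yr ?yq ?zr ?zq //.
  by rewrite (stepq 1) ?zq ?zr // Phi1 mul1g.
have E2 : Phi y * b = a.
  rewrite -(stepq y w) ?(sep_trans 1 y w) ?(sep_sym y 1) ?yr ?yq ?wr ?wq //.
  by rewrite (stepr 1) ?wq ?wr // Phi1 mul1g.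
have F1 : Phi y = b * a by rewrite -E1 -mulgA tperm2 mulg1.
have F2 : Phi y = a * b by rewrite -E2 -mulgA tperm2 mulg1.
have := congr1 (fun p : {perm option bool} => p None) (etrans (esym F1) F2).
by rewrite !permM tpermL tpermL (@tpermD _ (Some true) (Some false)) // tpermL.
Qed.

Lemma cross_comm r q : cross r q -> r * q = q * r.
Proof.
move=> /cross_corner[z [s [t [st -> ->]]]].
rewrite /wall !mulgA !mulgVK -(mulgA z) (racg_gen_comm st).
by rewrite !mulgA.
Qed.

Lemma cross_label (x : G) s y t : cross (wall x s) (wall y t) -> e s t.
Proof.
by move=> /cross_corner[z [s' [t' [st /wall_label-> // /wall_label->]]]].
Qed.

Lemma cross_wall_mul N (x : G) s : cross N (wall x s) -> wall (N * x) s = wall x s.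
Proof. by move=> /cross_comm E; rewrite wall_mul E mulgK. Qed.

(** The points [a], [a * gen s], [b] and [b * gen t] occupy the four quadrants, since [r] does not
    separate the two ends of an edge that crosses another wall. *)
Lemma adj_cross (a b : G) s t r : wall a s = wall b t ->
  sep a b r -> r != wall a s -> cross r (wall a s).
Proof.
move=> ab abr rs; apply: (@sep_cross a) => i j.
have ags : sep a (a * gen s) r = false by rewrite sep_gen eq_sym; apply/negbTE.
have bgs : sep b (b * gen t) r = false by rewrite sep_gen -ab eq_sym; apply/negbTE.
have asr : sep a (a * gen s) (wall a s) by rewrite sep_gen eqxx.
have bsr : sep b (b * gen t) (wall a s) by rewrite sep_gen ab eqxx.
case: i; last first.
  by case: j; [exists (a * gen s)|exists a; rewrite !sepxx].
case: (eqVneq (sep a b (wall a s)) j) => abj; first by exists b.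
exists (b * gen t); rewrite !(sep_trans b a (b * gen t)) abr bgs bsr; split=> //.
by move: abj; case: sep; case: j.
Qed.

Definition star (s : T) : {set T} := [set t | (t == s) || e s t].

Lemma in_star s t : (t \in star s) = (t == s) || e s t.
Proof. by rewrite inE. Qed.

Definition on_letters (J : {set T}) (x : G) := all (fun t => t \in J) (rword x).

Lemma on_lettersP (J : {set T}) (x y : G) :
  (forall z t, sep x y (wall z t) -> t \in J) -> on_letters J (x^-1 * y).
Proof.
move=> xyJ; apply/allP => t; set u := rword _ => tu.
have : reduced e u by exact: rword_reduced.
have : forall z t', wall z t' \in crossed x u -> t' \in J.
  by move=> z t'; rewrite mem_walls; exact: xyJ.
case/splitPr: tu => u1 u2 H _; apply: (H (x * word u1)).
by rewrite crossed_cat mem_cat /= inE eqxx orbT.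
Qed.

(** With [b = g * a] and [s = t], this puts the stabiliser of a wall into a conjugate of the
    subgroup of a star. *)
Lemma same_wall_star (a b : G) s t : wall a s = wall b t -> on_letters (star s) (a^-1 * b).
Proof.
move=> ab; apply: on_lettersP => z v abz; rewrite in_star.
have [E|zs] := eqVneq (wall z v) (wall a s); first by rewrite (wall_label E) eqxx.
by rewrite e_sym (cross_label (adj_cross ab abz zs)) orbT.
Qed.

(* Conjugate [x] so as to minimise its length, let [s] be its first letter and [N]
   the wall of [s].  If [x] fixes [N], then [s] occurs only once in [x]; if [x N]
   also separates [z] from [x z], conjugation by [s] shortens [x]; otherwise [x]
   maps a side of [N] strictly into itself. *)
Lemma torsion_free (x : G) : x <> 1 -> (forall t, parity t x = false) -> infinite_order x.
Proof.
move=> x1 px; have [n] := ubnP (dist 1 (x * 1)).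
elim: n (1 : G) => [//|n IH] z; rewrite ltnS => zn.
case E : (rword (z^-1 * (x * z))) => [|s u].
  case: x1; have := rwordK (z^-1 * (x * z)); rewrite E => /esym F.
  by rewrite -(mulKg z (x * z)) in F; apply: (@mulIg _ z); rewrite mul1g -(mulVKg z (x * z)) -[in LHS](mulKg z (x * z)) F !mulg1.
have red : reduced e (s :: u) by rewrite -E rword_reduced.
have Ez : z * word (s :: u) = x * z by rewrite -E rwordK mulVKg.
set N := wall z s.
have zN : sep z (x * z) N.
  by rewrite -Ez -mem_crossed //= inE eqxx.
set N' := wall (x * z) s.
have N'E : N' = x * N * x^-1 by rewrite /N' wall_mul.
have [NN|NN] := eqVneq N' N.
  (* A second letter [s] would give a wall [r] other than [N] with the same label. As [z] and
     [x * z] are both adjacent to [N], it would cross [N], but crossing walls have adjacent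
     labels. *)
  have su : s \notin u.
    apply/negP => su; have : sep z (x * z) N by [].
    move: red Ez; case/splitPr: su => u1 u2 red Ez _.
    set r := wall (z * gen s * word u1) s.
    have rin : r \in crossed (z * gen s) (u1 ++ s :: u2).
      by rewrite crossed_cat mem_cat /= inE eqxx orbT.
    have rN : r != wall z s.
      apply: contraTneq rin => ->; move: red.
      by rewrite -(reduced_crossed z) /= => /andP[].
    have rs : sep z (x * z) r by rewrite -Ez -mem_crossed//= inE rin orbT.
    have := cross_label (@adj_cross z (x * z) s s r (esym NN) rs rN).
    by rewrite e_irr.
  have := px s; have -> : parity s x = parity s (z^-1 * (x * z)).
    by rewrite !parityM parityV addbA addbAC addbb addFb.
  by rewrite -(rwordK (z^-1 * (x * z))) E parity_word /= eqxx (count_memPn su).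
have sepE r : sep (z * gen s) (x * (z * gen s)) r = (N == r) (+) sep z (x * z) r (+) (N' == r).
  rewrite (mulgA x) (sep_trans z) (sep_sym (z * gen s) z) sep_gen.
  by rewrite (sep_trans (x * z) z (x * z * gen s)) sep_gen addbA.
case zN' : (sep z (x * z) N').
  apply: (IH (z * gen s)); apply: leq_trans zn.
  apply: ltnW.
  apply: (@le_dist _ _ z (x * z) (N :: N' :: walls (z * gen s) (x * (z * gen s)))).
    rewrite /= inE !mem_walls !sepE !eqxx zN zN' (eq_sym N N') (negbTE NN) /=.
    exact: walls_uniq.
  move=> r; rewrite !inE => /or3P[/eqP->//|/eqP->//|].
  rewrite mem_walls sepE; have [<-//|_] := eqVneq N r.
  by have [<-//|_] := eqVneq N' r; rewrite addbF.
have nc : ~ cross N N' by rewrite /N /N' => /cross_label; rewrite e_irr.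
(* Otherwise [p], [z], [x * z] and [x * z * gen s] would occupy the four quadrants of [N] and [N'],
   whose equal labels forbid a crossing. *)
have N'N p : sep (x * z) p N' -> sep z p N.
  move=> pN'; apply: contrapT => /negP/negbTE pN; apply: nc.
  have pN'2 : sep z p N' by rewrite (sep_trans (x * z)) zN'.
  apply: (@sep_cross z) => i j.
  case: i; last by case: j; [exists p|exists z; rewrite !sepxx].
  case: j; last by exists (x * z).
  exists (x * z * gen s); rewrite !(sep_trans (x * z) z (x * z * gen s)) zN zN' !sep_gen eqxx.
  by rewrite (negbTE NN).
have iter k p : sep z p N -> sep (x * z) (x ^+ k.+1 * p) N'.
  elim: k p => [|k IHk] p pN; first by rewrite expg1 N'E sep_mul.
  by rewrite expgS -mulgA N'E sep_mul; apply/N'N/IHk.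
move=> [//|k] _ xk; have := iter k (x * z) zN.
by rewrite xk mul1g sepxx.
Qed.

(* If every wall separating [y] from [y'] crosses the wall [K], the wall closest
   to [y] that shields [y] and [y'] from [K] is adjacent to [y]. *)
Lemma all_cross_star (y y' w : G) s0 :
  (forall r, sep y y' r -> r != wall w s0 -> cross r (wall w s0)) ->
  exists v, on_letters (star v) (y^-1 * y').
Proof.
set K := wall w s0 => yK; case yy'K : (sep y y' K).
  exists s0; apply: on_lettersP => z t yz; rewrite in_star.
  have [E|zs] := eqVneq (wall z t) K; first by rewrite (wall_label E) eqxx.
  by rewrite e_sym (cross_label (yK _ yz zs)) orbT.
(* Induction on the length of a path from [y] to a wall [M] that has [y] and [y'] on one side and
   all points beyond [K] on the other. Every wall separating [y] from [y'] then crosses [M]. *)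
suff H n u s : (size u < n)%N -> sep y y' (wall (y * word u) s) = false ->
    (forall p, sep y p K -> sep y p (wall (y * word u) s)) ->
    exists v, on_letters (star v) (y^-1 * y').
  apply: (H _ (rword (y^-1 * w)) s0 (ltnSn _)); rewrite rwordK mulVKg //.
elim: n u s => [//|n IH] u s; rewrite ltnS => un; set M := wall _ s => yM KM.
have crM r : sep y y' r -> cross r M.
  move=> yr; have rK : r != K by apply: contraTneq yr => ->; rewrite yy'K.
  apply: (@sep_cross y) => i j; case: j.
    have [p [pr pK]] := cross_sep y (yK r yr rK) i true.
    by exists p; rewrite pr KM.
  by case: i; [exists y'|exists y; rewrite !sepxx].
case: u un @M yM KM crM => [|s1 u] un; first rewrite mulg1 => M yM KM crM.
  exists s; apply: on_lettersP => z t /crM/cross_label ts.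
  by rewrite in_star e_sym ts orbT.
case: (boolP (reduced e (s1 :: u))) => [red|/not_reduced_delete[v [<- sv]]]; last first.
  move=> M yM KM _; apply: (IH v s) => //; move: un; rewrite sv; lia.
set N1 := wall y s1 => M yM KM crM.
have [MN|MN] := eqVneq N1 M.
  by apply: (IH [::] s1); rewrite ?mulg1 -/N1 ?MN//; move: un => /=; lia.
(* If [N1] crosses [M], the two reflections commute; [N1] then fixes [M] and carries its edge at the
   end of the path to one that is reached without the first letter. *)
have ncr : cross N1 M -> exists v, on_letters (star v) (y^-1 * y').
  move=> /cross_wall_mul ME; apply: (IH u s); first by move: un => /=; lia.
    by rewrite -yM /M -ME word_cons /N1 /wall !mulgA mulgVK genK.
  suff -> : wall (y * word u) s = M by [].
  by rewrite /M -ME word_cons /N1 /wall !mulgA mulgVK genK.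
case yN1 : (sep y y' N1); first exact/ncr/crM.
have [/ncr //|nc] := pselect (cross N1 M).
(* If they do not cross, [N1] lies between [y] and [M] and takes the place of [M], with an empty
   path. *)
apply: (IH [::] s1); rewrite ?mulg1 -/N1 //; first by move: un => /=; lia.
move=> p /KM pM; apply: contrapT => /negP/negbTE pN1; apply: nc.
have uN1 : sep y (y * word (s1 :: u)) N1 by rewrite -mem_crossed //= inE eqxx.
apply: (@sep_cross y) => i [] /=; last first.
  case: i; last by exists y; rewrite !sepxx.
  by exists (y * gen s1); rewrite !sep_gen eqxx (negbTE MN).
case: i; last by exists p.
have MM : sep (y * word (s1 :: u)) (y * word (s1 :: u) * gen s) M by rewrite sep_gen eqxx.
have NM : sep (y * word (s1 :: u)) (y * word (s1 :: u) * gen s) N1 = false.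
  by rewrite sep_gen; apply/negbTE; rewrite eq_sym.
case uM : (sep y (y * word (s1 :: u)) M); first by exists (y * word (s1 :: u)).
exists (y * word (s1 :: u) * gen s).
by rewrite !(sep_trans (y * word (s1 :: u)) y (_ * gen s)) uN1 NM uM MM.
Qed.

Lemma wall_flip (x : G) a : wall x a * (x * gen a) = x.
Proof. by rewrite mulgA /wall mulgVK genK. Qed.

Lemma wall_slide (y : G) u s :
  (forall N, N \in crossed y u -> cross N (wall (y * word u) s)) ->
  wall (y * word u) s = wall y s.
Proof.
elim/last_ind: u => [|u a IH]; first by rewrite mulg1.
rewrite -cats1 word_cat mulgA /= => cr.
have E : wall (y * word u * gen a) s = wall (y * word u) s.
  have := cr (wall (y * word u) a); rewrite crossed_cat mem_cat inE eqxx orbT.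
  by move=> /(_ isT)/cross_wall_mul; rewrite wall_flip => <-.
rewrite [LHS]E; apply: IH => N Nu; rewrite -E; apply: cr.
by rewrite crossed_cat mem_cat Nu.
Qed.

(** The interval: the points on the word geodesics from [p] to [q]. *)
Definition between (p q y : G) : Prop := forall r, sep p y r -> sep p q r.

(* The point [y] is a point of the interval between [p] and [q] closest to [x]. *)
Lemma projection (p q x : G) :
  exists y, between p q y /\ (forall r, sep x y r -> sep p q r = false).
Proof.
suff H n y : (dist x y < n)%N -> between p q y ->
    exists y, between p q y /\ (forall r, sep x y r -> sep p q r = false).
  by apply: (H _ p (ltnSn _)) => r; rewrite sepxx.
elim: n y => [//|n IH] y; rewrite ltnS => xyn yI.
pose P r := sep p q r; set u := rword (y^-1 * x).
have red : reduced e u by exact: rword_reduced.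
have ux : y * word u = x by rewrite /u rwordK mulVKg.
(* Let [r] be the first wall on the way from [y] to [x] that separates [p] from [q]. The walls
   before it cross [r], so [r] slides back to [y], and crossing it there brings [y] closer to [x]
   inside the interval. *)
have [hP|nP] := boolP (has P (crossed y u)); last first.
  exists y; split=> // r; rewrite sep_sym -ux -mem_crossed // => ru.
  by apply/negbTE/(hasPn nP).
have [i iu uE] : exists2 i, (i < size u)%N & i = find P (crossed y u).
  by exists (find P (crossed y u)); rewrite // -(size_crossed y) -has_find.
have [s0 _] : exists s0 : T, True by case: (u) iu => // s0 *; exists s0.
have := nth_find 1 hP; rewrite -uE (nth_crossed _ _ s0 iu).
set u1 := take i u; set s := nth s0 u i; set r := wall _ s => Pr.
have uE2 : u = u1 ++ s :: drop i.+1 u by rewrite -[LHS](cat_take_drop i) (drop_nth s0).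
have u1P N : N \in crossed y u1 -> P N = false.
  move=> /(nthP 1)[j]; rewrite size_crossed => ju1 <-.
  have ji : (j < i)%N by move: ju1; rewrite size_take iu.
  rewrite uE in ji; have := before_find 1 ji.
  by rewrite uE2 crossed_cat nth_cat size_crossed ju1.
have red1 : reduced e (u1 ++ [:: s]).
  have : reduced e ((u1 ++ [:: s]) ++ drop i.+1 u) by rewrite -catA -uE2.
  by case/reduced_cat.
have rE : r = wall y s.
  apply: wall_slide => N Nu1; rewrite -/r.
  have PN := u1P _ Nu1; have yN : sep p y N = false.
    by apply: contraFF PN; apply: yI.
  have yN1 : sep y (y * word u1) N by rewrite -mem_crossed //; case/reduced_cat: red1.
  have Nr : r != N.
    apply: contraTneq Nu1 => <-; move: red1; rewrite -(reduced_crossed y) crossed_cat.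
    by rewrite cat_uniq /= orbF andbT => /andP[_].
  have pE : sep p (y * word u1) N by rewrite (sep_trans y) yN yN1.
  apply: (@sep_cross p) => -[|] j.
    have [jE|jE] := eqVneq (sep p (y * word u1) r) j; first by exists (y * word u1).
    exists (y * word u1 * gen s); rewrite !(sep_trans (y * word u1) p (_ * gen s)) pE !sep_gen.
    rewrite (negbTE Nr) eqxx; split=> //; move: jE.
    by case: sep; case: j.
  by case: j; [exists q|exists p; rewrite !sepxx].
have ry : sep x y r.
  by rewrite sep_sym -ux -mem_crossed // uE2 crossed_cat mem_cat inE eqxx orbT.
apply: (IH (y * gen s)).
  apply: leq_trans xyn.
  apply: leq_trans (_ : size (r :: walls x (y * gen s)) <= _)%N => //.
  apply: le_dist.
    rewrite /= walls_uniq andbT mem_walls (sep_trans y) ry sep_gen rE eqxx //.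
  move=> w; rewrite inE => /orP[/eqP->//|]; rewrite mem_walls (sep_trans y) sep_gen.
  by have [<-|_] := eqVneq (wall y s) w; rewrite -?rE ?ry// addbF.
move=> w; rewrite (sep_trans y) sep_gen -rE; have [<-//|_] := eqVneq r w.
by rewrite addbF; apply: yI.
Qed.

End Crossing.

(** * Join-free subgroups *)

Section SubgroupFacts.
Context (G : groupType).
Local Open Scope group_scope.

Lemma is_subgroup1 (K : set G) : is_subgroup K -> K 1.
Proof. by move=> [/set_mem]. Qed.

Lemma is_subgroupF (K : set G) x y : is_subgroup K -> K x -> K y -> K (x * y^-1).
Proof. by move=> [_ KF] Kx Ky; apply/set_mem/KF; apply/mem_set. Qed.

Lemma is_subgroupV (K : set G) x : is_subgroup K -> K x -> K x^-1.
Proof. by move=> Ks Kx; rewrite -[x^-1]mul1g; apply: is_subgroupF => //; exact: is_subgroup1. Qed.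

Lemma is_subgroupM (K : set G) x y : is_subgroup K -> K x -> K y -> K (x * y).
Proof.
by move=> Ks Kx Ky; rewrite -[y]invgK; apply: is_subgroupF => //; exact: is_subgroupV.
Qed.

Lemma subgroup_gen_incl (A : set G) x : A x -> subgroup_gen A x.
Proof. exact: sub_gen_smallest. Qed.

Lemma subgroup_gen_prod (A : seq G) x : subgroup_gen [set` A]%classic x ->
  exists2 l : seq G, all (mem (A ++ [seq a^-1 | a <- A])) l & \prod_(a <- l) a = x.
Proof.
set A' := A ++ _.
pose K : set G := fun x => exists2 l : seq G, all (mem A') l & \prod_(a <- l) a = x.
have A'V a : a \in A' -> a^-1 \in A'.
  rewrite !mem_cat => /orP[aA|/mapP[b bA ->]]; last by rewrite invgK bA.
  by apply/orP; right; apply: map_f.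
suff : (subgroup_gen [set` A] `<=` K)%classic by exact.
apply: smallest_sub; last first.
  move=> a /= aA; exists [:: a]; rewrite ?big_seq1 //= andbT.
  by rewrite /= mem_cat aA.
split; first by apply/mem_set; exists [::]; rewrite ?big_nil.
move=> _ _ /set_mem[l lA <-] /set_mem[m mA <-]; apply/mem_set.
exists (l ++ rev [seq a^-1 | a <- m]).
  rewrite all_cat lA all_rev; apply/allP => _ /mapP[a am ->].
  exact/A'V/(allP mA).
rewrite big_cat /=; congr (_ * _).
elim: m {mA} => [|a m IH]; first by rewrite !big_nil invg1.
by rewrite /= rev_cons -cats1 big_cat /= IH big_seq1 big_cons invgM.
Qed.

End SubgroupFacts.

Lemma seq_bound (A : Type) (B : eqType) (P : B -> A -> Prop) (f : A -> nat) (s : seq B) :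
  exists n, forall b, b \in s -> (exists a, P b a) -> exists2 a, P b a & (f a <= n)%N.
Proof.
elim: s => [|b s [n IH]]; first by exists 0%N.
have [[a Pba]|nP] := pselect (exists a, P b a).
  exists (maxn n (f a)) => c; rewrite inE => /orP[/eqP->|/IH{}IH /IH[a' Pa' fa']].
    by exists a => //; rewrite leq_max leqnn orbT.
  by exists a' => //; rewrite leq_max fa'.
exists n => c; rewrite inE => /orP[/eqP->//|]; exact: IH.
Qed.

Section Subgroup.
Context (T : finType) (X : sgraph T).
Local Notation e := (edge X).
Local Notation e_sym := (@edge_sym T X).
Local Notation e_irr := (@edge_irr T X).
Local Open Scope group_scope.
Local Notation G := (racg e).
Local Notation word := (@racg_word T e).
Local Notation gen := (@racg_gen T e).
Local Notation special := (@special_subgroup T e).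

Context (neighbour : forall s, exists t, e s t).
Context (H : set G) (H_subgroup : is_subgroup H) (H_fin_gen : fin_gen H)
  (H_join_free : join_free H).

Lemma special_word (J : {set T}) u : all (fun t => t \in J) u -> special J (word u).
Proof.
have sub : is_subgroup (special J) by exact: subgroup_genP.
elim: u => [_|s u IH /= /andP[sJ uJ]]; first by rewrite word_nil; exact: is_subgroup1.
rewrite word_cons; apply: (is_subgroupM sub) _ (IH uJ).
have : (gen @` [set` J])%classic (gen s) by exists s.
exact: (@subgroup_gen_incl (racg e)).
Qed.

Lemma on_letters_special J (x : G) : on_letters J x -> special J x.
Proof. by move=> xJ; rewrite -(rwordK x); exact: special_word. Qed.

Lemma star_join s : is_join e (star X s).
Proof.
have [t st] := neighbour s.
exists [set s], [set t | e s t]; split.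
- by apply/set0Pn; exists s; rewrite inE.
- by apply/set0Pn; exists t; rewrite inE.
- by rewrite disjoints1 inE e_irr.
- by apply/setP => v; rewrite !inE.
- by move=> a b; rewrite !inE => /eqP->.
Qed.

(** Translation on both sides is allowed because the two ends of a factor are near different
    elements of [H]. The quotient of two members involves [b] alone, so it lies in a conjugate of
    the join subgroup. *)
Lemma join_finite J b b' : is_join e J ->
  finite_set [set g | H g /\ special J (b^-1 * g * b')]%classic.
Proof.
move=> Jj; apply: contrapT => /(infinite_set_fset (#|{ffun T -> bool}|.+1)).
move=> [B BS sB]; pose f (g : G) := [ffun t => parity t g].
have fB : {in finmap.enum_fset B &, injective f}.
  move=> g g' gB g'B /ffunP fgg; apply: contrapT => gg'.
  have [Hg Sg] := BS _ gB; have [Hg' Sg'] := BS _ g'B.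
  have Hk : H (g * g'^-1) by exact: is_subgroupF.
  have k1 : g * g'^-1 <> 1 by move/divg1_eq.
  have pk t : parity t (g * g'^-1) = false.
    by rewrite parityM parityV; have := fgg t; rewrite !ffunE => ->; rewrite addbb.
  apply: (H_join_free.2 _ Hk (torsion_free k1 pk)); exists J; split=> //; exists b.
  have := is_subgroupF (subgroup_genP _) Sg Sg'; rewrite !invgM invgK.
  by rewrite conjgE !mulgA mulgK.
move: sB; rewrite ltnNge => /negP; apply.
rewrite -(size_map f); apply: leq_trans (max_card (mem (map f (finmap.enum_fset B)))).
by rewrite (card_uniqP _) // map_inj_in_uniq //; exact: finmap.fset_uniq.
Qed.

Fixpoint cayley_ball (n : nat) : seq G :=
  if n is m.+1 then cayley_ball m ++ [seq x * gen s | x <- cayley_ball m, s <- enum T] else [:: 1].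

Lemma mem_cayley_ball n x : (dist 1 x <= n)%N -> x \in cayley_ball n.
Proof.
rewrite dist_size invg1 mul1g -[in X in _ -> X](rwordK x).
elim: n (rword x) => [|n IH] u; first by rewrite leqn0 => /nilP ->; rewrite inE.
case/lastP: u => [_|u s]; first by rewrite mem_cat IH.
rewrite size_rcons ltnS => /IH un; rewrite /= mem_cat -cats1 word_cat.
by apply/orP; right; apply/allpairsP; exists (word u, s); rewrite /= un mem_enum.
Qed.

Definition tube (n : nat) (x : G) : Prop := exists2 h, H h & (dist h x <= n)%N.

Lemma tube_dist m n x y : tube m x -> (dist x y <= n)%N -> tube (m + n) y.
Proof.
move=> [h Hh hx] xy; exists h => //; apply: leq_trans (dist_triangle x _ _) _.
exact: leq_add.
Qed.

Lemma dist1V (x : G) : dist 1 x^-1 = dist 1 x.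
Proof. by rewrite -(dist_mul x) mulgV mulg1 dist_sym. Qed.

(** Measured from the elements of [H] near them, [x] and [y] become points of a ball. Only finitely
    many triples of [J] and two such points remain, each with a finite set by [join_finite]. *)
Lemma tube_join n : exists D, forall J x y, is_join e J -> tube n x -> tube n y ->
  on_letters J (x^-1 * y) -> (dist x y <= D)%N.
Proof.
pose Q (p : {set T} * G * G) g :=
  [/\ is_join e p.1.1, H g & special p.1.1 (p.1.2^-1 * g * p.2)].
have [F FP] : exists F : {set T} * G * G -> nat,
    forall p g, Q p g -> (dist 1 g <= F p)%N.
  suff /choice[F FP] : forall p, exists k, forall g, Q p g -> (dist 1 g <= k)%N by exists F.
  move=> [[J b] b']; have [Jj|nJ] := pselect (is_join e J); last by exists 0%N => g [].
  have /finite_seqP[s sE] := join_finite b b' Jj.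
  exists (\max_(g <- s) dist 1 g) => g [_ Hg gJ]; apply: leq_bigmax_seq => //.
  suff : [set` s]%classic g by []. by rewrite -sE.
pose S := [seq (p, b') | p <- [seq (J, b) | J <- enum {set T}, b <- cayley_ball n], b' <- cayley_ball n].
exists (n + \max_(p <- S) F p + n)%N => J x y Jj [h Hh hx] [k Hk ky] Jxy.
have Hg : H (h^-1 * k) by apply: is_subgroupM => //; exact: is_subgroupV.
have hk : (dist h k <= \max_(p <- S) F p)%N.
  rewrite -(dist_mul h^-1) mulVg.
  apply: leq_trans (_ : F (J, (h^-1 * x)%g, (k^-1 * y)%g) <= _)%N; last first.
    apply: leq_bigmax_seq => //; apply/allpairsP; exists ((J, h^-1 * x), k^-1 * y).
    split=> //=; last by rewrite mem_cayley_ball // -(mulVg k) dist_mul.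
    apply/allpairsP; exists (J, h^-1 * x); rewrite mem_enum; split=> //=.
    by rewrite mem_cayley_ball // -(mulVg h) dist_mul.
  apply: FP; split=> //=; rewrite invgM invgK !mulgA !mulgK.
  exact: on_letters_special.
apply: leq_trans (dist_triangle h _ _) _; rewrite -addnA.
apply: leq_add; first by rewrite dist_sym.
by apply: leq_trans (dist_triangle k _ _) _; exact: leq_add.
Qed.

Lemma tube_same_wall n : exists D, forall x y a b s t, tube n x -> tube n y ->
  (dist x a <= n)%N -> (dist y b <= n)%N -> wall a s = wall b t -> (dist x y <= D)%N.
Proof.
have [D DP] := tube_join (n + n); exists (n + D + n)%N => x y a b s t xn yn xa yb ab.
apply: leq_trans (dist_triangle a _ _) _; rewrite -addnA leq_add//.
apply: leq_trans (dist_triangle b _ _) _; apply: leq_add; last by rewrite dist_sym.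
apply: (DP (star X s)); [exact: star_join|exact: tube_dist xa|exact: tube_dist yb|].
exact: (same_wall_star ab).
Qed.

End Subgroup.

Section Monotone.
Context (T : finType) (X : sgraph T).
Local Notation e := (edge X).
Local Open Scope group_scope.
Local Notation G := (racg e).
Local Notation word := (@racg_word T e).
Local Notation gen := (@racg_gen T e).

Context (neighbour : forall s, exists t, e s t).
Context (H : set G) (H_subgroup : is_subgroup H) (H_fin_gen : fin_gen H)
  (H_join_free : join_free H).

Lemma sep_path (f : nat -> G) i j r : (i <= j)%N -> sep (f i) (f j) r ->
  exists k, [/\ (i <= k)%N, (k < j)%N & sep (f k) (f k.+1) r].
Proof.
elim: j => [|j IH]; first by rewrite leqn0 => /eqP->; rewrite sepxx.
rewrite leq_eqVlt => /orP[/eqP->|]; first by rewrite sepxx.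
rewrite ltnS => ij; case fij : (sep (f i) (f j) r).
  by have [k [? ? ?]] := IH ij fij; exists k; split=> //; lia.
by rewrite (sep_trans (f j)) fij => fj; exists j.
Qed.

(* A geodesic of [H] from [1] to [h]: it crosses a wall only at times that differ
   by at most [W], because [H] meets the stabiliser of a wall in a finite set. *)
Lemma quasi_path : exists C W : nat, forall h, H h -> exists (eta : nat -> G) (n : nat),
  [/\ eta 0%N = 1, forall i, (n <= i)%N -> eta i = h,
      forall i, H (eta i), forall i, (dist (eta i) (eta i.+1) <= C)%N &
      forall i j r, sep (eta i) (eta i.+1) r -> sep (eta j) (eta j.+1) r ->
        (j <= i + W)%N].
Proof.
have [A HA] := H_fin_gen; pose A' := A ++ [seq a^-1 | a <- A].
have AH a : a \in A' -> H a.
  have AH b : b \in A -> H b by move=> bA; rewrite HA; exact: subgroup_gen_incl.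
  rewrite mem_cat => /orP[/AH//|/mapP[b /AH bH ->]]; exact: is_subgroupV.
have AP x : H x -> exists2 l : seq G, all (mem A') l & \prod_(a <- l) a = x.
  by rewrite {1}HA => /subgroup_gen_prod.
pose C := \max_(a <- A') dist 1 a.
have AC a : a \in A' -> (dist 1 a <= C)%N by move=> aA; apply: leq_bigmax_seq.
have [D DP] := tube_same_wall neighbour H_subgroup H_join_free C.
(* An element of [H] that is short in [G] may be long in the generators of [H]; over the finite ball
   of radius [D] one bound [W] suffices. *)
have [W WP] := seq_bound (fun x (l : seq G) => all (mem A') l /\ \prod_(a <- l) a = x)
  size (cayley_ball X D).
have {}WP x : H x -> (dist 1 x <= D)%N ->
    exists l : seq G, [/\ all (mem A') l, \prod_(a <- l) a = x & (size l <= W)%N].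
  move=> /AP[l lA lx] /mem_cayley_ball/WP[]; first by exists l.
  by move=> m [mA mx] mW; exists m.
exists C, W => h Hh.
have [l lA [lh lmin]] : exists2 l : seq G, all (mem A') l & \prod_(a <- l) a = h /\
    forall m : seq G, all (mem A') m -> \prod_(a <- m) a = h -> (size l <= size m)%N.
  have [l lA lh] := AP h Hh; have [n] := ubnP (size l).
  elim: n l lA lh => [//|n IH] l lA lh; rewrite ltnS => ln.
  have [[m [mA mh ml]]|nm] := pselect (exists m : seq G,
      [/\ all (mem A') m, \prod_(a <- m) a = h & (size m < size l)%N]).
    by apply: (IH m) => //; lia.
  exists l => //; split=> // m mA mh; rewrite leqNgt; apply/negP => ml.
  by apply: nm; exists m.
pose eta i := \prod_(a <- take i l) a.
have allH m : all (mem A') m -> H (\prod_(a <- m) a).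
  elim: m => [|a m IH /= /andP[aA mA]]; first by rewrite big_nil => _; exact: is_subgroup1.
  by rewrite big_cons; apply: (is_subgroupM H_subgroup); [exact: AH|exact: IH].
have takeA i : all (mem A') (take i l).
  by move: lA; rewrite -{1}(cat_take_drop i l) all_cat => /andP[].
have dropA i : all (mem A') (drop i l).
  by move: lA; rewrite -{1}(cat_take_drop i l) all_cat => /andP[].
have Heta i : H (eta i) by exact: allH.
have etaC i : (dist (eta i) (eta i.+1) <= C)%N.
  have [il|il] := ltnP i (size l); last by rewrite /eta !take_oversize ?distxx //; lia.
  rewrite /eta (take_nth 1 il) -cats1 big_cat /= big_seq1 -[X in dist X _]mulg1 dist_mul.
  by apply/AC/(allP lA); rewrite mem_nth.
exists eta, (size l); split=> //; first by rewrite /eta take0 big_nil.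
  by move=> i il; rewrite /eta take_oversize.
move=> i j r ri rj; rewrite leqNgt; apply/negP => ij.
have jl : (j < size l)%N.
  rewrite ltnNge; apply: contraL rj => lj.
  by rewrite /eta !take_oversize ?sepxx //; exact: leqW.
have wall_at k : sep (eta k) (eta k.+1) r ->
    exists a s, (dist (eta k) a <= C)%N /\ r = wall a s.
  rewrite -mem_walls => /crossed_wall[u1 [s [u2 [E ->]]]]; exists (eta k * word u1), s.
  split=> //; apply: leq_trans (etaC k); rewrite [X in (_ <= X)%N]dist_size E size_cat.
  by apply: leq_trans (dist_word _ _) _; rewrite leq_addr.
have [a [s [ia ra]]] := wall_at i ri; have [b [t [jb rb]]] := wall_at j rj.
have tube0 k : tube H C (eta k) by exists (eta k); rewrite ?distxx.
have := DP _ _ _ _ _ _ (tube0 i) (tube0 j) ia jb (etrans (esym ra) rb).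
rewrite -(dist_mul (eta i)^-1) mulVg => /WP[]; first by apply: is_subgroupM => //; exact: is_subgroupV.
move=> m [mA mE mW].
(* Replacing the stretch of [l] between the times [i] and [j] by [m], of length at most [W],
   contradicts the minimality of [l]. *)
have := lmin (take i l ++ m ++ drop j l); rewrite !all_cat mA takeA dropA !big_cat /= mE.
move=> /(_ isT); rewrite !mulgA mulgV mul1g /eta -[X in X = h -> _]big_cat cat_take_drop.
move=> /(_ lh); rewrite !size_cat size_take size_drop; case: ifP; lia.
Qed.

(* Project a geodesic of [H] to the interval between [1] and [h], and keep one
   point out of [W.+1]: the remaining sequence crosses each wall at most once. *)
Lemma monotone_word : exists C, forall h, H h -> exists u,
  [/\ reduced e u, word u = h & forall i, tube H C (word (take i u))].
Proof.
have [C [W path]] := quasi_path; pose K := (W * C)%N; pose M := (K + W.+1 * C + K)%N.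
exists (K + M)%N => h Hh; have [eta [n [eta0 etan Heta etaC window]]] := path h Hh.
have /choice[y yP] : forall i, exists y, between 1 h y /\
    (forall r, sep (eta i) y r -> sep 1 h r = false) by move=> i; exact: projection.
(* A wall between [eta i] and its projection separates [eta i] from both [1] and [h], so it is
   crossed before and after the time [i]. The earlier crossing falls into the last [W] steps, each
   of which crosses at most [C] walls. *)
have etay i : (dist (eta i) (y i) <= K)%N.
  have [yb yp] := yP i.
  apply: leq_trans (_ : size (flatten [seq walls (eta k) (eta k.+1) | k <- iota (i - W) W]) <= _)%N.
    apply: dist_le => r ry; have hr := yp r ry.
    have yr : sep 1 (y i) r = false by apply: contraFF hr; exact: yb.
    have ir : sep 1 (eta i) r by rewrite (sep_trans (y i)) yr sep_sym ry.
    have ihr : sep (eta i) h r by rewrite (sep_trans 1) sep_sym ir hr.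
    have [|k [_ ki kr]] := @sep_path eta 0 i r (leq0n i); first by rewrite eta0.
    have [|m [im _ mr]] := @sep_path eta i (maxn i n) r (leq_maxl _ _).
      by rewrite (etan (maxn i n)) ?leq_maxr.
    apply/flattenP; exists (walls (eta k) (eta k.+1)); last by rewrite mem_walls.
    apply/mapP; exists k => //; rewrite mem_iota.
    have := window k m r kr mr; lia.
  rewrite /K size_flatten /shape -map_comp.
  suff le w j : (sumn [seq dist (eta k) (eta k.+1) | k <- iota j w] <= w * C)%N by exact: le.
  by elim: w j => [//|w IH] j /=; rewrite mulSn leq_add.
pose z j := y (j * W.+1)%N.
have zside i r : sep 1 h r -> side (y i) r = side (eta i) r.
  move=> hr; have [_ yp] := yP i; have : sep (eta i) (y i) r = false.
    by apply: contraTF hr => /yp->.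
  by rewrite /sep; case: side; case: side.
(* Projecting preserves the sides of the walls between [1] and [h]. Such a wall separating [1] from
   [z j] but not from [z j.+1] would be crossed before [j * W.+1] and again after [j.+1 * W.+1],
   more than [W] steps later. *)
have zstep j : between 1 (z j.+1) (z j).
  move=> r zj; have hr : sep 1 h r by apply: (yP _).1 zj.
  apply: contrapT => /negP/negbTE zj1.
  have zj2 : sep (z j.+1) h r by rewrite (sep_trans 1) sep_sym zj1.
  move: zj zj2; rewrite /z /sep !zside // -/(sep _ _ _) => zj zj2.
  have [|k [_ kj kr]] := @sep_path eta 0 (j * W.+1) r (leq0n _); first by rewrite eta0.
  have [|m [im _ mr]] := @sep_path eta (j.+1 * W.+1) (maxn (j.+1 * W.+1) n) r (leq_maxl _ _).
    by rewrite (etan (maxn _ n)) ?leq_maxr.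
  have := window k m r kr mr; nia.
have zM j : (dist (z j) (z j.+1) <= M)%N.
  apply: leq_trans (dist_triangle (eta (j.+1 * W.+1)%N) _ _) _; apply: leq_add (etay _).
  apply: leq_trans (dist_triangle (eta (j * W.+1)%N) _ _) _; apply: leq_add.
    by rewrite dist_sym; exact: etay.
  rewrite mulSn; move: (j * W.+1)%N => i; elim: W.+1 => [|w IH]; first by rewrite distxx.
  apply: leq_trans (dist_triangle (eta (w + i)%N) _ _) _.
  by rewrite mulSn addnC leq_add.
have z0 : z 0%N = 1.
  apply/esym/dist_eq0/eqP; rewrite -leqn0; apply: (@dist_le _ _ _ _ [::]) => r.
  have [yb yp] := yP 0%N; rewrite /z mul0n => ry; have := yb r ry; rewrite yp //.
  by rewrite eta0.
have zn : z n = h.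
  apply/dist_eq0/eqP; rewrite -leqn0; apply: (@dist_le _ _ _ _ [::]) => r.
  have nW : (n <= n * W.+1)%N by rewrite leq_pmulr.
  have [yb yp] := yP (n * W.+1)%N; rewrite /z -/(y _) sep_sym => ry.
  have hr : sep 1 h r = false.
    by apply: yp; rewrite etan.
  have : sep 1 (y (n * W.+1)%N) r by rewrite (sep_trans h) hr.
  by move/yb; rewrite hr.
suff [u [ru uz up]] : exists u, [/\ reduced e u, word u = z n &
    forall i, tube H (K + M) (word (take i u))] by exists u; split; rewrite // uz.
elim: n {etan zn} => [|j [u [ru uz up]]].
  exists [::]; split=> //; move=> i; exists 1; first exact: is_subgroup1.
  by rewrite distxx.
exists (u ++ rword ((z j)^-1 * z j.+1)); split.
- rewrite /reduced crossed_cat cat_uniq -/(reduced _ _) ru reduced_crossed rword_reduced andbT /=.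
  apply/hasPn => r; rewrite mul1g uz -/(walls _ _) mem_walls => zr.
  apply/negP => ur; have zjr : sep 1 (z j) r by rewrite -uz -{1}(mul1g (word u)) -mem_crossed.
  by have := zstep j r zjr; rewrite (sep_trans (z j)) zjr zr.
- by rewrite word_cat uz rwordK mulVKg.
- move=> i; rewrite take_cat; case: ifP => _; first exact: up.
  rewrite word_cat uz; apply: (@tube_dist _ _ _ K M (z j)).
    by exists (eta (j * W.+1)%N) => //; exact: etay.
  apply: leq_trans (dist_word _ _) _; apply: leq_trans (zM j).
  by rewrite dist_size size_take; case: ifP; lia.
Qed.

End Monotone.

(** * Walls crossing a given wall *)

Section Coloured.
Context (T : finType) (X : sgraph T).
Local Notation e := (edge X).
Local Notation e_sym := (@edge_sym T X).
Local Notation e_irr := (@edge_irr T X).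
Context (neighbour : forall s, exists t, e s t).

(** Here [q] bounds the number of labels on an interval, counted separately in each colour. If a
    half of the interval loses one, its bound is doubled, plus one for odd lengths. *)
Fixpoint run_bound (D q : nat) : nat :=
  if q is q'.+1 then (run_bound D q').*2.+1 else D.*2.+1.

Lemma run_bound_ge D q : (D.*2.+1 <= run_bound D q)%N.
Proof. by elim: q => //= q IH; rewrite -addnn; lia. Qed.

(* Halving an interval until both halves carry the same sets of labels in each
   colour exhibits a long factor whose letters span a join. *)
Lemma coloured_run D (lab : nat -> T) (k : nat -> bool) a n :
  (forall i j J, (a <= i)%N -> (i <= j <= n)%N -> is_join e J ->
     (forall h, (i <= h < j)%N -> lab h \in J) -> (j <= i + D)%N) ->
  (forall i j, (a <= i)%N -> (i <= j <= n)%N ->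
     (forall h, (i <= h < j)%N -> k h) -> (j <= i + D)%N) ->
  (forall i j, (a <= i)%N -> (i <= j <= n)%N ->
     (forall h, (i <= h < j)%N -> ~~ k h) -> (j <= i + D)%N) ->
  (forall s t, (a <= s)%N -> (s < t < n)%N -> k s -> ~~ k t -> e (lab s) (lab t)) ->
  (n <= a + run_bound D #|T|.*2)%N.
Proof.
move=> joinD kD lD adj.
pose labs c i j := [set t : T | has (fun h => (k h == c) && (lab h == t)) (iota i (j - i))].
have labsP c i j t : reflect (exists2 h, (i <= h < j)%N & k h = c /\ lab h = t)
    (t \in labs c i j).
  rewrite inE; apply: (iffP hasP) => [[h]|[h hij [<- <-]]].
    by rewrite mem_iota => hi /andP[/eqP kc /eqP lt]; exists h; rewrite //; lia.
  by exists h; rewrite ?mem_iota ?eqxx//; lia.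
have mono c i j i' j' : (i' <= i)%N -> (j <= j')%N -> labs c i j \subset labs c i' j'.
  move=> ii jj; apply/fintype.subsetP => t /labsP[h hij kl]; apply/labsP.
  by exists h => //; lia.
suff H q i j : (#|labs true i j| + #|labs false i j| <= q)%N ->
    (a <= i)%N -> (i <= j <= n)%N -> (j <= i + run_bound D q)%N.
  have [an|na] := leqP a n; last by lia.
  by apply: (H _ a n); rewrite ?an ?leqnn// -addnn; apply: leq_add; exact: max_card.
elim: q i j => [|q IH] i j ijq ai ijn.
  have [|ij] := leqP j i; first by lia.
  have : lab i \in labs (k i) i j by apply/labsP; exists i => //; lia.
  move=> li; have : (0 < #|labs (k i) i j|)%N by rewrite card_gt0; apply/set0Pn; exists (lab i).
  by case: (k i); lia.
pose m := (i + (j - i)./2)%N.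
have half : ((j - i)./2.*2 <= j - i <= (j - i)./2.*2.+1)%N.
  by have := odd_double_half (j - i); case: odd => /=; lia.
have im : (i <= m)%N by rewrite leq_addr.
have mj : (m <= j)%N by rewrite /m; lia.
have [smallL|bigL] := boolP (#|labs true i m| + #|labs false i m| <= q)%N.
  have := IH i m smallL ai; rewrite im /=; have -> : (m <= n)%N by lia.
  by move=> /(_ isT); rewrite /m /=; lia.
have [smallR|bigR] := boolP (#|labs true m j| + #|labs false m j| <= q)%N.
  have := IH m j smallR; rewrite mj /=; have -> : (j <= n)%N by lia.
  have -> : (a <= m)%N by lia.
  by move=> /(_ isT isT); rewrite /m /=; lia.
have ge := run_bound_ge D q.+1.
have [mD|mD] := leqP m (i + D)%N; first by rewrite /m in mD *; lia.
have [jD|jD] := leqP j (m + D)%N; first by rewrite /m in jD *; lia.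
have full c i' j' : (i <= i')%N -> (j' <= j)%N ->
    ~~ (#|labs true i' j'| + #|labs false i' j'| <= q)%N ->
    labs c i' j' = labs c i j.
  move=> ii jj big; have lt := subset_leq_card (mono true i' j' i j ii jj).
  have lf := subset_leq_card (mono false i' j' i j ii jj).
  by apply/eqP; rewrite eqEcard mono //; case: c; lia.
have ex c i' j' : (a <= i')%N -> (i' <= j' <= n)%N -> (i' + D < j')%N ->
    exists t, t \in labs c i' j'.
  move=> ai' ij' D'; apply: contrapT => none.
  have allc h : (i' <= h < j')%N -> k h = ~~ c.
    move=> hij; have kc : k h <> c.
      by move=> kc; apply: none; exists (lab h); apply/labsP; exists h.
    by case: c kc {none} => /=; case: (k h).
  have : (j' <= i' + D)%N; last by lia.
  by case: c allc {none} => allc; [apply: lD|apply: kD] => // h /allc->.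
have exL c : exists t, t \in labs c i j.
  have imn : (i <= m <= n)%N by lia.
  have [t tm] := ex c i m ai imn mD.
  by exists t; apply: (fintype.subsetP (mono c i m i j (leqnn _) mj)).
have Jjoin : is_join e (labs true i j :|: labs false i j).
  have adjLR s t : s \in labs true i j -> t \in labs false i j -> e s t.
    rewrite -(full true i m) // -(full false m j) // => /labsP[h him [kh <-]].
    by move=> /labsP[h' hmj [kh' <-]]; apply: adj; rewrite ?kh ?kh' //; lia.
  exists (labs true i j), (labs false i j); split=> //.
  - by apply/set0Pn; exact: exL.
  - by apply/set0Pn; exact: exL.
  - apply/pred0P => t /=; apply/negP => /andP[t1 t2].
    by have := adjLR t t t1 t2; rewrite e_irr.
have : (j <= i + D)%N; last by lia.
apply: joinD Jjoin _ => // h hij; rewrite inE.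
by case kh : (k h); apply/orP; [left|right]; apply/labsP; exists h.
Qed.

(** After the first index of colour [true], the labels of a run of the other colour lie in the star
    of its label, so these runs are bounded as well. *)
Lemma coloured_count D (lab : nat -> T) (k : nat -> bool) n :
  (forall i j J, (i <= j <= n)%N -> is_join e J ->
     (forall h, (i <= h < j)%N -> lab h \in J) -> (j <= i + D)%N) ->
  (forall i j, (i <= j <= n)%N ->
     (forall h, (i <= h < j)%N -> k h) -> (j <= i + D)%N) ->
  (forall s t, (s < t < n)%N -> k s -> ~~ k t -> e (lab s) (lab t)) ->
  (count k (iota 0 n) <= (run_bound D #|T|.*2).+1)%N.
Proof.
move=> joinD kD adj; have [[s sn ks]|nok] := pselect (exists2 s, (s < n)%N & k s); last first.
  rewrite (_ : count _ _ = 0%N) //; apply/eqP; rewrite -leqn0 leqNgt -has_count.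
  by apply/hasPn => s; rewrite mem_iota => sn; apply/negP => ks; apply: nok; exists s.
have [s0 /andP[s0n ks0] s0min] := @ex_minnP (fun s => (s < n) && k s)%N
  (ex_intro _ s (introT andP (conj sn ks))).
have run : (n <= s0.+1 + run_bound D #|T|.*2)%N.
  apply: (@coloured_run D lab k).
  - by move=> i j J _; exact: joinD.
  - by move=> i j _; exact: kD.
  - move=> i j s0i ijn nk; apply: (joinD _ _ (star X (lab s0))) => //; first exact: star_join.
    by move=> h hij; rewrite in_star adj ?orbT ?nk//; lia.
  - by move=> s' t _; exact: adj.
have -> : n = (s0 + (n - s0))%N by lia.
rewrite iotaD count_cat add0n (_ : count k (iota 0 s0) = 0%N).
  by apply: leq_trans (count_size _ _) _; rewrite size_iota; lia.
apply/eqP; rewrite -leqn0 leqNgt -has_count; apply/hasPn => h; rewrite mem_iota => hs.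
by apply/negP => kh; have := s0min h; rewrite kh andbT => /(_ _); lia.
Qed.

Lemma coloured_count_rev D (lab : nat -> T) (k : nat -> bool) n :
  (forall i j J, (i <= j <= n)%N -> is_join e J ->
     (forall h, (i <= h < j)%N -> lab h \in J) -> (j <= i + D)%N) ->
  (forall i j, (i <= j <= n)%N ->
     (forall h, (i <= h < j)%N -> k h) -> (j <= i + D)%N) ->
  (forall s t, (s < t < n)%N -> ~~ k s -> k t -> e (lab s) (lab t)) ->
  (count k (iota 0 n) <= (run_bound D #|T|.*2).+1)%N.
Proof.
move=> joinD kD adj.
have -> : count k (iota 0 n) = count (fun i => k (n - i.+1)%N) (iota 0 n).
  transitivity (count k [seq (n - i.+1)%N | i <- iota 0 n]); last by rewrite count_map.
  rewrite -count_rev; congr (count k _).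
  apply: (@eq_from_nth _ 0%N); rewrite size_rev ?size_map // size_iota => i iN.
  by rewrite nth_rev size_iota // (nth_map 0%N) ?size_iota // !nth_iota //; lia.
apply: (@coloured_count D (fun i => lab (n - i.+1)%N)).
- move=> i j J ijn Jj all; have [ij|] := ltnP i j; last by lia.
  have : ((n - i) <= (n - j) + D)%N; last by lia.
  apply: joinD Jj _; first by lia.
  move=> h hij; have -> : h = (n - (n - h.+1).+1)%N by lia.
  by apply: all; lia.
- move=> i j ijn all; have : ((n - i) <= (n - j) + D)%N; last by lia.
  apply: kD; first by lia.
  move=> h hij; have -> : h = (n - (n - h.+1).+1)%N by lia.
  by apply: all; lia.
- by move=> s t stn ks kt; rewrite e_sym; apply: adj => //; lia.
Qed.

End Coloured.

Section WordWalls.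
Context (T : finType) (X : sgraph T).
Local Notation e := (edge X).
Local Open Scope group_scope.
Local Notation G := (racg e).
Local Notation word := (@racg_word T e).
Local Notation gen := (@racg_gen T e).

Context (s0 : T) (u : seq T) (u_reduced : reduced e u).
Local Notation n := (size u).
Definition prefix_elt i : G := word (take i u).
Definition word_wall i : G := wall (prefix_elt i) (nth s0 u i).
Local Notation xs := prefix_elt.
Local Notation wl := word_wall.

Lemma prefix0 : xs 0 = 1.
Proof. by rewrite /xs take0. Qed.

Lemma prefixS i : (i < n)%N -> xs i.+1 = xs i * gen (nth s0 u i).
Proof. by move=> iu; rewrite /xs (take_nth s0 iu) -cats1 word_cat. Qed.

Lemma prefix_size i : (n <= i)%N -> xs i = word u.
Proof. by move=> iu; rewrite /xs take_oversize. Qed.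

Lemma crossed_take (x : G) i : crossed x (take i u) = take i (crossed x u).
Proof.
by elim: u x i => [|s v IH] x [|i] //=; rewrite IH.
Qed.

Lemma nth_word_wall i : (i < n)%N -> nth 1 (crossed 1 u) i = wl i.
Proof. by move=> iu; rewrite (nth_crossed _ _ s0 iu) mul1g. Qed.

Lemma sep1_prefix i t : (t < n)%N -> sep 1 (xs i) (wl t) = (t < i)%N.
Proof.
move=> tn; have ri : reduced e (take i u).
  by move: u_reduced; rewrite -{1}(cat_take_drop i u) => /reduced_cat[].
have tc : (t < size (crossed (1 : G) u))%N by rewrite size_crossed.
rewrite /xs -{1}(mul1g (word _)) -mem_crossed // crossed_take -nth_word_wall //.
by rewrite in_take ?mem_nth // index_uniq.
Qed.

Lemma sep_prefixP i j r : (i <= j)%N -> sep (xs i) (xs j) r ->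
  exists2 t, (i <= t < j)%N & (t < n)%N /\ r = wl t.
Proof.
move=> ij /(sep_path ij)[t [it tj]]; have [tn|nt] := ltnP t n; last first.
  by rewrite !prefix_size ?sepxx //; lia.
by rewrite prefixS // sep_gen => /eqP <-; exists t; rewrite ?it.
Qed.

Lemma sep_word_wall r : sep 1 (word u) r -> exists2 t, (t < n)%N & r = wl t.
Proof.
rewrite -prefix0 -(prefix_size (leqnn n)) => /(sep_prefixP (leq0n n))[t tn [_ ->]].
by exists t.
Qed.

Lemma word_wall_inj t t' : (t < n)%N -> (t' < n)%N -> wl t = wl t' -> t = t'.
Proof.
move=> tn tn' E; have := sep1_prefix t.+1 tn'; have := sep1_prefix t'.+1 tn.
have := sep1_prefix t tn'; have := sep1_prefix t' tn; rewrite -E.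
rewrite !sep1_prefix //; lia.
Qed.

Lemma dist_prefix i j : (i <= j <= n)%N -> dist (xs i) (xs j) = (j - i)%N.
Proof.
move=> /andP[ij jn]; rewrite -(subnKC ij) /xs takeD word_cat dist_reduced.
  by rewrite size_take size_drop subnKC //; case: ifP; lia.
have : reduced e (take i u ++ take (j - i) (drop i u) ++ drop (j - i) (drop i u)).
  by rewrite !cat_take_drop.
by move=> /reduced_cat[_ /reduced_cat[]].
Qed.

Lemma prefix_letters i j (J : {set T}) : (i <= j)%N ->
  (forall t, (i <= t < j)%N -> (t < n)%N -> nth s0 u t \in J) ->
  on_letters J ((xs i)^-1 * xs j).
Proof.
move=> ij uJ; apply: on_lettersP => z t /(sep_prefixP ij)[t' tij [tn /wall_label->]].
exact: uJ.
Qed.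

Section Bust.
Context (neighbour : forall s, exists t, e s t) (D : nat).
Hypothesis bust : forall i j J, (i <= j <= n)%N -> is_join e J ->
  on_letters J ((xs i)^-1 * xs j) -> (j <= i + D)%N.

(* [shields i K] says that the [i]-th wall separates [1] from [K], or is [K];
   [shields_end i K] says that it separates [word u] from [K], or is [K]. *)
Definition shields i (K : G) := exists b, forall x, sep 1 x (wl i) = false -> side x K = b.
Definition shields_end i (K : G) := exists b, forall x, sep 1 x (wl i) -> side x K = b.

(** An empty quadrant puts one side of the [i]-th wall entirely on one side of [K]; the position of
    [1] decides between the two cases. *)
Lemma not_cross_shields i K : ~ cross (wl i) K -> shields i K \/ shields_end i K.
Proof.
move=> nc; apply: contrapT => nse; apply: nc => a b; apply: contrapT => nx; apply: nse.
have xb x : side x (wl i) = a -> side x K = ~~ b.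
  by move=> xa; case E : (side x K); move: E nx; case: b => // E nx; case: nx; exists x.
case: (eqVneq (side 1 (wl i)) a) => [E|E]; [left|right]; exists (~~ b) => x.
  by rewrite /sep E => ax; apply: xb; move: ax; case: side; case: (a).
by rewrite /sep => ax; apply: xb; move: ax E; case: side; case: side; case: (a).
Qed.

(** Points beyond [K] are beyond the [t]-th wall and can be taken on either side of the [i]-th;
    before the [t]-th wall, [1] and [xs i.+1] do the same. *)
Lemma shields_cross i t K : (i < t < n)%N -> cross (wl i) K -> shields t K ->
  cross (wl i) (wl t).
Proof.
move=> /andP[it tn] iK [b tb]; have iN : (i < n)%N by lia.
apply: (@sep_cross _ _ 1) => a c; case: c; last first.
  case: a; [exists (xs i.+1)|exists 1; rewrite !sepxx //].
  by rewrite !sep1_prefix //; split=> //; lia.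
have [x [xi xK]] := iK (side 1 (wl i) (+) a) (~~ b).
exists x; split; first by rewrite /sep xi addKb.
by case xt : (sep 1 x (wl t)) => //; move: xK; rewrite (tb _ xt); case: (b).
Qed.

Lemma shields_end_cross i t K : (t < i < n)%N -> cross (wl i) K -> shields_end t K ->
  cross (wl i) (wl t).
Proof.
move=> /andP[it tn] iK [b tb]; have iN : (t < n)%N by lia.
apply: (@sep_cross _ _ 1) => a c; case: c.
  case: a; [exists (xs n)|exists (xs i)]; rewrite !sep1_prefix //; split=> //; lia.
have [x [xi xK]] := iK (side 1 (wl i) (+) a) (~~ b).
exists x; split; first by rewrite /sep xi addKb.
by case xt : (sep 1 x (wl t)) => //; move: xK; rewrite (tb _ xt); case: (b).
Qed.

(** The other kind of shield is impossible: [xs t] and [xs t.+1] are both beyond the [i]-th wall,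
    but the [t]-th wall separates them. *)
Lemma earlier_shields i t : (i < t < n)%N -> ~ cross (wl i) (wl t) -> shields i (wl t).
Proof.
move=> /andP[it tn] /not_cross_shields[//|[b ib]]; have iN : (i < n)%N by lia.
have xt := sep1_prefix t tn; have xt1 := sep1_prefix t.+1 tn.
have := ib (xs t); have := ib (xs t.+1); rewrite !sep1_prefix //.
have -> : (i < t.+1)%N by lia. rewrite it => /(_ isT) E1 /(_ isT) E2.
by move: xt xt1; rewrite /sep E1 E2 => ->; lia.
Qed.

Lemma cross_run K w s i j : K = wall w s -> (i <= j <= n)%N ->
  (forall t, (i <= t < j)%N -> cross (wl t) K) -> (j <= i + D)%N.
Proof.
move=> -> ijn all; have ij : (i <= j)%N by lia.
have [r|v] := @all_cross_star _ _ (xs i) (xs j) w s.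
  by move=> /(sep_prefixP ij)[t tij [_ ->]] _; exact: all.
by apply: bust ijn _; exact: star_join.
Qed.

Lemma label_run i j J : (i <= j <= n)%N -> is_join e J ->
  (forall t, (i <= t < j)%N -> nth s0 u t \in J) -> (j <= i + D)%N.
Proof.
move=> ijn Jj all; apply: (bust ijn Jj); apply: prefix_letters; first by lia.
by move=> t tij _; exact: all.
Qed.

Lemma cross_wall_label i j : cross (wl i) (wl j) -> e (nth s0 u i) (nth s0 u j).
Proof. exact: cross_label. Qed.

Definition crossers (K : G) i := `[< cross (wl i) K >].

(** A wall before the [t]-th that does not cross it shields it from [1], so every earlier crosser
    also crosses the shield. This is the adjacency that [coloured_count] asks for. *)
Lemma crossers_before t : (t < n)%N ->
  (count (crossers (wl t)) (iota 0 t) <= (run_bound D #|T|.*2).+1)%N.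
Proof.
move=> tn; apply: (@coloured_count T X neighbour D (nth s0 u)).
- by move=> i j J ijt; apply: label_run; lia.
- move=> i j ijt all; apply: (@cross_run (wl t)) => //; first by lia.
  by move=> h /all/asboolP.
- move=> s t' stt' /asboolP cs /asboolP ct'; apply: cross_wall_label.
  by apply: (@shields_cross s t' (wl t)) => //; [lia|apply: earlier_shields => //; lia].
Qed.

(* The [i]-th wall either crosses [K], or shields it from [1], or from the end of
   the word.  The walls before the last shield [t] that cross [K] also cross the
   [t]-th wall; after [t], only shields from the end are left. *)
Lemma crossers_bound w s :
  (count (crossers (wall w s)) (iota 0 n) <= (run_bound D #|T|.*2).*2 + 3)%N.
Proof.
set K := wall w s; set B := run_bound D _.
have after a : (a <= n)%N -> (forall t, (a <= t < n)%N -> ~ shields t K) ->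
    (count (crossers K) (iota a (n - a)) <= B.+1)%N.
  move=> an nsh; rewrite -[a in iota a _]addn0 iotaDl count_map.
  apply: (@coloured_count_rev T X neighbour D (fun i => nth s0 u (a + i))).
  - move=> i j J ijn Jj all; have [ij|] := leqP i j; last by lia.
    suff : (a + j <= a + i + D)%N by lia.
    apply: label_run Jj _; first by lia.
    move=> h hij; have -> : h = (a + (h - a))%N by lia.
    by apply: all; lia.
  - move=> i j ijn all; suff : (a + j <= a + i + D)%N by lia.
    apply: (@cross_run K) => //; first by lia.
    move=> h hij; have -> : h = (a + (h - a))%N by lia.
    by apply/asboolP; apply: (all (h - a)%N); lia.
  - move=> i j ijn /= /asboolP ci /asboolP cj; rewrite edge_sym; apply: cross_wall_label.
    apply: (@shields_end_cross _ _ K) => //; first by lia.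
    by case: (not_cross_shields ci) => // /nsh; lia.
pose P t := (t < n)%N && `[< shields t K >].
have [exP|nosh] := pselect (exists t, P t); last first.
  have := after 0%N (leq0n _); rewrite subn0 => /(_ _)/leq_trans -> //; last by lia.
  by move=> t tn st; apply: nosh; exists t; rewrite /P; move: tn => /= ->; apply/asboolP.
have Pn t : P t -> (t <= n)%N by move=> /andP[/ltnW].
have [t /andP[tn /asboolP st] tmax] := ex_maxnP exP Pn.
have -> : n = (t + (1 + (n - t.+1)))%N by lia.
rewrite !iotaD !count_cat add0n addn1.
have le1 : (count (crossers K) (iota t 1) <= 1)%N by rewrite -{2}(size_iota t 1) count_size.
have le2 : (count (crossers K) (iota t.+1 (n - t.+1)) <= B.+1)%N.
  apply: after => // t' tt' st'; have := tmax t'; rewrite /P.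
  have -> : (t' < n)%N by lia.
  by move=> /(_ (asboolT st')); lia.
have le3 : (count (crossers K) (iota 0 t) <= B.+1)%N.
  apply: leq_trans (crossers_before tn).
  have sub t' : t' \in iota 0 t -> crossers K t' -> crossers (wl t) t'.
    rewrite mem_iota => tt' /asboolP c; apply/asboolP.
    by apply: (@shields_cross t' t K) => //; lia.
  rewrite -!size_filter; apply: uniq_leq_size; first by rewrite filter_uniq // iota_uniq.
  by move=> t'; rewrite !mem_filter => /andP[c tt']; rewrite tt' sub.
by rewrite -addnn; lia.
Qed.

End Bust.
End WordWalls.

(** * Discrete paths far from the subgroup *)

Section Translate.
Context (T : finType) (X : sgraph T).
Local Open Scope group_scope.
Local Notation G := (racg (edge X)).
Local Notation gen := (@racg_gen T (edge X)).

Lemma sep_mulV g (x y r : G) : sep x y (g^-1 * r * g) = sep (g * x) (g * y) r.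
Proof. by rewrite -(sep_mul g) !mulgA mulgV mul1g mulgK. Qed.

Lemma cross_mul g (r q : G) : cross r q -> cross (g * r * g^-1) (g * q * g^-1).
Proof.
move=> /(cross_sep 1) rq; apply: (@sep_cross _ _ (g * 1)) => a b.
by have [x [xr xq]] := rq a b; exists (g * x); rewrite !sep_mul.
Qed.

Lemma corner_cross (z : G) s t : edge X s t -> cross (wall z s) (wall z t).
Proof.
move=> st; have ts : (wall z t == wall z s) = false.
  by apply/eqP => /wall_label ts; rewrite ts edge_irr in st.
have st' : (wall z s == wall z t) = false by rewrite eq_sym.
apply: (@sep_cross _ _ z) => -[] [].
- exists (z * gen s * gen t); rewrite !(sep_trans (z * gen s) z (_ * gen t)).
  by rewrite !sep_gen wall_comm // !eqxx ts st'.
- by exists (z * gen s); rewrite !sep_gen eqxx st'.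
- by exists (z * gen t); rewrite !sep_gen eqxx ts.
- by exists z; rewrite !sepxx.
Qed.

End Translate.

Section Subgroup.
Context (T : finType) (X : sgraph T).
Local Notation e := (edge X).
Local Open Scope group_scope.
Local Notation G := (racg e).
Local Notation word := (@racg_word T e).
Local Notation gen := (@racg_gen T e).

Context (neighbour : forall s, exists t, e s t).
Context (H : set G) (H_subgroup : is_subgroup H) (H_fin_gen : fin_gen H)
  (H_join_free : join_free H).

Lemma tame_word : exists C m, forall h, H h -> exists u,
  [/\ reduced e u, word u = h, forall i, tube H C (prefix_elt X u i) &
      forall s0 (w : G) s, (count (crossers s0 u (wall w s)) (iota 0 (size u)) <= m)%N].
Proof.
have [C mono] := monotone_word neighbour H_subgroup H_fin_gen H_join_free.
have [D DP] := tube_join H_subgroup H_join_free C.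
exists C, ((run_bound D #|T|.*2).*2 + 3)%N => h /mono[u [ru uh ut]].
exists u; split=> // s0 w s; apply: crossers_bound => // i j J ijn Jj ijJ.
have := DP J _ _ Jj (ut i) (ut j) ijJ; rewrite -/(prefix_elt X u _) dist_prefix //; lia.
Qed.

Lemma crossing_bound : exists m, forall h h' w s (l : seq G), H h -> H h' -> uniq l ->
  (forall r, r \in l -> sep h h' r /\ cross r (wall w s)) -> (size l <= m)%N.
Proof.
have [C [m tame]] := tame_word; exists m => h h' w s l Hh Hh' ul lP.
have [|u [ru uh _ cu]] := tame (h^-1 * h').
  by apply: is_subgroupM => //; exact: is_subgroupV.
apply: leq_trans (cu s (h^-1 * w) s); rewrite -size_filter.
rewrite -(size_map (fun r => h^-1 * r * h) l) -(size_map (word_wall X s u)).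
apply: uniq_leq_size.
  rewrite map_inj_uniq // => r r'; rewrite -{2 4}(invgK h) => /eqP; rewrite conj_eq.
  by move/eqP.
move=> _ /mapP[r /lP[rs rc] ->].
have [|t tn rt] := @sep_word_wall T X s u ru (h^-1 * r * h).
  by rewrite sep_mulV uh mulg1 mulVKg.
have : cross (h^-1 * r * h) (wall (h^-1 * w) s).
  by rewrite -{2}(invgK h) wall_mul; exact: cross_mul.
rewrite rt => c; apply/mapP; exists t => //; rewrite mem_filter mem_iota tn andbT leq0n andbT.
exact/asboolP.
Qed.

(* The time [tau j] is the first one at which the path [v] has crossed the [j]-th
   member of a chain of nested walls, no wall crossing two consecutive members. *)
Lemma far_path_length : exists W C : nat, (0 < W)%N /\
  forall h N (v : nat -> G) (E R d : nat), H h ->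
  (forall i, (i < N)%N -> (dist (v i) (v i.+1) <= E)%N) ->
  (forall i k, (i <= N)%N -> H k -> (R <= dist k (v i))%N) ->
  (dist 1 (v 0%N) <= d)%N -> (dist h (v N) <= d)%N ->
  exists (M : nat) (tau : nat -> nat),
    [/\ forall j, (j < M)%N -> (tau j <= tau j.+1)%N,
        forall j, (j <= M)%N -> (tau j <= N)%N,
        (dist 1 h <= M.+1 * W + d.*2)%N &
        (M * R <= \sum_(0 <= j < M) dist (v (tau j)) (v (tau j.+1))
                  + M * (C + 3 * E) + dist 1 h)%N].
Proof.
(* Two walls of the word that are [W] apart have at least [3 * m + 1] others between them. Any wall
   is crossed by at most [m] of these, so one of them avoids three given walls ([pick]). *)
have [C [m tame]] := tame_word; pose W := (3 * m + 2)%N.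
exists W, C.+1; split=> [|h N v E R d Hh vE vR v0 vN]; first by rewrite /W addn2.
have [u [ru uh ut cu]] := tame h Hh; set n := size u.
have dh : dist 1 h = n by rewrite -uh -{1}(mul1g (word u)) dist_reduced.
case un : u => [|s0 u'].
  exists 0%N, (fun=> 0%N); split=> //; rewrite dh /n un /=; lia.
set wl := word_wall X s0 u; set xs := prefix_elt X u.
have {}cu (w : G) s : (count (crossers s0 u (wall w s)) (iota 0 n) <= m)%N by exact: cu.
(* The walls that the path may fail to cross, at most [d] at each end. *)
pose bad t := sep 1 (v 0%N) (wl t) || sep h (v N) (wl t).
pose P := [seq t <- iota 0 n | ~~ bad t].
have PP t : t \in P -> (t < n)%N /\ ~~ bad t by rewrite mem_filter mem_iota => /andP[-> /=].
have sizeP : (n <= size P + d.*2)%N.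
  have cnt x y : (count (fun t => sep x y (wl t)) (iota 0 n) <= dist x y)%N.
    rewrite -size_filter -(size_map wl); apply: le_dist.
      rewrite map_inj_in_uniq ?filter_uniq ?iota_uniq // => t t'.
      rewrite !mem_filter !mem_iota => /andP[_ tn] /andP[_ t'n].
      by apply: word_wall_inj.
    by move=> r /mapP[t]; rewrite mem_filter => /andP[st _] ->.
  have := count_predC bad (iota 0 n); rewrite size_iota.
  have -> : count (predC bad) (iota 0 n) = size P by rewrite size_filter.
  have := count_predUI (fun t => sep 1 (v 0%N) (wl t)) (fun t => sep h (v N) (wl t)) (iota 0 n).
  have := cnt 1 (v 0%N); have := cnt h (v N).
  rewrite (_ : count bad _ = count (predU (fun t => sep 1 (v 0%N) (wl t)) (fun t => sep h (v N) (wl t))) (iota 0 n)) //.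
  lia.
have [P0|P0] := posnP (size P).
  by exists 0%N, (fun=> 0%N); split=> //; rewrite ?dh /=; lia.
pose M := ((size P).-1 %/ W)%N; pose p j := nth 0%N P (j * W).
have jP j : (j <= M)%N -> (j * W < size P)%N.
  by rewrite /M leq_divRL ?/W; lia.
have pP j : (j <= M)%N -> (p j < n)%N /\ ~~ bad (p j) by move=> /jP jM; exact/PP/mem_nth.
have spaced a b : (a + b < size P)%N -> (nth 0%N P a + b <= nth 0%N P (a + b))%N.
  have sP : sorted ltn P by apply: sorted_filter (iota_ltn_sorted 0 n); exact: ltn_trans.
  elim: b => [|b IH]; first by rewrite !addn0.
  rewrite !addnS => ab; apply: leq_ltn_trans (IH _) _; first by lia.
  by rewrite (sorted_ltn_nth ltn_trans) // inE //; lia.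
have pW j : (j < M)%N -> (p j + W <= p j.+1)%N.
  move=> jM; have := jP j.+1 jM; rewrite /p.
  by rewrite (_ : j.+1 * W = j * W + W)%N; [exact: spaced|rewrite mulSn addnC].
have nest i t x : (i < t < n)%N -> ~ cross (wl i) (wl t) -> sep 1 x (wl t) -> sep 1 x (wl i).
  move=> itn nc xt; apply: contrapT => /negP/negbTE xi.
  have [b ib] := earlier_shields ru itn nc.
  by move: xt; rewrite /sep (ib x xi) -(ib 1 (sepxx _ _)) addbb.
have pick i j z t : (i + W <= j < n)%N -> exists l, [/\ (i < l < j)%N,
    ~ cross (wl l) (wl i), ~ cross (wl l) (wl j) & ~ cross (wl l) (wall z t)].
  move=> ijn; apply: contrapT => none; pose k := (j - i.+1)%N.
  pose a1 := crossers s0 u (wl i); pose a2 := crossers s0 u (wl j).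
  pose a3 := crossers s0 u (wall z t).
  have all3 : all (predU a1 (predU a2 a3)) (iota i.+1 k).
    apply/allP => l; rewrite mem_iota /k => il; apply: contrapT => nall.
    apply: none; exists l; split; first by rewrite /W in ijn; lia.
    - by move=> c; apply: nall; rewrite /= (asboolT c : a1 l).
    - by move=> c; apply: nall; rewrite /= (asboolT c : a2 l) orbT.
    - by move=> c; apply: nall; rewrite /= (asboolT c : a3 l) !orbT.
  have le (w : G) s : (count (crossers s0 u (wall w s)) (iota i.+1 k) <= m)%N.
    apply: leq_trans (cu w s); rewrite (_ : n = (i.+1 + (k + (n - j)))%N); last by rewrite /k /W in ijn *; lia.
    by rewrite 2!iotaD !count_cat add0n; lia.
  have := count_predUI a1 (predU a2 a3) (iota i.+1 k).
  have := count_predUI a2 a3 (iota i.+1 k).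
  have := all3; rewrite all_count size_iota => /eqP ->.
  have := le _ _ : (count a1 (iota i.+1 k) <= m)%N.
  have := le _ _ : (count a2 (iota i.+1 k) <= m)%N.
  have := le _ _ : (count a3 (iota i.+1 k) <= m)%N.
  rewrite /k /W in ijn *; lia.
have ncij i j : (i + W <= j < n)%N -> ~ cross (wl i) (wl j).
  move=> ijn c; have [l [ilj li lj _]] := pick i j 1 s0 ijn.
  have [x [xi xj]] := cross_sep 1 c false true.
  have xl : sep 1 x (wl l) by apply: (nest l j) => //; lia.
  have : sep 1 x (wl i) by apply: (nest i l) => //; [lia|move/cross_symP].
  by rewrite xi.
(* Choose [l] between [i] and [j] that crosses neither of them nor the given wall. A wall crossing
   both ends of this nest would have points in all four quadrants with the [l]-th wall. *)
have nc2 i j z t : (i + W <= j < n)%N -> cross (wall z t) (wl i) -> ~ cross (wall z t) (wl j).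
  move=> ijn ci cj; have [l [ilj li lj lr]] := pick i j z t ijn.
  apply: lr; apply/cross_symP; apply: (@sep_cross _ _ 1) => a b; case: b.
    have [x [xr xj]] := cross_sep 1 cj a true; exists x; split=> //.
    by apply: (nest l j) => //; lia.
  have [x [xr xi]] := cross_sep 1 ci a false; exists x; split=> //.
  apply: contraFF xi => xl; apply: (nest i l) => //; [lia|by move/cross_symP].
pose c j := wl (p j); pose far j i := sep 1 (v i) (c j).
pose tau j := find (far j) (iota 0 N.+1).
have far0 j : (j <= M)%N -> far j 0%N = false.
  by move=> /pP[_]; rewrite negb_or => /andP[/negbTE].
have farN j : (j <= M)%N -> far j N.
  move=> /pP[pn]; rewrite negb_or => /andP[_ /negbTE hN].
  by rewrite /far (sep_trans h) hN -uh -(prefix_size X (leqnn n)) sep1_prefix // pn.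
have has_far j : (j <= M)%N -> has (far j) (iota 0 N.+1).
  by move=> /farN jN; apply/hasP; exists N => //; rewrite mem_iota; lia.
have tauN j : (j <= M)%N -> (tau j <= N)%N.
  by move=> /has_far; rewrite has_find size_iota ltnS.
have far_tau j : (j <= M)%N -> far j (tau j).
  move=> jM; have := nth_find 0%N (has_far j jM); rewrite nth_iota //.
  by rewrite ltnS tauN.
have before j i : (j <= M)%N -> (i < tau j)%N -> far j i = false.
  move=> jM ij; have := before_find 0%N ij; rewrite nth_iota //.
  by have := tauN j jM; lia.
have tau_mono j : (j < M)%N -> (tau j <= tau j.+1)%N.
  move=> jM; rewrite leqNgt; apply/negP => lt.
  have := before j _ (ltnW jM) lt; have := far_tau j.+1 jM; rewrite /far => fj.
  have [pn _] := pP j.+1 jM; have pj := pW j jM.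
  rewrite (nest (p j) (p j.+1)) //; first by rewrite /W in pj; lia.
  by apply: ncij; lia.
have adj j : (j <= M)%N -> exists y s, (dist y (v (tau j)) <= E)%N /\ wall y s = c j.
  move=> jM; have := far_tau j jM; have := before j (tau j).-1 jM; have := tauN j jM.
  case: (tau j) => [|t] tN; first by rewrite far0.
  rewrite /= ltnSn => /(_ isT) nt ft.
  have : sep (v t) (v t.+1) (c j) by rewrite (sep_trans 1) sep_sym -/(far j t) nt.
  rewrite -mem_walls => /crossed_wall[u1 [s [u2 [uE ->]]]]; exists (v t * word u1), s.
  split=> //; have := vE t tN; rewrite dist_size uE size_cat /=.
  have := rwordK ((v t)^-1 * v t.+1); rewrite uE word_cat => E1.
  have -> : v t.+1 = v t * word u1 * word (s :: u2) by rewrite -mulgA E1 mulVKg.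
  by have := dist_word (v t * word u1) (s :: u2); rewrite /=; lia.
have step j : (j < M)%N -> (R + p j <= C.+1 + 3 * E + dist (v (tau j)) (v (tau j.+1)) + p j.+1)%N.
  move=> jM; have [y [s [yv yc]]] := adj j (ltnW jM).
  have [y' [s' [yv' yc']]] := adj j.+1 jM.
  have [pn _] := pP j (ltnW jM); have [pn' _] := pP j.+1 jM; have pj := pW j jM.
  have [k Hk kz] := ut (p j); rewrite -/xs in kz.
  have Rk : (R <= dist k (v (tau j)))%N by apply: vR => //; apply: tauN; exact: ltnW.
  have zz : (dist (xs (p j)) (xs (p j.+1)) = p j.+1 - p j)%N by rewrite dist_prefix //; lia.
  (* Both [y] and [xs (p j)] are adjacent to [c j], so another wall between them crosses [c j]. It
     then cannot cross [c j.+1], hence does not separate [y'] from [xs (p j.+1)], and so separates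
     [y] from [y'] or [xs (p j)] from [xs (p j.+1)]. *)
  have yz : (dist y (xs (p j)) <= dist y y' + (p j.+1 - p j) + 1)%N.
    rewrite -zz addn1 -[X in (_ <= X.+1)%N]size_cat.
    apply: (@dist_le _ _ _ _ (c j :: (walls y y' ++ walls (xs (p j)) (xs (p j.+1))))).
    move=> r yr; rewrite inE; have [//|rc] := eqVneq r (c j); rewrite mem_cat !mem_walls /=.
    have ry : cross r (c j) by rewrite -yc; apply: adj_cross yr _; rewrite yc.
    have [z [t rE]] : exists z t, r = wall z t.
      by move: yr; rewrite -mem_walls => /crossed_wall[u1 [t [u2 [_ ->]]]]; exists (y * word u1), t.
    case yr' : (sep y' (xs (p j.+1)) r); last first.
      move: yr; rewrite (sep_trans y') (sep_trans (xs (p j.+1)) y') yr' (sep_sym (xs (p j.+1))).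
      by case: sep; case: sep.
    have cc : ~ cross (c j) (c j.+1) by apply: ncij; lia.
    have [rc'|rc'] := eqVneq r (c j.+1); first by case: cc; apply: cross_symP; rewrite -rc'.
    have : cross r (c j.+1) by rewrite -yc'; apply: adj_cross yr' _; rewrite yc'.
    move=> rc2; case: (@nc2 (p j) (p j.+1) z t); rewrite -?rE //; lia.
  have t1 := dist_triangle (xs (p j)) k (v (tau j)).
  have t2 := dist_triangle y (xs (p j)) (v (tau j)); rewrite (dist_sym _ y) in t2.
  have t3 := dist_triangle (v (tau j)) y y'.
  have t4 := dist_triangle (v (tau j.+1)) (v (tau j)) y'; rewrite (dist_sym (v (tau j.+1)) y') in t4.
  lia.
exists M, tau; split=> //.
  rewrite dh; apply: leq_trans sizeP _; rewrite leq_add2r mulnC.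
  have := ltn_ceil (size P).-1 (_ : 0 < W)%N; rewrite -/M /W; lia.
rewrite dh; suff Hs M' : (M' <= M)%N -> (M' * R <=
    \sum_(0 <= j < M') dist (v (tau j)) (v (tau j.+1)) + M' * (C.+1 + 3 * E) + p M')%N.
  apply: leq_trans (Hs M (leqnn _)) _; rewrite leq_add2l.
  by have [pn _] := pP M (leqnn _); exact: ltnW.
elim: M' => [//|M' IH] M'M; rewrite big_nat_recr //= !mulSn.
by have := IH (ltnW M'M); have := step M' M'M; lia.
Qed.

End Subgroup.

(** * Flats of four-cycles and paths avoiding the subgroup *)

Section Alternating.
Context (T : finType) (X : sgraph T).
Local Notation e := (edge X).
Local Open Scope group_scope.
Local Notation G := (racg e).
Local Notation word := (@racg_word T e).
Local Notation gen := (@racg_gen T e).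

(** For distinct non-adjacent [a] and [c], the geodesics from [1] in an infinite dihedral subgroup;
    the two diagonals of a four-cycle give the two directions of a flat. *)
Fixpoint alt (a c : T) n := if n is n'.+1 then a :: alt c a n' else [::].

Lemma size_alt a c n : size (alt a c n) = n.
Proof. by elim: n a c => //= n IH a c; rewrite IH. Qed.

Lemma mem_alt a c n s : s \in alt a c n -> s = a \/ s = c.
Proof.
by elim: n a c => //= n IH a c; rewrite inE => /orP[/eqP->|/IH[]->]; [left|right|left].
Qed.

Lemma take_alt a c n i : (i <= n)%N -> take i (alt a c n) = alt a c i.
Proof. by elim: n a c i => [|n IH] a c [|i] //=; rewrite ltnS => /IH->. Qed.

(** If the first wall recurred, [adj_cross] would make the second one cross it, against the
    non-adjacency of [a] and [c]. *)
Lemma alt_reduced a c n : a != c -> ~~ e a c -> reduced e (alt a c n).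
Proof.
elim: n a c => [//|n IH] a c ac nac.
have red : reduced e (alt c a n) by apply: IH; rewrite 1?eq_sym // edge_sym.
rewrite /reduced /= reduced_crossed red andbT mul1g; apply/negP.
move=> /crossed_wall[u1 [s [u2 [uE E]]]].
have {}E : wall (gen a) a = wall (gen a * word u1) s.
  by rewrite -E -[gen a]mul1g wall_gen.
case: u1 uE E => [|b u1] uE E.
  rewrite mulg1 in E; have := wall_label E; case: n uE {IH red} => //= n [<- _] ca.
  by rewrite ca eqxx in ac.
have bc : b = c by case: n uE {IH red} => //= n [].
rewrite {}bc in uE E.
have red1 : reduced e (c :: u1) by move: red; rewrite uE => /reduced_cat[].
have cr : cross (wall (gen a) c) (wall (gen a) a).
  apply: (adj_cross E); first by rewrite -mem_crossed //= inE eqxx.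
  by apply/eqP => /wall_label ca; rewrite ca eqxx in ac.
by have := cross_label cr; rewrite edge_sym (negbTE nac).
Qed.

Lemma word_comm (u v : seq T) : (forall s t, s \in u -> t \in v -> e s t) ->
  word u * word v = word v * word u.
Proof.
have one s w : (forall t, t \in w -> e s t) -> gen s * word w = word w * gen s.
  elim: w => [|t w IH] st; first by rewrite word_nil mulg1 mul1g.
  rewrite word_cons mulgA racg_gen_comm ?st ?inE ?eqxx // -mulgA IH ?mulgA // => t' tw.
  by rewrite st // inE tw orbT.
elim: u => [|s u IH] uv; first by rewrite word_nil mulg1 mul1g.
rewrite !word_cons -mulgA IH; first by rewrite !mulgA one // => t; apply: uv; rewrite inE eqxx.
by move=> a t au; apply: uv; rewrite inE au orbT.
Qed.

End Alternating.

Section Subgroup.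
Context (T : finType) (X : sgraph T).
Local Notation e := (edge X).
Local Open Scope group_scope.
Local Notation G := (racg e).
Local Notation word := (@racg_word T e).
Local Notation gen := (@racg_gen T e).

Context (neighbour : forall s, exists t, e s t).
Context (H : set G) (H_subgroup : is_subgroup H) (H_fin_gen : fin_gen H)
  (H_join_free : join_free H).

Definition far R (x : G) := forall k, H k -> (R <= dist k x)%N.

Definition joined R (l : nat) (x y : G) := exists u : seq T,
  [/\ x * word u = y, (size u <= l)%N & forall i, far R (x * word (take i u))].

Lemma joined_le R l l' x y : (l <= l')%N -> joined R l x y -> joined R l' x y.
Proof. by move=> ll [u [? ? ?]]; exists u; split=> //; lia. Qed.

Lemma joined_refl R x : far R x -> joined R 0 x x.
Proof. by exists [::]; split; rewrite ?mulg1 // => i; rewrite mulg1. Qed.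

Lemma joined_gen R x s : far R x -> far R (x * gen s) -> joined R 1 x (x * gen s).
Proof.
move=> fx fxs; exists [:: s]; split=> // -[|[|i]] //; rewrite /= word_nil mulg1 //.
Qed.

Lemma joined_trans R l l' x y z :
  joined R l x y -> joined R l' y z -> joined R (l + l') x z.
Proof.
move=> [u [<- ul uf]] [v [<- vl vf]]; exists (u ++ v); split.
- by rewrite word_cat mulgA.
- by rewrite size_cat leq_add.
- by move=> i; rewrite take_cat; case: ifP => _; rewrite ?word_cat ?mulgA.
Qed.

Lemma joined_sym R l x y : joined R l x y -> joined R l y x.
Proof.
move=> [u [<- ul uf]]; exists (rev u); rewrite size_rev; split=> //.
  by rewrite word_rev mulgK.
move=> i; rewrite -{1}(cat_take_drop (size u - i) u) take_rev.
rewrite word_cat word_rev !mulgA mulgK; exact: uf.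
Qed.

(* The walls crossed by the first alternating word all cross the wall of [b] at
   [x], so [crossing_bound] limits how many of them separate elements of [H]. *)
Lemma far_flat : exists m, forall C R J a b c d i x, tube H C x -> (R + C + m <= J)%N ->
  a != c -> ~~ e a c -> (forall s t, s \in [:: a; c] -> t \in [:: b; d] -> e s t) ->
  far R (x * word (alt a c J) * word (alt b d i)).
Proof.
have [m cb] := crossing_bound neighbour H_subgroup H_fin_gen H_join_free.
exists m => C R J a b c d i x [h Hh hx] JR ac nac ab k Hk.
have red : reduced e (alt a c J) by exact: alt_reduced.
set y := _ * word _; pose l := crossed x (alt a c J).
pose bad r := sep h x r || sep k y r.
have lcross r : r \in l -> sep x y r /\ cross r (wall x b).
  move=> rl; have [u1 [s [u2 [uE rE]]]] := crossed_wall rl.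
  have sac : s \in [:: a; c].
    have : s \in alt a c J by rewrite uE mem_cat inE eqxx orbT.
    by rewrite !inE => /mem_alt[]->; rewrite eqxx ?orbT.
  split.
    rewrite /y -mulgA -word_cat sep_word crossed_cat count_cat.
    rewrite (count_uniq_mem _ (_ : uniq (crossed x (alt a c J)))) ?reduced_crossed // rl.
    rewrite (_ : count_mem r _ = 0%N) //; apply/count_memPn/negP.
    move=> /crossed_wall[v1 [t [v2 [vE]]]]; rewrite rE => /wall_label st.
    have tbd : t \in [:: b; d].
      have : t \in alt b d i by rewrite vE mem_cat inE eqxx orbT.
      by rewrite !inE => /mem_alt[]->; rewrite eqxx ?orbT.
    by have := ab s t sac tbd; rewrite st edge_irr.
  have u1b t : t \in u1 -> e t b.
    move=> tu; apply: ab; last by rewrite inE eqxx.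
    have : t \in alt a c J by rewrite uE mem_cat tu.
    by rewrite !inE => /mem_alt[]->; rewrite eqxx ?orbT.
  have -> : wall x b = wall (x * word u1) b.
    rewrite wall_mul /wall -/(wall _ _); have := @word_comm T X u1 [:: b].
    move=> -> ; last by move=> s' t' su; rewrite inE => /eqP->; exact: u1b.
    by rewrite -[word [:: b]]/(gen b) mulgK.
  by rewrite rE; apply: corner_cross; apply: ab; rewrite // inE eqxx.
(* A wall of [l] that separates neither [h] from [x] nor [k] from [y] separates [h] from [k]. Thus
   all but at most [C + m] of the [J] walls of [l] separate [k] from [y]. *)
have good : (count (predC bad) l <= m)%N.
  rewrite -size_filter; apply: (cb h k x b) => //; first by rewrite filter_uniq // reduced_crossed.
  move=> r; rewrite mem_filter /bad /= negb_or => /andP[/andP[/negbTE hr /negbTE kr] /lcross[xy c']].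
  split=> //; rewrite (sep_trans x) hr (sep_trans y) xy sep_sym.
  by rewrite kr.
have cnt p q : (count (sep p q) l <= dist p q)%N.
  rewrite -size_filter; apply: le_dist; first by rewrite filter_uniq // reduced_crossed.
  by move=> r; rewrite mem_filter => /andP[].
have := count_predC bad l; rewrite size_crossed size_alt.
have := count_predUI (sep h x) (sep k y) l; have := cnt h x; have := cnt k y.
have -> : count bad l = count (predU (sep h x) (sep k y)) l by [].
lia.
Qed.

Section Flats.
Context (m C R : nat).
Hypothesis far_flatJ : forall J a b c d i x, tube H C x -> (R + C + m <= J)%N ->
  a != c -> ~~ e a c -> (forall s t, s \in [:: a; c] -> t \in [:: b; d] -> e s t) ->
  far R (x * word (alt a c J) * word (alt b d i)).
Let J := (R + C + m)%N.

Lemma joined_half x a b c d : tube H C x -> a != c -> ~~ e a c ->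
  (forall s t, s \in [:: a; c] -> t \in [:: b; d] -> e s t) ->
  joined R J (x * word (alt a c J)) (x * word (alt a c J) * word (alt b d J)).
Proof.
move=> xC ac nac ab; exists (alt b d J); rewrite size_alt; split=> // i.
have [iJ|Ji] := leqP i J; first by rewrite take_alt //; exact: far_flatJ.
by rewrite take_oversize ?size_alt; [exact: far_flatJ|exact: ltnW].
Qed.

(** The path follows the two sides opposite to [x] of a square in the flat at [x]; the two
    alternating words commute, so both sides end at the same corner. *)
Lemma joined_corner x a b c d : tube H C x -> a != c -> ~~ e a c -> b != d -> ~~ e b d ->
  (forall s t, s \in [:: a; c] -> t \in [:: b; d] -> e s t) ->
  joined R (2 * J) (x * word (alt a c J)) (x * word (alt b d J)).
Proof.
move=> xC ac nac bd nbd ab; rewrite mul2n -addnn.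
apply: joined_trans (joined_half xC ac nac ab) _.
have ba s t : s \in [:: b; d] -> t \in [:: a; c] -> e s t.
  by move=> sb ta; rewrite edge_sym ab.
rewrite -mulgA (word_comm (u := alt a c J)); last first.
  move=> s t /mem_alt sac /mem_alt tbd; apply: ab; rewrite !inE.
    by case: sac => ->; rewrite eqxx ?orbT.
  by case: tbd => ->; rewrite eqxx ?orbT.
by rewrite mulgA; apply/joined_sym/joined_half.
Qed.

(** Four-cycles adjacent in the four-cycle graph share a non-adjacent pair, hence such a point at
    the same [x]: there the path passes from one flat to the next. *)
Definition axis x (Q : {set T}) y := exists b d,
  [/\ b \in Q, d \in Q, b != d, ~~ e b d & y = x * word (alt b d J)].

(** The last clause says that a non-adjacent pair in [Q] is one of the two diagonals, in either
    order, and so is joined to the whole of the other one. *)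
Lemma four_cycleP Q : induced_four_cycle e Q -> exists a b c d,
  [/\ [/\ a \in Q, b \in Q, c \in Q & d \in Q],
      [/\ a != c, ~~ e a c, b != d & ~~ e b d],
      forall s t, s \in [:: a; c] -> t \in [:: b; d] -> e s t,
      forall s, s \in Q -> s \in [:: a; c] \/ s \in [:: b; d] &
      forall p q, p \in Q -> q \in Q -> p != q -> ~~ e p q ->
        (forall s t, s \in [:: p; q] -> t \in [:: b; d] -> e s t) \/
        (forall s t, s \in [:: p; q] -> t \in [:: a; c] -> e s t)].
Proof.
move=> /existsP[a /existsP[b /existsP[c /existsP[d /and5P[/eqP QE abcd ab bc /and4P[cd da nac nbd]]]]]].
have [ba cb dc ad] : [/\ e b a, e c b, e d c & e a d] by split; rewrite edge_sym.
move: abcd; rewrite /= !inE !negb_or -!andbA => /and4P[_ ac _ /and4P[_ bd _ _]].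
exists a, b, c, d; rewrite QE; split.
- by rewrite !inE !eqxx !orbT.
- by [].
- by move=> s t; rewrite !inE => /orP[]/eqP-> /orP[]/eqP->.
- move=> s; rewrite !inE => /orP[/orP[/orP[]|]|] ->; rewrite ?orbT; by [left|right].
- have two (P : T -> T -> Prop) p q r s : P p r -> P p s -> P q r -> P q s ->
      forall x y, x \in [:: p; q] -> y \in [:: r; s] -> P x y.
    by move=> ? ? ? ? x y; rewrite !inE => /orP[]/eqP-> /orP[]/eqP->.
  move=> p q; rewrite !inE => /orP[/orP[/orP[]|]|]/eqP-> /orP[/orP[/orP[]|]|]/eqP->;
    rewrite ?eqxx ?ab ?bc ?cd ?da ?ba ?cb ?dc ?ad //= => _ _;
    by [left; apply: (two (fun x y => is_true (e x y)))|right; apply: (two (fun x y => is_true (e x y)))].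
Qed.

(** At most three corners, of length [2 * J] each, lead from [y] to [y']: one at each end, and one
    to change the diagonal. *)
Lemma joined_axis x Q y y' : tube H C x -> induced_four_cycle e Q ->
  axis x Q y -> axis x Q y' -> joined R (6 * J) y y'.
Proof.
move=> xC /four_cycleP[a [b [c [d [_ [ac nac bd nbd] ab _ opp]]]]].
have jac := joined_corner xC ac nac bd nbd ab.
have half z : axis x Q z -> joined R (2 * J) z (x * word (alt b d J)) \/
    joined R (2 * J) z (x * word (alt a c J)).
  move=> [p [q [pQ qQ pq npq ->]]].
  by have [adj|adj] := opp p q pQ qQ pq npq; [left|right]; apply: joined_corner.
have E : (6 * J = 2 * J + (2 * J + 2 * J))%N by lia.
have hb z : axis x Q z -> joined R (2 * J + 2 * J) z (x * word (alt b d J)).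
  move=> /half[jz|jz]; first by apply: joined_le jz; lia.
  exact: joined_trans jac.
rewrite E => /half[jy|jy] /half[jy'|jy'].
- by apply: (@joined_le R (2 * J + 2 * J)); [lia|apply: joined_trans jy (joined_sym jy')].
- by apply: joined_trans jy _; apply: joined_trans (joined_sym jac) (joined_sym jy').
- by apply: joined_trans jy _; apply: joined_trans jac (joined_sym jy').
- by apply: (@joined_le R (2 * J + 2 * J)); [lia|apply: joined_trans jy (joined_sym jy')].
Qed.

Lemma joined_chain x Q p y y' : tube H C x -> induced_four_cycle e Q ->
  path (four_cycle_adj e) Q p -> axis x Q y -> axis x (last Q p) y' ->
  induced_four_cycle e (last Q p) /\ joined R (6 * J * (size p).+1) y y'.
Proof.
move=> xC; elim: p Q y => [|Q' p IH] Q y Qc /=.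
  by move=> _ yQ y'Q; split=> //; rewrite muln1; exact: joined_axis yQ y'Q.
move=> /andP[/and4P[_ Q'c _ /existsP[b /existsP[d /and4P[bd nbd bQQ dQQ]]]] path'] yQ y'Q.
move: bQQ dQQ; rewrite !finset.in_setI => /andP[bQ bQ'] /andP[dQ dQ'].
have zQ : axis x Q (x * word (alt b d J)) by exists b, d.
have zQ' : axis x Q' (x * word (alt b d J)) by exists b, d.
have [lc jz] := IH Q' _ Q'c path' zQ' y'Q; split=> //.
by rewrite mulnS; apply: joined_trans jz; exact: joined_axis yQ zQ.
Qed.

End Flats.

Lemma component_induced Q0 Q : induced_four_cycle e Q0 ->
  connect (four_cycle_adj e) Q0 Q -> induced_four_cycle e Q.
Proof.
move=> Q0c /connectP[p]; elim/last_ind: p => [_ ->//|p Q' _].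
by rewrite rcons_path last_rcons => /andP[_ /and4P[_ Q'c _ _]] ->.
Qed.

Lemma far_path_exists : CFS e -> exists A : nat, forall R h, H h ->
  exists g, (dist 1 g <= A * R.+1)%N /\ joined R (A * R.+1 * (dist 1 h).+1) g (h * g).
Proof.
move=> [Q0 Q0c cov]; have [m ff] := far_flat.
have [C [m' tame]] := tame_word neighbour H_subgroup H_fin_gen H_join_free.
(* A chain of four-cycles costs [6 * J] for each member, and [shortenP] removes repetitions. *)
pose K := (6 * #|{set T}|.+1)%N.
exists (K.*2.+1 * (C + m).+1)%N => R h Hh; pose J := (R + C + m)%N.
have {}ff := ff C R.
have chain x Q y y' : tube H C x -> connect (four_cycle_adj e) Q0 Q ->
    axis m C R x Q0 y -> axis m C R x Q y' -> joined R (K * J) y y'.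
  move=> xC /connectP[p0 /shortenP[p pp up _] ->] yQ y'Q.
  have [_] := joined_chain ff xC Q0c pp yQ y'Q; apply: joined_le.
  rewrite /K mulnAC leq_mul2r leq_mul2l /= ltnS; apply/orP; right.
  apply: leq_trans (_ : size (Q0 :: p) <= _)%N => //.
  by rewrite -(card_uniqP up) max_card.
have induced Q := @component_induced Q0 Q Q0c.
have [a [b [c [d [[aQ _ cQ _] [ac nac _ _] ab _ _]]]]] := four_cycleP Q0c.
pose g := word (alt a c J); have gQ x : axis m C R x Q0 (x * g) by exists a, c.
have farg x : tube H C x -> far R (x * g).
  move=> xC; have := @ff J a b c d 0%N x xC (leqnn _) ac nac ab.
  by rewrite /= word_nil mulg1.
(* By CFS, [s] lies in a four-cycle [Q] of the component; it commutes with the diagonal [p], [q] of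
   [Q] that avoids it. Far out along this diagonal, a single edge [s] leads from the flats at [x] to
   those at [x * gen s]; chains of four-cycles at both points connect it to [g]. *)
have step x s : tube H C x -> tube H C (x * gen s) ->
    joined R (K.*2 * J).+1 (x * g) (x * gen s * g).
  move=> xC xsC; have : s \in finset.cover (four_cycle_component e Q0) by rewrite cov inE.
  move=> /finset.bigcupP[Q]; rewrite inE => Qconn sQ.
  have [p [q [pQ qQ pq npq spq]]] : exists p q, [/\ p \in Q, q \in Q, p != q, ~~ e p q &
      forall s' t, s' \in [:: p; q] -> t \in [:: s; s] -> e s' t].
    have [a' [b' [c' [d' [[aQ' bQ' cQ' dQ'] [ac' nac' bd' nbd'] ab' sc _]]]]] :=
      four_cycleP (induced _ Qconn).
    have [sac|sbd] := sc s sQ.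
      exists b', d'; split=> // s' t sb; rewrite !inE orbb => /eqP->.
      by rewrite edge_sym; apply: ab'.
    exists a', c'; split=> // s' t sb; rewrite !inE orbb => /eqP->.
    exact: ab'.
  have far1 x' : tube H C x' -> far R (x' * word (alt p q J)).
    move=> xC'; have := @ff J p s q s 0%N x' xC' (leqnn _) pq npq spq.
    by rewrite /= word_nil mulg1.
  have comm : x * gen s * word (alt p q J) = x * word (alt p q J) * gen s.
    rewrite -!mulgA; congr (_ * _); have := @word_comm T X [:: s] (alt p q J) => -> //.
    move=> s' t; rewrite inE => /eqP-> /mem_alt tpq; rewrite edge_sym; apply: spq.
      by rewrite !inE; case: tpq => ->; rewrite eqxx ?orbT.
    by rewrite !inE eqxx.
  have j1 : joined R (K * J) (x * g) (x * word (alt p q J)).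
    by apply: (chain x Q) => //; exists p, q.
  have j2 : joined R 1 (x * word (alt p q J)) (x * gen s * word (alt p q J)).
    by rewrite comm; apply: joined_gen; rewrite -?comm; exact: far1.
  have j3 : joined R (K * J) (x * gen s * word (alt p q J)) (x * gen s * g).
    by apply: joined_sym; apply: (chain (x * gen s) Q) => //; exists p, q.
  have := joined_trans j1 (joined_trans j2 j3); apply: joined_le.
  by rewrite -addnn mulnDl add1n addnS.
have [u [ru uh ut _]] := tame h Hh.
have dh : dist 1 h = size u by rewrite -uh -{1}(mul1g (word u)) dist_reduced.
have J1 : ((K.*2 * J).+1 <= K.*2.+1 * (C + m).+1 * R.+1)%N.
  have : (J.+1 <= (C + m).+1 * R.+1)%N by rewrite /J; nia.
  by move=> JJ; rewrite -mulnA mulSn; apply: leq_trans (_ : K.*2 * J + J.+1 <= _)%N; nia.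
exists g; split.
  apply: leq_trans (_ : size (alt a c J) <= _)%N; last by rewrite size_alt; nia.
  by have := dist_word (1 : G) (alt a c J); rewrite mul1g.
have walk i : (i <= size u)%N -> joined R (i * (K.*2 * J).+1) g (word (take i u) * g).
  elim: i => [_|i IH iu].
    rewrite take0 mul1g mul0n; apply: joined_refl; rewrite -(mul1g g); apply: farg.
    by have := ut 0%N; rewrite /prefix_elt take0.
  rewrite mulSn addnC; apply: joined_trans (IH (ltnW iu)) _.
  have [s0 _] : exists s0 : T, True by exists a.
  have E : word (take i.+1 u) = word (take i u) * gen (nth s0 u i).
    exact: (@prefixS T X s0 u i iu).
  rewrite E; apply: step; first exact: ut.
  by rewrite -E; exact: ut.
have := walk (size u) (leqnn _); rewrite take_size uh; apply: joined_le.
by rewrite dh mulnC leq_mul.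
Qed.

End Subgroup.

Import Order.TTheory GRing.Theory Num.Theory.
Import numFieldTopology.Exports.

(** * Lipschitz paths in metric spaces *)

Section Metric.
Context {R : realType} {X : metricType R}.
Local Open Scope classical_set_scope.
Local Open Scope ring_scope.

Lemma edist_mdist (x y : X) : edist (x, y) = (mdist x y)%:E.
Proof.
apply/eqP; rewrite eq_le; apply/andP; split.
  apply/lee_addgt0Pr => eps eps0; apply: ereal_inf_lbound.
  exists (mdist x y + eps) => //=; split; last by rewrite ballEmdist /= ltrDl.
  by rewrite ltr_wpDl// mdist_ge0.
apply: le_ereal_inf_tmp => _ [r [r0 + <-]]; rewrite ballEmdist /= => xy.
by rewrite lee_fin ltW.
Qed.

Context (A : set X).

Lemma edist_inf_ltP (x : X) (r : R) :
  (edist_inf A x < r%:E)%E <-> exists2 a, A a & mdist x a < r.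
Proof.
split=> [/ereal_inf_lt[_ [a Aa <-]]|[a Aa xa]].
  by rewrite edist_mdist lte_fin; exists a.
apply: le_lt_trans (_ : (mdist x a)%:E < _)%E; last by rewrite lte_fin.
by apply: ereal_inf_lbound; exists a => //; rewrite edist_mdist.
Qed.

Lemma nbhd_complP (r : R) (x : X) :
  nbhd_compl A r x <-> forall a, A a -> r <= mdist x a.
Proof.
split=> [nx a Aa|H /edist_inf_ltP[a /H]]; last by rewrite leNgt => /negP.
by rewrite leNgt; apply/negP => xa; apply: nx; apply/edist_inf_ltP; exists a.
Qed.

Lemma nbhd_frontierP (r : R) (x : X) : nbhd_frontier A r x <->
  nbhd_compl A r x /\ forall eps, 0 < eps -> exists2 a, A a & mdist x a < r + eps.
Proof.
split=> [xr|[cx near]].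
  rewrite /nbhd_frontier /= in xr; split; first by rewrite /nbhd_compl /= xr ltxx.
  by move=> eps eps0; apply/edist_inf_ltP; rewrite xr lte_fin ltrDl.
apply/eqP; rewrite eq_le; apply/andP; split; last by rewrite leNgt; apply/negP.
apply/lee_addgt0Pr => eps /near/edist_inf_ltP/ltW.
by rewrite EFinD.
Qed.

(** With 1-Lipschitz paths on [[0, K]], concatenating, cutting and bounding lengths require no
    computation of [path_length]. *)
Definition lipschitz_path (C : set X) (x y : X) (K : R) : Prop :=
  0 <= K /\ exists f : R -> X, [/\ f 0 = x, f K = y,
    forall s t, 0 <= s <= K -> 0 <= t <= K -> mdist (f s) (f t) <= `|s - t| &
    forall s, 0 <= s <= K -> C (f s)].

Lemma lipschitz_path_dist C x y K : lipschitz_path C x y K -> mdist x y <= K.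
Proof.
move=> [K0 [f [<- <- fl _]]]; apply: le_trans (fl 0 K _ _) _; rewrite ?lexx ?K0 //.
by rewrite sub0r normrN ger0_norm.
Qed.

Lemma lipschitz_path_refl (C : set X) x : C x -> lipschitz_path C x x 0.
Proof.
move=> Cx; split=> //; exists (fun=> x); split=> // s t _ _.
by rewrite mdistxx.
Qed.

Lemma lipschitz_path_sub (C D : set X) x y K : (forall z, mdist x z <= K -> C z -> D z) ->
  lipschitz_path C x y K -> lipschitz_path D x y K.
Proof.
move=> CD [K0 [f [fx fy fl fC]]]; split=> //; exists f; split=> // s sK.
apply: CD (fC s sK); rewrite -fx; apply: le_trans (fl 0 s _ sK) _; first by rewrite lexx.
by case/andP: sK => s0 sK; rewrite sub0r normrN ger0_norm.
Qed.

Lemma lipschitz_path_sym C x y K : lipschitz_path C x y K -> lipschitz_path C y x K.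
Proof.
move=> [K0 [f [fx fy fl fC]]]; split=> //; exists (fun t => f (K - t)).
split; rewrite ?subr0 ?subrr // => s.
  move=> t sK tK; apply: le_trans (fl _ _ _ _) _; try lra.
  by rewrite (_ : K - s - (K - t) = t - s); [rewrite distrC|ring].
by move=> sK; apply: fC; lra.
Qed.

Lemma lipschitz_path_trans C x y z K L :
  lipschitz_path C x y K -> lipschitz_path C y z L -> lipschitz_path C x z (K + L).
Proof.
move=> [K0 [f [fx fy fl fC]]] [L0 [g [gx gy gl gC]]]; split; first exact: addr_ge0.
pose h t := if t <= K then f t else g (t - K); exists h; split.
- by rewrite /h K0.
- rewrite /h; case: ifPn => [KL|_]; last by rewrite addrAC subrr add0r.
  have L00 : L = 0 by lra.
  by rewrite L00 addr0 fy -gx -gy L00.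
- have hl s t : s <= t -> 0 <= s <= K + L -> 0 <= t <= K + L -> mdist (h s) (h t) <= `|s - t|.
    move=> st sK tK; rewrite /h; case: ifPn => sK'; case: ifPn => tK'.
    + by apply: fl; lra.
    + apply: le_trans (metric_triangle _ y _) _.
      rewrite -[X in mdist _ X]fy -[X in mdist X (g _)]gx.
      apply: le_trans (lerD (fl s K _ _) (gl 0 (t - K) _ _)) _; try lra.
      rewrite -ltNge in tK'; rewrite !ler0_norm; lra.
    + lra.
    + by apply: le_trans (gl _ _ _ _) _; [lra|lra|rewrite opprB addrA subrK].
  move=> s t sK tK; case: (leP s t) => st; first exact: hl.
  by rewrite metric_sym distrC; apply: hl => //; exact: ltW.
- by move=> s sK; rewrite /h; case: ifPn => sK'; [apply: fC|apply: gC]; lra.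
Qed.

Lemma length_dist_lipschitz C x y K : lipschitz_path C x y K ->
  (length_dist C x y <= K%:E)%E.
Proof.
move=> [K0 [f [fx fy fl fC]]]; pose g t := f (K * t).
have K01 t : 0 <= t <= 1 -> 0 <= K * t <= K.
  by move=> /andP[t0 t1]; rewrite mulr_ge0//= ler_piMr.
have gl s t : 0 <= s <= 1 -> 0 <= t <= 1 -> mdist (g s) (g t) <= K * `|s - t|.
  move=> s01 t01; apply: le_trans (fl _ _ (K01 s s01) (K01 t t01)) _.
  by rewrite -mulrBr normrM (ger0_norm K0).
have gpath : path_in C x y g.
  split; rewrite /g ?mulr0 ?mulr1 //; last first.
    by move=> _ [t + <-]; rewrite /= in_itv /= => /K01; exact: fC.
  apply/subspace_continuousP => t; rewrite /= in_itv /= => t01.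
  apply/metricType_numDomainType.cvgrPdist_lt => eps eps0.
  (* The summand 1 covers the case [K = 0]. *)
  rewrite near_withinE; apply/nbhs_ballP; exists (eps / (K + 1)) => /=.
    by rewrite divr_gt0// ltr_wpDl.
  move=> z; rewrite /ball /= in_itv /= => tz z01.
  apply: le_lt_trans (gl t z t01 z01) _.
  apply: le_lt_trans (_ : (K + 1) * `|t - z| < _); first by rewrite ler_wpM2r// lerDl.
  by rewrite mulrC -ltr_pdivlMr// ltr_wpDl.
apply: le_trans (_ : path_length g <= _)%E; first by apply: ereal_inf_lbound; exists g.
apply: ge_ereal_sup => _ [s sP <-]; rewrite lee_fin.
have nth01 i : (i < (size s).+1)%N -> 0 <= nth 1 (0 :: s) i <= 1.
  by move=> iS; rewrite (itv_partition_nth_ge iS sP) (itv_partition_nth_le iS sP).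
have nthle i : (i < size s)%N -> nth 1 (0 :: s) i <= nth 1 (0 :: s) i.+1.
  by move=> iS; case: sP => /(pathP 1)/(_ i iS)/ltW.
apply: le_trans (_ : \sum_(0 <= i < size s) K * (nth 1 (0 :: s) i.+1 - nth 1 (0 :: s) i) <= _).
  rewrite !big_nat; apply: ler_sum => i /= iS.
  apply: le_trans (gl _ _ (nth01 i (leqW iS)) (nth01 i.+1 iS)) _.
  by rewrite distrC ger0_norm // subr_ge0 nthle.
rewrite -mulr_sumr telescope_sumr // (itv_partition_nth_size _ sP) /=.
by rewrite subr0 mulr1.
Qed.

(* Real induction: the supremum of the endpoints of fine chains starting at [0]
   is [1], and it is attained. *)
Lemma fine_partition C x y (g : R -> X) : path_in C x y g ->
  exists2 s, itv_partition 0 1 s &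
    forall i, (i < size s)%N -> mdist (g (nth 1 (0 :: s) i)) (g (nth 1 (0 :: s) i.+1)) <= 1.
Proof.
move=> [gc _ _ _].
pose fine := fun a b : R => (a < b) && (mdist (g a) (g b) <= 1).
pose S := [set t : R | 0 <= t <= 1 /\ exists2 s, path fine 0 s & last 0 s = t].
suff [_ [s sf s1]] : S 1.
  exists s; first by split; [apply: sub_path sf => a b /andP[]|rewrite s1].
  by move=> i iS; move: sf => /(pathP 1)/(_ i iS)/andP[].
have S0 : S 0 by split; [rewrite lexx ler01|exists [::]].
have Sb : has_sup S by split; [exists 0|exists 1 => t [/andP[]]].
set c := sup S; have c0 : 0 <= c by apply: ub_le_sup S0; case: Sb.
have c1 : c <= 1 by apply: ge_sup; [case: Sb|move=> t [/andP[]]].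
have step t t' : S t -> t < t' -> t' <= 1 -> mdist (g t) (g t') <= 1 -> S t'.
  move=> [/andP[t0 t1] [s sf st]] tt' t'1 gt; split; first by rewrite t'1 (le_trans t0) ?ltW.
  by exists (rcons s t'); rewrite ?last_rcons // rcons_path sf st /fine tt'.
have [d d0 dP] : exists2 d, 0 < d & forall z, 0 <= z <= 1 -> `|c - z| < d -> mdist (g c) (g z) < 2^-1.
  have c01 : `[0, 1]%classic c by rewrite /= in_itv /= c0.
  have := (subspace_continuousP _ _).1 gc c c01.
  move=> /metricType_numDomainType.cvgrPdist_lt/(_ 2^-1).
  rewrite invr_gt0 ltr0n => /(_ isT); rewrite near_withinE => /nbhs_ballP[d /= d0 dP].
  by exists d => // z z01 cz; apply: dP; rewrite /= ?in_itv.
have [t St ct] := sup_adherent d0 Sb; rewrite -/c in ct.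
have tc : t <= c by apply: ub_le_sup St; case: Sb.
have [/andP[t0 t1] _] := St.
have gt : mdist (g c) (g t) < 2^-1 by apply: dP; rewrite ?t0 // ger0_norm; lra.
have Sc : S c.
  have [->//|tc'] := eqVneq c t; apply: (step t) => //; first by rewrite lt_neqAle eq_sym tc'.
  by rewrite metric_sym; lra.
have [<-//|cn] := eqVneq c 1; have c1' : c < 1 by rewrite lt_neqAle cn.
pose t' := Num.min (c + d / 2) 1.
have ct' : c < t' by rewrite /t' lt_min c1' andbT ltrDl divr_gt0.
have t'1 : t' <= 1 by rewrite /t' ge_min lexx orbT.
have t'd : t' <= c + d / 2 by rewrite /t' ge_min lexx.
have St' : S t'.
  apply: (step c) => //; apply: ltW; apply: lt_le_trans (dP t' _ _) _; first by lra.
    by rewrite ltr0_norm; lra.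
  by lra.
have : t' <= c by apply: ub_le_sup St'; case: Sb.
by rewrite leNgt ct'.
Qed.

Lemma path_length_partition (g : R -> X) s : itv_partition 0 1 s ->
  ((\sum_(0 <= i < size s) mdist (g (nth 1 (0 :: s) i)) (g (nth 1 (0 :: s) i.+1)))%:E
    <= path_length g)%E.
Proof. by move=> sP; apply: ereal_sup_ubound; exists s. Qed.

Lemma sum_mdist_sub (f : nat -> X) (N M : nat) (tau : nat -> nat) :
  (forall j, (j < M)%N -> (tau j <= tau j.+1)%N) -> (forall j, (j <= M)%N -> (tau j <= N)%N) ->
  \sum_(0 <= j < M) mdist (f (tau j)) (f (tau j.+1)) <= \sum_(0 <= i < N) mdist (f i) (f i.+1).
Proof.
move=> mono bd.
have tri a b : (a <= b)%N -> mdist (f a) (f b) <= \sum_(a <= i < b) mdist (f i) (f i.+1).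
  elim: b => [|b IH]; first by rewrite leqn0 => /eqP->; rewrite mdistxx big_geq.
  rewrite leq_eqVlt => /orP[/eqP->|]; first by rewrite mdistxx big_geq.
  rewrite ltnS => ab; rewrite big_nat_recr //=.
  by apply: le_trans (metric_triangle _ (f b) _) _; rewrite lerD2r IH.
have sub m : (m <= M)%N ->
    \sum_(0 <= j < m) mdist (f (tau j)) (f (tau j.+1)) <= \sum_(0 <= i < tau m) mdist (f i) (f i.+1).
  elim: m => [_|m IH mM]; first by rewrite big_geq //; apply: sumr_ge0 => i _; exact: mdist_ge0.
  rewrite big_nat_recr //= [leRHS](@big_cat_nat _ _ _ (tau m)) ?mono //=.
  by apply: lerD; [apply: IH; exact: ltnW|apply: tri; exact: mono].
apply: le_trans (sub M (leqnn _)) _.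
rewrite [leRHS](@big_cat_nat _ _ _ (tau M)) ?bd //=.
by rewrite lerDl; apply: sumr_ge0 => i _; exact: mdist_ge0.
Qed.

Lemma first_hit x a r K : A a -> nbhd_compl A r x -> 0 <= r -> lipschitz_path setT x a K ->
  exists2 z, nbhd_frontier A r z &
    exists2 K', K' <= K & lipschitz_path (nbhd_compl A r) x z K'.
Proof.
move=> Aa cx r0 [K0 [f [fx fy fl _]]].
pose E := [set t : R | 0 <= t <= K /\ exists2 b, A b & mdist (f t) b <= r].
have EK : E K by split; [rewrite K0 lexx|exists a; rewrite // fy mdistxx].
have Ei : has_inf E by split; [exists K|exists 0 => t [/andP[]]].
set t0 := inf E.
have t00 : 0 <= t0 by apply: lb_le_inf; [exists K|move=> t [/andP[]]].
have t0K : t0 <= K by apply: ge_inf => //; case: Ei.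
have before t : 0 <= t -> t <= t0 -> nbhd_compl A r (f t).
  move=> t_0 tt0; apply/nbhd_complP => b Ab; rewrite leNgt; apply/negP => ftb.
  have [t0'|t0'] := eqVneq t 0.
    by move/nbhd_complP: cx => /(_ b Ab); rewrite -fx -t0' leNgt ftb.
  (* Going back by [eps] keeps the path within [r] of [b], so [E] would have a member below its
     infimum. *)
  pose eps := Num.min t (r - mdist (f t) b).
  have e0 : 0 < eps by rewrite lt_min subr_gt0 ftb andbT lt_neqAle eq_sym t0'.
  have et : eps <= t by rewrite ge_min lexx.
  have er : eps <= r - mdist (f t) b by rewrite ge_min lexx orbT.
  have : E (t - eps).
    split; first by lra.
    exists b => //; apply: le_trans (metric_triangle _ (f t) _) _.
    apply: le_trans (lerD (fl (t - eps) t _ _) (lexx _)) _; try lra.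
    by rewrite ler0_norm; lra.
  have lbE : has_lbound E by case: Ei.
  by move=> /(ge_inf lbE); rewrite -/t0; lra.
exists (f t0); last first.
  exists t0 => //; split=> //; exists f; split=> //.
    by move=> s t sK tK; apply: fl; lra.
  by move=> s /andP[s0 st]; exact: before.
apply/nbhd_frontierP; split; first exact: before.
move=> eps eps0; have [t [tK [b Ab tb]] tt0] := inf_adherent (divr_gt0 eps0 (ltr0n _ 2)) Ei.
rewrite -/t0 in tt0.
have t0t : t0 <= t by apply: ge_inf => //; [case: Ei|split=> //; exists b].
exists b => //; apply: le_lt_trans (metric_triangle _ (f t) _) _.
apply: le_lt_trans (lerD (fl t0 t _ _) tb) _; try lra.
by rewrite ler0_norm; lra.
Qed.

End Metric.

(** * The Cayley graph *)

Section Realization.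
Context {R : realType} {X : cgraph}.
Local Open Scope classical_set_scope.
Local Open Scope ring_scope.
Local Notation "|X|" := (realization R X).
Local Notation rv := (@rvertex R X).

Lemma edge_path (a b : X) : adj a b -> lipschitz_path setT (rv a) (rv b) 1.
Proof.
move=> ab; have nab : a != b by exact: adj_neq.
have pt (t : R) : exists x : |X|, 0 <= t <= 1 ->
    forall v, x v = (1 - t) * (v == a)%:R + t * (v == b)%:R.
  have [t01|t01] := boolP (0 <= t <= 1); last by exists (rv a).
  have P : exists c d : X, (c = d \/ adj c d) /\
      on_edge c d (fun v => (1 - t) * (v == a)%:R + t * (v == b)%:R).
    by exists a, b; split; [right|exists t].
  by exists (RPoint P).
have {pt}[f fE] := choice pt.
have fon t : 0 <= t <= 1 -> on_edge a b (f t) by move=> t01; exists t => // v; exact: fE.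
have fa t : 0 <= t <= 1 -> f t a = 1 - t.
  by move=> t01; rewrite fE // eqxx (negbTE nab) mulr0 addr0 mulr1.
split=> //; exists f; split=> //.
- by apply: bary_inj => v; rewrite fE ?lexx ?ler01 // subr0 mul1r mul0r addr0.
- by apply: bary_inj => v; rewrite fE ?lexx ?ler01 // subrr mul1r mul0r add0r.
- move=> s t s01 t01; apply: le_trans (rdist_le (string1 ab (fon s s01) (fon t t01))) _.
  by rewrite !fa // (_ : 1 - s - (1 - t) = t - s); [rewrite distrC|ring].
Qed.

Lemma vertex_near (x : |X|) : exists a, mdist x (rv a) <= 1.
Proof.
have [a [b [[<-|ab] xab]]] := baryP x; exists a.
  suff -> : x = rv a by rewrite mdistxx.
  apply: bary_inj => v; have [t _ ->] := xab.
  by rewrite -mulrDl subrK mul1r.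
apply: le_trans (rdist_le (string1 ab xab (on_edgel a b))) _.
have [t /andP[t0 t1] xE] := xab; rewrite xE /= eqxx (negbTE (adj_neq ab)).
by rewrite mulr0 addr0 mulr1 addrAC subrr add0r normrN ger0_norm.
Qed.

(* The affine extension of [F] to the edges changes by at most [L * l] along a
   string of length [l]. *)
Lemma lipschitz_vertex (F : X -> R) (L : R) : 0 < L ->
  (forall a b, adj a b -> `|F a - F b| <= L) ->
  forall a b, `|F a - F b| <= L * mdist (rv a) (rv b).
Proof.
move=> L0 FL a b; pose Fh (x : |X|) := \sum_(v \in [set: X]) (x v * F v).
have Frv c : Fh (rv c) = F c.
  rewrite /Fh (fsbigE [:: c]) //= => [|v _].
    by rewrite big_cons big_nil in_setT eqxx mul1r addr0.
  by rewrite inE => /negbTE ->; rewrite mul0r.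
have Fon c d (x : |X|) : c != d -> on_edge c d x -> Fh x = x c * F c + (1 - x c) * F d.
  move=> cd [t _ xE]; rewrite /Fh (fsbigE [:: c; d]) //= => [||v _].
  - rewrite !big_cons big_nil !in_setT addr0 !xE !eqxx (negbTE cd) eq_sym (negbTE cd).
    by rewrite !mulr0 !mulr1 addr0 add0r subKr.
  - by rewrite inE cd.
  - rewrite !inE negb_or => /andP[/negbTE vc /negbTE vd].
    by rewrite xE vc vd !mulr0 addr0 mul0r.
have Fs x y l : string x y l -> `|Fh x - Fh y| <= L * l.
  elim=> {x y l} [x|c d x y z l cd xcd ycd _ IH]; first by rewrite subrr normr0 mulr0.
  have ncd := adj_neq cd.
  apply: le_trans (ler_distD (Fh y) _ _) _; rewrite mulrDr lerD //.
  rewrite !(Fon c d) // (_ : _ - _ = (x c - y c) * (F c - F d)); last by ring.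
  by rewrite normrM mulrC ler_wpM2r // FL.
rewrite -!Frv mulrC -ler_pdivrMr //; apply: lb_le_inf; first exact: string_ex.
by move=> l /Fs; rewrite ler_pdivrMr // mulrC.
Qed.

End Realization.

Section Cayley.
Context {R : realType} (T : finType) (X : sgraph T).
Local Notation e := (edge X).
Local Notation G := (racg e).
Local Notation word := (@racg_word T e).
Local Notation gen := (@racg_gen T e).
Context (S : seq G) (S_gen : subgroup_gen [set` S]%classic = setT).
Local Notation Cay := (cayley_graph S_gen).
Local Notation rv := (@rvertex R Cay).
Local Open Scope ring_scope.

Lemma dist_le_mdist : exists2 L : nat, (0 < L)%N &
  forall a b : G, (dist a b)%:R <= L%:R * mdist (rv a) (rv b) :> R.
Proof.
exists (\max_(s <- S) dist 1 s).+1 => // a b; set L := _.+1.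
have adjL c d : @adj Cay c d -> (dist c d <= L)%N.
  have H c' d' : (c'^-1 * d')%g \in S -> (dist c' d' <= L)%N.
    move=> cdS; rewrite -(dist_mul c'^-1) mulVg /L; apply: leqW.
    exact: (@leq_bigmax_seq _ S xpredT (fun s => dist 1 s)).
  by move=> /andP[_ /orP[/H//|/H]]; rewrite dist_sym.
have := @lipschitz_vertex R Cay (fun c => (dist a c)%:R) L%:R (ltr0Sn _ _) _ a b.
rewrite distxx sub0r normrN ger0_norm ?ler0n //; apply=> c d cd.
have t1 := dist_triangle c a d; have t2 := dist_triangle d a c.
rewrite (dist_sym d c) in t2; have := adjL c d cd => cL.
have n1 : ((dist a c)%:R <= (dist a d)%:R + L%:R :> R) by rewrite -natrD ler_nat; lia.
have n2 : ((dist a d)%:R <= (dist a c)%:R + L%:R :> R) by rewrite -natrD ler_nat; lia.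
by rewrite ler_norml; lra.
Qed.

Lemma generator_path : exists2 L : nat, (0 < L)%N &
  forall (a : G) s, exists2 K : R, K <= L%:R &
    lipschitz_path setT (rv a) (rv (a * gen s)%g) K.
Proof.
have step (a b : G) : b \in S ++ [seq s^-1%g | s <- S] -> exists2 K : R, K <= 1 &
    lipschitz_path setT (rv a) (rv (a * b)%g) K.
  move=> bS; have [->|b1] := eqVneq b 1%g.
    by rewrite mulg1; exists 0 => //; exact: lipschitz_path_refl.
  exists 1 => //; apply: edge_path; rewrite /= /cayley_adj; apply/andP; split.
    by apply: contra_neq b1 => /esym; rewrite -[RHS]mulg1 => /mulgI.
  rewrite mulKg invgM mulgVK; move: bS; rewrite mem_cat => /orP[->//|/mapP[s sS ->]].
  by rewrite invgK sS orbT.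
have prod (l : seq G) a : all (mem (S ++ [seq s^-1%g | s <- S])) l ->
    exists2 K : R, K <= (size l)%:R & lipschitz_path setT (rv a) (rv (a * \prod_(b <- l) b)%g) K.
  elim: l a => [a _|b l IH a /= /andP[bS lS]].
    by rewrite big_nil mulg1; exists 0 => //; exact: lipschitz_path_refl.
  have [K K1 Kp] := step a b bS; have [K' K'1 K'p] := IH (a * b)%g lS.
  rewrite big_cons mulgA; exists (K + K'); last exact: lipschitz_path_trans Kp K'p.
  by rewrite -[(size l).+1]add1n natrD lerD.
have /choice[f fP] : forall s, exists l : seq G,
    all (mem (S ++ [seq s^-1%g | s <- S])) l /\ (\prod_(b <- l) b)%g = gen s.
  move=> s; have : subgroup_gen [set` S]%classic (gen s) by rewrite S_gen.
  by move=> /subgroup_gen_prod[l lS lE]; exists l.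
exists (\max_s size (f s)).+1 => // a s; have [fS fE] := fP s.
have [K K1 Kp] := prod (f s) a fS; rewrite fE in Kp; exists K => //.
by apply: le_trans K1 _; rewrite ler_nat; apply: leqW; exact: leq_bigmax.
Qed.

(** A region [C] need only contain the balls of radius [L] about the vertices along the word, so
    avoiding [H] in the word metric carries over to the Cayley graph. *)
Lemma cayley_comparison : exists2 L : nat, (0 < L)%N &
  (forall a b : G, (dist a b)%:R <= L%:R * mdist (rv a) (rv b) :> R) /\
  (forall (a : G) u, exists2 K : R, K <= L%:R * (size u)%:R &
    forall C, (forall i z, (i <= size u)%N ->
        mdist (rv (a * word (take i u))%g) z <= L%:R -> C z) ->
      lipschitz_path C (rv a) (rv (a * word u)%g) K).
Proof.
have [L1 L10 L1P] := dist_le_mdist; have [L2 L20 L2P] := generator_path.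
exists (maxn L1 L2); first by rewrite leq_max L10.
have m1 : (L1%:R <= (maxn L1 L2)%:R :> R) by rewrite ler_nat leq_maxl.
have m2 : (L2%:R <= (maxn L1 L2)%:R :> R) by rewrite ler_nat leq_maxr.
split=> [a b|a u].
  by apply: le_trans (L1P a b) _; rewrite ler_wpM2r // mdist_ge0.
elim: u a => [|s u IH] a.
  exists 0; first by rewrite mulr0.
  move=> C Cz; rewrite mulg1; apply: lipschitz_path_refl; apply: (Cz 0%N) => //.
  by rewrite mulg1 mdistxx ler0n.
have [K KL Kp] := L2P a s; have [K' K'L K'p] := IH (a * gen s)%g.
exists (K + K') => [|C Cz].
  by rewrite /= -add1n natrD mulrDr mulr1 lerD // (le_trans KL).
rewrite word_cons mulgA; apply: (@lipschitz_path_trans _ _ _ _ (rv (a * gen s)%g)).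
  apply: lipschitz_path_sub Kp => z az _; apply: (Cz 0%N) => //=.
  by rewrite mulg1 (le_trans az) // (le_trans KL).
apply: K'p => i z iu iz; apply: (Cz i.+1) => //=.
by rewrite word_cons mulgA.
Qed.

End Cayley.

Section Subgroup.
Context (T : finType) (X : sgraph T).
Local Notation e := (edge X).
Local Notation G := (racg e).
Local Open Scope group_scope.
Context (neighbour : forall s, exists t, e s t).
Context (H : set G) (H_subgroup : is_subgroup H) (H_fin_gen : fin_gen H)
  (H_join_free : join_free H).

(** As [H] is infinite, it leaves every ball, and a path of bounded steps inside [H] cannot jump
    over the length [Z]. The upper estimate keeps the number of flats in the upper bound linear in
    [r]. *)
Lemma subgroup_element_of_length : exists C : nat, forall Z : nat,
  exists2 h, H h & (Z <= dist 1 h <= Z + C)%N.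
Proof.
have [C [W path]] := quasi_path neighbour H_subgroup H_fin_gen H_join_free.
exists C => Z; have [h Hh hZ] : exists2 h, H h & (Z <= dist 1 h)%N.
  apply: contrapT => none; apply: (H_join_free.1).
  apply: (@sub_finite_set _ _ [set` cayley_ball X Z]%classic); last exact: finite_seq.
  move=> h Hh /=; apply: mem_cayley_ball; rewrite leqNgt; apply/negP => hZ.
  by apply: none; exists h; rewrite // ltnW.
have [eta [n [e0 en He eC _]]] := path h Hh.
have ex : exists i, (Z <= dist 1 (eta i))%N by exists n; rewrite en.
have [i iZ imin] := ex_minnP ex; exists (eta i); rewrite // iZ /=.
case: i iZ imin => [|i] iZ imin; first by rewrite e0 distxx.
have iZ' : (dist 1 (eta i) < Z)%N by rewrite ltnNge; apply/negP => /imin; rewrite ltnn.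
apply: leq_trans (dist_triangle (eta i) _ _) _; apply: leq_add (eC i); exact: ltnW.
Qed.

End Subgroup.

(** * Divergence *)

Section Divergence.
Context {R : realType} (T : finType) (X : sgraph T).
Local Notation e := (edge X).
Local Notation G := (racg e).
Local Notation word := (@racg_word T e).
Context (H : set G) (H_subgroup : is_subgroup H) (H_fin_gen : fin_gen H)
  (H_join_free : join_free H) (e_CFS : CFS e).
Context (S : seq G) (S_gen : subgroup_gen [set` S]%classic = setT).
Local Notation Cay := (cayley_graph S_gen).
Local Notation rv := (@rvertex R Cay).
Local Notation sigma := (@subgroup_divergence R G S S_gen H).
Local Notation A := (rv @` H)%classic.
Local Open Scope ring_scope.

Lemma CFS_neighbour s : exists t, e s t.
Proof.
have [Q0 Q0c cov] := e_CFS.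
have : s \in finset.cover (four_cycle_component e Q0) by rewrite cov inE.
move=> /finset.bigcupP[Q]; rewrite inE => /(component_induced Q0c)/four_cycleP.
move=> [a [b [c [d [_ _ ab sc _]]]]] /sc[sa|sb].
  by exists b; apply: ab; rewrite // inE eqxx.
by exists a; rewrite edge_sym; apply: ab; rewrite // inE eqxx.
Qed.

Lemma nat_ceil (x : R) : 0 <= x -> exists n : nat, x <= n%:R <= x + 1.
Proof.
move=> x0; have /andP[n1 n2] := truncn_itv x0.
exists (Num.truncn x).+1; rewrite ltW //= -[X in X%:R]addn1 natrD; lra.
Qed.

Lemma nat_floor (x : R) : 0 <= x -> exists n : nat, x - 1 <= n%:R <= x.
Proof.
move=> x0; have /andP[n1 n2] := truncn_itv x0.
by exists (Num.truncn x); rewrite n1 andbT; move: n2; rewrite -addn1 natrD; lra.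
Qed.

Section Arithmetic.
Context (L W C : nat).

(** The loss from [rho * r / L] at each wall of the chain: 2 for rounding [Rn], [C + 9 * L] from
    [far_path_length] with steps [3 * L], [2 * L] for moving the path to vertices, and [W] for the
    share of [dist 1 h]. *)
Definition lower_slope_loss : R := 2 + C%:R + 11 * L%:R + W%:R.
Definition lower_count_loss : R := W%:R + 4 * L%:R + 4.
Definition lower_linear (rho : R) : R :=
  L%:R / rho * (2 * L%:R * W%:R + lower_slope_loss + lower_count_loss
                + W%:R * (W%:R + 4 * L%:R + 2)).

(** The quadratic term is the product of [mw], for the number of walls, and [mP], for the cost of
    each. The bound on [D] lets the distance of the end points outweigh the [2 * d] walls, of order
    [L * r], lost near them. *)
Lemma lower_arith (rho r m l Rn nh d D : R) : (0 < L)%N -> (0 < W)%N ->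
  0 < rho <= 1 -> 1 + L%:R * lower_slope_loss / rho < r -> 0 <= m ->
  nh <= (m + 1) * W%:R + 2 * d -> d <= L%:R * (r + 2) + 1 ->
  m * Rn <= L%:R * (l + 2 * m) + m * (C%:R + 9 * L%:R) + nh ->
  (D - 2) * r - 2 <= L%:R * nh -> 2 * L%:R + 2 * L%:R ^+ 2 + 2 <= D ->
  (rho * r - 1) / L%:R - 1 <= Rn ->
  (r ^+ 2 - lower_linear rho * r) / (W%:R * L%:R ^+ 2 / rho) <= l.
Proof.
move=> L0 W0 /andP[rho0 rho1] rD m0 a1 a2 b c1 c2 d1.
have L1 : 1 <= L%:R :> R by rewrite ler1n.
have W1 : 1 <= W%:R :> R by rewrite ler1n.
have C0 : 0 <= C%:R :> R by rewrite ler0n.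
rewrite /lower_linear /lower_slope_loss /lower_count_loss in rD *.
set x := L%:R in L1 a2 b c1 c2 d1 rD *; set w := W%:R in W1 a1 rD *.
set c := C%:R in C0 b rD *.
pose s2 := 2 + c + 11 * x + w; pose s1 := w + 4 * x + 4.
have x0 : 0 < x by lra.
have w0 : 0 < w by lra.
have s20 : 0 <= s2 by rewrite /s2; lra.
have r1 : 1 <= r.
  apply: ltW; apply: le_lt_trans rD; rewrite lerDl divr_ge0 //; last exact: ltW.
  by rewrite mulr_ge0 //; lra.
have P0 : 0 <= rho * r / x - s2.
  rewrite subr_ge0 ler_pdivlMr //; have : x * s2 / rho <= r by rewrite /s2; lra.
  by rewrite ler_pdivrMr // => h; lra.
have Rn1 : rho * r / x - s2 <= Rn - (c + 11 * x + w).
  have : 1 / x <= 1 by rewrite ler_pdivrMr // mul1r.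
  move: d1; rewrite mulrBl /s2; lra.
have mP : m * (rho * r / x - s2) <= x * l + w + 2 * x * r + 4 * x + 2.
  apply: le_trans (ler_wpM2l m0 Rn1) _; lra.
have mw : r - s1 <= w * m.
  have : x * (r - s1) <= x * (w * m); last by rewrite ler_pM2l.
  have q1 : x * nh <= x * ((m + 1) * w + 2 * (x * (r + 2) + 1)) by rewrite ler_pM2l //; lra.
  have q2 : (2 * x + 2 * x ^+ 2) * r <= (D - 2) * r by rewrite ler_wpM2r //; lra.
  have q3 : 0 <= x * r by rewrite mulr_ge0 //; lra.
  have q4 : x * 2 <= x * x * 2 by rewrite -mulrA ler_pM2l //; lra.
  rewrite /s1; move: q1 q2 q3 q4 c1; rewrite expr2; nra.
have key : (r - s1) * (rho * r / x - s2) <= w * (x * l + w + 2 * x * r + 4 * x + 2).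
  apply: le_trans (ler_wpM2r P0 mw) _; rewrite -(mulrA w m).
  by apply: ler_wpM2l mP; exact: ltW.
rewrite ler_pdivrMr ?divr_gt0 ?mulr_gt0 ?exprn_gt0 //.
have E : x / rho * ((r - s1) * (rho * r / x - s2)) <= x / rho * (w * (x * l + w + 2 * x * r + 4 * x + 2)).
  by rewrite ler_pM2l ?divr_gt0.
have F : x / rho * ((r - s1) * (rho * r / x - s2)) =
    r ^+ 2 - x / rho * s2 * r - s1 * r + x / rho * s1 * s2.
  by field; rewrite !gt_eqF.
have xr : 1 <= x / rho by rewrite ler_pdivlMr // mul1r; lra.
have s10 : 0 <= s1 by rewrite /s1; lra.
have t1 : 0 <= x / rho * s1 * s2 by apply: mulr_ge0 => //; apply: mulr_ge0 => //; lra.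
have t2 : s1 * r <= x / rho * s1 * r.
  by rewrite -mulrA; apply: ler_peMl => //; apply: mulr_ge0; lra.
have t3 : x / rho * (w * (w + 4 * x + 2)) <= x / rho * (w * (w + 4 * x + 2)) * r.
  by apply: ler_peMr => //; apply: mulr_ge0; [lra|apply: mulr_ge0; lra].
rewrite -/s1 -/s2; move: E; rewrite F => E.
have E2 : l * (w * x ^+ 2 / rho) = x / rho * (w * (x * l)) by field; rewrite gt_eqF.
rewrite E2; move: E t1 t2 t3.
have -> : x / rho * (w * (x * l + w + 2 * x * r + 4 * x + 2)) =
  x / rho * (w * (x * l)) + x / rho * (w * (w + 4 * x + 2)) + x / rho * (2 * x * w) * r by ring.
have -> : x / rho * (2 * x * w + s2 + s1 + w * (w + 4 * x + 2)) * r =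
  x / rho * (2 * x * w) * r + x / rho * s2 * r + x / rho * s1 * r +
  x / rho * (w * (w + 4 * x + 2)) * r by ring.
lra.
Qed.

End Arithmetic.
Lemma slope_bound L n : (2 <= n)%N -> (2 * L + 2 * L ^ 2 + 2 <= (L + L ^ 2 + 1) * n)%N.
Proof.
move=> n2; apply: (@leq_trans ((L + L ^ 2 + 1) * 2)); last by rewrite leq_mul2l n2 orbT.
by move: (L ^ 2)%N => a; lia.
Qed.

Lemma divergence_lower : exists M : nat, (0 < M)%N /\
  forall rho n, 0 < rho <= 1 -> (2 <= n)%N -> fun_preceq (fun x => (x ^+ 2)%:E) (sigma rho (M * n)%N).
Proof.
have [L L0 [dle path]] := @cayley_comparison R T X S S_gen.
have mle a b : mdist (rv a) (rv b) <= L%:R * (dist a b)%:R.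
  have [K KL Kp] := path a (rword (a^-1 * b)%g); rewrite rwordK mulVKg in Kp.
  rewrite dist_size; apply: le_trans KL.
  by apply: (lipschitz_path_dist (C := setT)); exact: Kp.
have [W [C [W0 LB]]] := far_path_length CFS_neighbour H_subgroup H_fin_gen H_join_free.
(* As [n] is at least 2, [M * n] reaches the bound that [lower_arith] requires of [D]. *)
pose M := (L + L ^ 2 + 1)%N; exists M; split=> [|rho n rho01 n2]; first by rewrite /M addn1.
have /andP[rho0 rho1] := rho01.
have L1 : 1 <= L%:R :> R by rewrite ler1n.
have Lp : 0 < L%:R :> R by rewrite ltr0n.
set kappa : R := W%:R * L%:R ^+ 2 / rho.
have kappa0 : 0 < kappa by rewrite /kappa divr_gt0 // mulr_gt0 ?exprn_gt0 // ltr0n.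
set c := lower_linear L W C rho.
have s20 : 0 <= lower_slope_loss L W C :> R.
  by rewrite /lower_slope_loss -!natrM -!natrD ler0n.
have c0 : 0 < c.
  rewrite /c /lower_linear /lower_count_loss; apply: mulr_gt0; first by rewrite divr_gt0.
  have w0 : 0 <= W%:R :> R by rewrite ler0n.
  have : 0 <= 2 * L%:R * W%:R :> R by rewrite -!natrM ler0n.
  have : 0 <= W%:R * (W%:R + 4 * L%:R + 2) :> R by rewrite -!natrM -!natrD -natrM ler0n.
  lra.
have D0 : 0 < 1 + L%:R * lower_slope_loss L W C / rho :> R.
  by rewrite ltr_wpDr // divr_ge0 ?mulr_ge0 // ltW.
exists kappa, 1, c, (1 + L%:R * lower_slope_loss L W C / rho); split=> // r rD.
have r1 : 1 <= r.
  by apply: ltW; apply: le_lt_trans rD; rewrite lerDl divr_ge0 ?mulr_ge0 // ltW.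
rewrite mul1r.
suff low : (((r ^+ 2 - c * r) / kappa)%:E <= sigma rho (M * n)%N r)%E.
  apply: le_trans (_ : kappa%:E * ((r ^+ 2 - c * r) / kappa)%:E + (c * r)%:E <= _)%E.
    by rewrite -EFinM -EFinD lee_fin mulrC divfK ?gt_eqF // subrK.
  by rewrite leeD2r // lee_wpmul2l // lee_fin ltW.
apply: le_ereal_inf_tmp => _ [[x1 x2] /= [fx1 fx2 _ x12] <-].
apply: le_ereal_inf_tmp => _ [g gP <-].
have [s sP sfine] := fine_partition gP; set N := size s in sfine.
apply: le_trans (path_length_partition g sP); rewrite lee_fin.
pose q i := g (nth 1 (0 :: s) i).
have [gc g0 g1 gC] := gP.
have q0 : q 0%N = x1 by rewrite /q /= g0.
have qN : q N = x2 by rewrite /q (itv_partition_nth_size _ sP) g1.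
set l := (X in _ <= X).
have /choice[v vP] : forall i, exists a, mdist (q i) (rv a) <= 1 by move=> i; exact: vertex_near.
have far i k : (i <= N)%N -> H k -> rho * r - 1 <= mdist (rv k) (rv (v i)).
  move=> iN Hk; have : nbhd_compl A (rho * r) (q i).
    apply: gC; exists (nth 1 (0 :: s) i) => //=; rewrite in_itv /=.
    by rewrite (itv_partition_nth_ge _ sP) // (itv_partition_nth_le _ sP).
  move=> /nbhd_complP/(_ (rv k)); have vi := vP i.
  have := metric_triangle (q i) (rv (v i)) (rv k); rewrite (metric_sym (rv (v i))) => t Ak.
  have : rho * r <= mdist (q i) (rv k) by apply: Ak; exists k.
  lra.
have [_ /(_ 1 ltr01)[_ [h1 Hh1 <-] xh1]] := (nbhd_frontierP _ _ _).1 fx1.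
have [_ /(_ 1 ltr01)[_ [h2 Hh2 <-] xh2]] := (nbhd_frontierP _ _ _).1 fx2.
have [Rn /andP[Rn1 Rn2]] : exists n : nat, (rho * r - 1) / L%:R - 1 <= n%:R <= (rho * r - 1) / L%:R.
  apply: nat_floor; apply: divr_ge0; last exact: ltW.
  have : L%:R * lower_slope_loss L W C / rho < r by lra.
  rewrite ltr_pdivrMr // => h.
  have : 1 <= L%:R * lower_slope_loss L W C :> R; last by lra.
  apply: le_trans L1 _; rewrite ler_peMr ?ler0n // /lower_slope_loss.
  have : 0 <= C%:R :> R by rewrite ler0n.
  have : 0 <= W%:R :> R by rewrite ler0n.
  lra.
have [d /andP[d1 d2]] : exists n : nat, L%:R * (r + 2) <= n%:R <= L%:R * (r + 2) + 1.
  by apply: nat_ceil; apply: mulr_ge0; lra.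
have dh x h i : mdist x (rv h) < r + 1 -> q i = x -> (dist h (v i) <= d)%N.
  move=> xh qx; rewrite -(ler_nat R); apply: le_trans (dle h (v i)) _.
  apply: le_trans d1; rewrite ler_pM2l //; have := vP i; rewrite qx => xv.
  have := metric_triangle (rv h) x (rv (v i)); rewrite (metric_sym (rv h) x); lra.
have step i : (i < N)%N -> (dist (v i) (v i.+1) <= 3 * L)%N.
  move=> iN; rewrite -(ler_nat R) natrM; apply: le_trans (dle _ _) _.
  rewrite mulrC ler_pM2r //; have := sfine i iN; rewrite -/(q i) -/(q i.+1) => qi.
  have t1 := metric_triangle (rv (v i)) (q i) (rv (v i.+1)).
  have t2 := metric_triangle (q i) (q i.+1) (rv (v i.+1)).
  by have := vP i; have := vP i.+1; rewrite (metric_sym (q i) (rv (v i))); lra.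
have Hh : H (h1^-1 * h2)%g by apply: is_subgroupM => //; exact: is_subgroupV.
(* Translation by [h1^-1] makes the path start near [1]. Consecutive [q i], and each [q i] and
   [v i], are within 1, so the vertices move by at most 3 in the Cayley graph and [3 * L] in the
   word metric. *)
have [] := LB (h1^-1 * h2)%g N (fun i => (h1^-1 * v i)%g) (3 * L)%N Rn d Hh.
- by move=> i iN; rewrite dist_mul step.
- move=> i k iN Hk; rewrite -(dist_mul h1) mulVKg -(ler_nat R); apply: le_trans Rn2 _.
  rewrite ler_pdivrMr // (mulrC _ L%:R); apply: le_trans (mle _ _).
  by apply: far => //; exact: is_subgroupM.
- by rewrite -(dist_mul h1) mulg1 mulVKg; exact: dh xh1 q0.
- by rewrite dist_mul; exact: dh xh2 qN.
move=> m [tau [tau1 tau2 nh sum]].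
have dE : dist 1 (h1^-1 * h2) = dist h1 h2 by rewrite -(dist_mul h1) mulg1 mulVKg.
rewrite dE in nh sum.
have D2 : 2 * L%:R + 2 * L%:R ^+ 2 + 2 <= (M * n)%:R :> R.
  by rewrite -natrX -!natrM -!natrD ler_nat; exact: slope_bound.
apply: (@lower_arith L W C rho r m%:R l Rn%:R (dist h1 h2)%:R d%:R (M * n)%:R) => //.
- by move: nh; rewrite -(ler_nat R) natrD natrM -addn1 natrD -mul2n natrM.
- apply: le_trans (_ : (m * Rn)%:R <= _); first by rewrite natrM.
  apply: le_trans (_ : _ <= (_)%:R) _; first by rewrite ler_nat; exact: sum.
  rewrite !natrD natrM lerD2r; apply: lerD; last first.
    by rewrite natrD natrM natrM mulrA -[3%:R * 3%:R]natrM.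
  have sumE : \sum_(0 <= j < m) mdist (q (tau j)) (q (tau j.+1)) <= l.
    exact: (sum_mdist_sub q tau1 tau2).
  apply: le_trans (_ : \sum_(0 <= j < m) (L%:R * (mdist (q (tau j)) (q (tau j.+1)) + 2)) <= _).
    rewrite natr_sum; apply: ler_sum => j _; rewrite dist_mul; apply: le_trans (dle _ _) _.
    rewrite ler_pM2l //; have := vP (tau j); have := vP (tau j.+1).
    have t1 := metric_triangle (rv (v (tau j))) (q (tau j)) (rv (v (tau j.+1))).
    have t2 := metric_triangle (q (tau j)) (q (tau j.+1)) (rv (v (tau j.+1))).
    by move: t1; rewrite (metric_sym (rv (v (tau j))) (q (tau j))); lra.
  rewrite -mulr_sumr ler_pM2l // big_split /= lerD // sumr_const_nat subn0.
  by rewrite mulr_natr.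
- apply: le_trans (mle h1 h2).
  have t1 := metric_triangle x1 (rv h1) x2; have t2 := metric_triangle (rv h1) (rv h2) x2.
  rewrite (metric_sym (rv h2)) in t2; lra.
Qed.

Lemma upper_arith (L U E : nat) (r n N1 Z d K c2 c3 : R) : 1 < r -> 0 <= n ->
  N1 <= L%:R * (r + L%:R) + 2 -> 0 <= N1 -> K = L%:R * (U%:R * N1) ->
  Z <= L%:R * (n * r + 4 * K) + 1 -> d <= Z + E%:R -> 0 <= d ->
  c2 = L%:R * U%:R * (L%:R + L%:R ^+ 2 + 2) ->
  c3 = L%:R * (n + 4 * c2) + E%:R + 2 ->
  K + (K * (d + 1) + K) <= (c2 * c3 + 1) * r ^+ 2 + (2 * c2 + 1) * r.
Proof.
move=> r1 n0 N1r N10 KE Zr dZ d0 c2E c3E.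
have x0 : 0 <= L%:R :> R by rewrite ler0n.
have u0 : 0 <= U%:R :> R by rewrite ler0n.
have e0 : 0 <= E%:R :> R by rewrite ler0n.
have c20 : 0 <= c2.
  by rewrite c2E -natrX -natrM -!natrD -natrM ler0n.
have N1r' : N1 <= (L%:R + L%:R ^+ 2 + 2) * r.
  apply: le_trans N1r _; rewrite expr2.
  have : L%:R * L%:R <= L%:R * L%:R * r by rewrite ler_peMr ?mulr_ge0 // ltW.
  by rewrite mulrDr !mulrDl => h; lra.
have K0 : 0 <= K by rewrite KE !mulr_ge0.
have Kr : K <= c2 * r.
  rewrite KE c2E mulrA -(mulrA (L%:R * U%:R)); apply: ler_wpM2l N1r'.
  exact: mulr_ge0.
have dr : d + 1 <= c3 * r.
  have h1 : L%:R * (n * r + 4 * K) <= L%:R * (n * r + 4 * (c2 * r)).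
    by apply: ler_wpM2l => //; lra.
  have h2 : E%:R + 2 <= (E%:R + 2) * r by rewrite ler_peMr ?ltW //; lra.
  have -> : c3 * r = L%:R * (n * r + 4 * (c2 * r)) + (E%:R + 2) * r by rewrite c3E; ring.
  lra.
have d1 : 0 <= d + 1 by lra.
have Kd : K * (d + 1) <= (c2 * r) * (c3 * r) by apply: ler_pM.
have -> : (c2 * c3 + 1) * r ^+ 2 + (2 * c2 + 1) * r =
  (c2 * r) * (c3 * r) + r ^+ 2 + 2 * (c2 * r) + r by ring.
have : 0 <= r ^+ 2 by exact: sqr_ge0.
lra.
Qed.

Lemma divergence_upper rho n : 0 < rho <= 1 -> (2 <= n)%N ->
  fun_preceq (sigma rho n) (fun x => (x ^+ 2)%:E).
Proof.
move=> /andP[rho0 rho1] n2.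
have [L L0 [dle path]] := @cayley_comparison R T X S S_gen.
have [U UB] := far_path_exists CFS_neighbour H_subgroup H_fin_gen H_join_free e_CFS.
have [E el] := subgroup_element_of_length CFS_neighbour H_subgroup H_fin_gen H_join_free.
have Lp : 0 < L%:R :> R by rewrite ltr0n.
pose c2 : R := L%:R * U%:R * (L%:R + L%:R ^+ 2 + 2).
pose c3 : R := L%:R * (n%:R + 4 * c2) + E%:R + 2.
have c20 : 0 <= c2 by rewrite /c2 -natrX -natrM -!natrD -natrM ler0n.
have c30 : 0 <= c3.
  rewrite /c3; apply: addr_ge0 => //; apply: addr_ge0; last by rewrite ler0n.
  by apply: mulr_ge0; [exact: ltW|apply: addr_ge0; [rewrite ler0n|rewrite mulr_ge0]].
exists (c2 * c3 + 1), 1, (2 * c2 + 1), 1; split.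
  by split; rewrite // ltr_wpDl // mulr_ge0.
move=> r r1; rewrite mul1r -EFinM -EFinD.
(* Word distance [N] from [H] gives distance [r + L] in the Cayley graph; the surplus [L] is spent
   on the points between the vertices of the path. *)
have [N /andP[N1 N2]] : exists N : nat, L%:R * (r + L%:R) <= N%:R <= L%:R * (r + L%:R) + 1.
  by apply: nat_ceil; apply: mulr_ge0; lra.
pose K : R := L%:R * (U%:R * N.+1%:R).
have K0 : 0 <= K by rewrite /K !mulr_ge0 ?ler0n.
(* The four [K] pay for the ways from [1] to [g], from [g] to [z1], from [z2] to [h * g] and from
   there to [h], so that [n * r] is left between [z1] and [z2]. *)
have [Z /andP[Z1 Z2]] : exists Z : nat,
    L%:R * (n%:R * r + 4 * K) <= Z%:R <= L%:R * (n%:R * r + 4 * K) + 1.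
  apply: nat_ceil; apply: mulr_ge0; first exact: ltW.
  by apply: addr_ge0; apply: mulr_ge0; rewrite ?ler0n //; lra.
have [h Hh /andP[Zh hZ]] := el Z.
have [g [gU [u [gu uU ufar]]]] := UB N h Hh.
have rvA k : H k -> A (rv k) by move=> Hk; exists k.
have vfar z : far H N z -> forall y, mdist (rv z) y <= L%:R -> nbhd_compl A r y.
  move=> zfar y zy; apply/nbhd_complP => _ [k Hk <-].
  have : N%:R <= L%:R * mdist (rv k) (rv z).
    by apply: le_trans (dle k z); rewrite ler_nat; exact: zfar.
  move=> Nk; have : r + L%:R <= mdist (rv k) (rv z).
    by rewrite -(ler_pM2l Lp); apply: le_trans N1 Nk.
  have := metric_triangle (rv k) y (rv z).
  by rewrite (metric_sym (rv k) y) (metric_sym y (rv z)); lra.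
have [Kj KjL pj] := path g u; have {}pj : lipschitz_path (nbhd_compl A r) (rv g) (rv (h * g)%g) Kj.
  by rewrite -gu; apply: pj => i z _; apply: vfar; exact: ufar.
have far_g : far H N g by have := ufar 0%N; rewrite take0 mulg1.
have far_hg : far H N (h * g)%g by rewrite -gu -(take_size u); exact: ufar.
have back k : exists2 K', K' <= K & lipschitz_path setT (rv (k * g)%g) (rv k) K'.
  have [K' K'L p'] := path (k * g)%g (rword (g^-1)%g); rewrite rwordK mulgK in p'.
  exists K'; last exact: p'.
  apply: le_trans K'L _; rewrite /K ler_wpM2l ?ler0n // -natrM ler_nat.
  by apply: leq_trans gU; rewrite -(dist1V g) dist_size invg1 mul1g.
have hit k : H k -> far H N (k * g)%g -> exists2 z, nbhd_frontier A r z &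
    exists2 K', K' <= K & lipschitz_path (nbhd_compl A r) (rv (k * g)%g) z K'.
  move=> Hk kfar; have [K1 K1K p1] := back k.
  have cg : nbhd_compl A r (rv (k * g)%g) by apply: (vfar _ kfar); rewrite mdistxx ltW.
  have r0 : 0 <= r by lra.
  have [z fz [K' K'K p']] := first_hit (rvA k Hk) cg r0 p1.
  by exists z => //; exists K' => //; apply: le_trans K1K.
have H1 : H 1%g by exact: is_subgroup1.
have [|z1 fz1 [K1 K1K p1]] := hit 1%g H1; first by rewrite mul1g.
have [z2 fz2 [K2 K2K p2]] := hit h Hh far_hg.
rewrite mul1g in p1.
have pz := lipschitz_path_trans (lipschitz_path_sym p1) (lipschitz_path_trans pj p2).
have lenr := length_dist_lipschitz pz.
have z12 : n%:R * r <= mdist z1 z2.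
  have [K3 K3K p3] := back 1%g; have [K4 K4K p4] := back h.
  rewrite mul1g in p3; have d1 := lipschitz_path_dist p1; have d2 := lipschitz_path_dist p2.
  have d3 := lipschitz_path_dist p3; have d4 := lipschitz_path_dist p4.
  have big : n%:R * r + 4 * K <= mdist (rv 1%g) (rv h).
    rewrite -(ler_pM2l Lp); apply: le_trans Z1 _; apply: le_trans (dle _ _).
    by rewrite ler_nat.
  have t1 := metric_triangle (rv 1%g) (rv g) (rv h).
  have t2 := metric_triangle (rv g) z1 (rv h).
  have t3 := metric_triangle z1 z2 (rv h).
  have t4 := metric_triangle z2 (rv (h * g)%g) (rv h).
  rewrite (metric_sym (rv 1%g) (rv g)) in t1; rewrite (metric_sym z2 (rv (h * g)%g)) in t4.
  lra.
apply: le_trans (_ : (K1 + (Kj + K2))%:E <= _)%E; last first.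
  rewrite lee_fin; apply: le_trans (_ : K + (K * ((dist 1 h)%:R + 1) + K) <= _).
    apply: lerD => //; apply: lerD => //; apply: le_trans KjL _.
    rewrite /K -(mulrA L%:R) natr1; apply: ler_wpM2l; first exact: ltW.
    by rewrite -!natrM ler_nat.
  apply: (@upper_arith L U E r n%:R N.+1%:R Z%:R) => //; rewrite ?ler0n //.
  - by rewrite -addn1 natrD; lra.
  - by rewrite -natrD ler_nat.
apply: le_trans (_ : length_dist (nbhd_compl A (rho * r)) z1 z2 <= _)%E.
  apply: ereal_inf_lbound; exists (z1, z2) => //=; split=> //.
  by apply: le_lt_trans lenr _; rewrite ltry.
(* The same path serves for [rho * r]: it stays at distance [r], and [rho] is at most 1. *)
apply: length_dist_lipschitz; apply: lipschitz_path_sub pz => z _.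
move=> /nbhd_complP cz; apply/nbhd_complP => a Aa; apply: le_trans (cz a Aa).
by rewrite ler_piMl //; lra.
Qed.

End Divergence.

Theorem theorem1p11 (R : realType) (T : finType) (e : rel T)
    (e_sym : symmetric e) (e_irr : irreflexive e)
    (e_conn : forall u v : T, connect e u v)
    (e_CFS : CFS e) (e_not_join : ~ is_join_graph e)
    (H : set (racg e)) (H_subgroup : is_subgroup H) (H_fin_gen : fin_gen H)
    (H_join_free : join_free H)
    (S : seq (racg e)) (S_gen : subgroup_gen [set` S] = setT) :
  exactly_quadratic (subgroup_divergence (R := R) S_gen H).
Proof.
pose X := SGraph e_sym e_irr.
exists 'X^2%R; split; first by rewrite size_polyXn.
  by move=> x _; rewrite hornerXn sqr_ge0.
have pE : (fun x : R => (('X^2 : {poly R}).[x])%:E)%R = (fun x => (x ^+ 2)%:E)%R.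
  by apply: funext => x; rewrite hornerXn.
split.
  exists 1%R, 1%N; split=> // rho n rho01 n2; rewrite mul1r pE.
  exact: (@divergence_upper R T X H H_subgroup H_fin_gen H_join_free e_CFS S S_gen rho n rho01 n2).
have [M [M0 low]] := @divergence_lower R T X H H_subgroup H_fin_gen H_join_free e_CFS S S_gen.
by exists 1%R, M; split=> // rho n rho01 n2; rewrite pE; apply: low.
Qed.
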